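(* The constructions $(\mathcal G,\mathcal S)\mapsto(G,\Sigma)$ (twisted groupoid of germs of a twisted Boolean inverse semigroup) and $(G,\Sigma)\mapsto(\mathrm{Bis}(G),\mathrm{Bis}(\Sigma))$ (twisted ample semigroup of a twisted Boolean groupoid) are functorial and give an equivalence of the category of twisted Boolean inverse semigroups and the category of twisted Boolean groupoids.
   Context: $\mathbb T$ is the group of complex numbers of modulus one. Inverse semigroup: each $s$ has a unique $s^*$ with $ss^*s=s$, $s^*ss^*=s^*$; $\mathcal G^{(0)}$ is the set of idempotents, $d(s)=s^*s$, $r(s)=ss^*$, $s\le t$ iff $s=te$ with $e$ idempotent; $(s,t)$ is orthogonal if $s^*t=st^*=0$. $\mathcal G$ (with zero) is Boolean if $\mathcal G^{(0)}$ is a Boolean algebra (possibly without unit) and every orthogonal pair has a join. A Boolean inverse semigroup morphism $j:\mathcal H\to\mathcal G$ is a semigroup homomorphism whose restriction $j^{(0)}$ to idempotents is a Boolean algebra homomorphism that is non-degenerate (every element of $\mathcal G^{(0)}$ is dominated by some $j(e)$, $e\in\mathcal H^{(0)}$). A Boolean space is a locally compact Hausdorff totally disconnected space; $\mathcal B(X)$ is the Boolean algebra of its compact open subsets. $\mathcal T(X)$ is the inverse semigroup under multiplication of continuous functions $h:\mathrm{supp}(h)\to\mathbb T$, $\mathrm{supp}(h)\in\mathcal B(X)$. Twisted Boolean inverse semigroup $(\mathcal G,\mathcal S)$: an inverse semigroup extension $\mathcal T\rightarrowtail\mathcal S\xrightarrow{p}\mathcal G$ ($p$ a surjective homomorphism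 identifying idempotents of $\mathcal S$ and $\mathcal G$, with $p^{-1}(\mathcal G^{(0)})=\mathcal T$) where $\mathcal G$ is Boolean, $\mathcal T=\mathcal T(X)$ with $X$ the dual space of $\mathcal G^{(0)}=\mathcal B(X)$, and $shs^*=h\circ\varphi_s^{-1}$ for $s\in\mathcal S$, $h\in\mathcal T$; here $\varphi_s:\mathrm{dom}(s)\to\mathrm{ran}(s)$ is the homeomorphism of compact open subsets of $X$ dual to $e\mapsto ses^*$. An arrow from $(\mathcal H,\mathcal S_{\mathcal H})$ to $(\mathcal G,\mathcal S)$ is a pair of Boolean inverse semigroup morphisms $j:\mathcal H\to\mathcal G$, $j_1:\mathcal S_{\mathcal H}\to\mathcal S$, compatible with the quotient maps and such that the restriction of $j_1$ to the kernels is the natural extension of $j^{(0)}$ (i.e. $h\mapsto h\circ\rho^{(0)}$, with $\rho^{(0)}$ the dual map of $j^{(0)}$). An étale groupoid is a locally compact groupoid (not necessarily Hausdorff, with Hausdorff unit space) whose range and domain maps $r,d$ are local homeomorphisms; it is Boolean if its unit space is a Boolean space. Twisted Boolean groupoid $(G,\Sigma)$: a central groupoid extension $X\times\mathbb T\rightarrowtail\Sigma\xrightarrow{p}G$ with common unit space $X$, $G$ Boolean, $\Sigma$ locally compact, $X\times\mathbb T$ (homeomorphically) locally closed in $\Sigma$, $p$ a continuous open surjection. An arrow from $(H,\Lambda)$ to $(G,\Sigma)$ is a multiplier action of $\Lambda$ on $\Sigma$ with proper anchor that is $\mathbb T$-equivariant: a continuous left action of $\Lambda$ on $\Sigma$ with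 continuous moment map $\rho:\Sigma\to\Lambda^{(0)}$, $(l,\sigma)\mapsto l\sigma$ for $d(l)=\rho(\sigma)$, with $l(\sigma\tau)=(l\sigma)\tau$, $(\theta l)\sigma=l(\theta\sigma)$ for $\theta\in\mathbb T$, and such that the anchor $\rho^{(0)}=\rho_{|\Sigma^{(0)}}:G^{(0)}\to H^{(0)}$ is proper. Composition of an action of $K$ on $\Lambda$ (moment map $\sigma$) with an action of $\Lambda$ on $\Sigma$ (moment map $\rho$): moment map $\sigma^{(0)}\circ\rho$, action $\kappa\gamma=(\kappa\rho(\gamma))\gamma$. $\mathrm{Bis}(\Sigma)$ (resp. $\mathrm{Bis}(G)$) is the inverse semigroup of compact continuous bisections, i.e. compact subsets $S$ such that $r_{|S},d_{|S}$ are homeomorphisms onto open subsets of the unit space (for étale $G$: compact open bisections). On arrows, a $\mathbb T$-equivariant multiplier action of $\Lambda$ on $\Sigma$ with proper anchor $\rho^{(0)}:G^{(0)}\to H^{(0)}$ (an arrow from $(H,\Lambda)$ to $(G,\Sigma)$) gives the map $j_1:\mathrm{Bis}(\Lambda)\to\mathrm{Bis}(\Sigma)$, $j_1(S)=\{l\,x:l\in S,\ x\in G^{(0)},\ \rho^{(0)}(x)=d(l)\}$ ($x$ identified with the unit of $\Sigma$), and $j:\mathrm{Bis}(H)\to\mathrm{Bis}(G)$ is defined similarly by the quotient action of $H$ on $G$. Twisted groupoid of germs of $(\mathcal G,\mathcal S)$: on pairs $(s,x)$, $s\in\mathcal S$, $x\in\mathrm{dom}(s)$, $(s,x)\sim(t,y)$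 iff $x=y$ and $sa=tb$ with $a,b\in\mathcal T(X)$, $a(x)=b(x)=1$; $(s,x)\approx(t,y)$ iff $x=y$ and $sa=tb$ with $a,b\in\mathcal T(X)$, $|a(x)|=|b(x)|=1$. $\Sigma$ is the set of classes $[s,x]$ for $\sim$, $G$ the set of classes $[[s,x]]$ for $\approx$; $[s,\varphi_t(x)][t,x]=[st,x]$, $[s,x]^{-1}=[s^*,\varphi_s(x)]$, same for $[[\cdot]]$; $[s,x]\theta=[sc,x]$ for $c\in\mathcal T(X)$, $c(x)=\theta$. Basic open sets: $\{[[s,x]]:x\in\mathrm{dom}(s)\cap U\}$ ($U\subset X$ open) for $G$, and $\{[s,x]:x\in\mathrm{dom}(s)\}W$ ($W\subset\mathbb T$ open) for $\Sigma$. On arrows, $(j,j_1)$ gives the action with anchor $\rho^{(0)}$ dual to $j^{(0)}$ and $[s,\rho^{(0)}(\varphi_t(x))][t,x]=[j_1(s)t,x]$. *)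

(* Defs.v *)
From HB Require Import structures.
From mathcomp Require Import all_boot all_order all_algebra.
From mathcomp Require Import all_classical all_reals all_analysis.
From mathcomp Require Import complex.
Import numFieldNormedType.Exports.

Set Implicit Arguments.
Unset Strict Implicit.
Unset Printing Implicit Defensive.

Import Order.TTheory GRing.Theory Num.Theory.
Local Open Scope classical_set_scope.
Local Open Scope ring_scope.

Record category := Category {
  ob :> Type;
  hom : ob -> ob -> Type;
  idm : forall a, hom a a;
  cmp : forall a b c, hom b c -> hom a b -> hom a c;
  cmp1f : forall a b (f : hom a b), cmp (idm b) f = f;
  cmpf1 : forall a b (f : hom a b), cmp f (idm a) = f;
  cmpA : forall a b c d (h : hom c d) (g : hom b c) (f : hom a b),
    cmp h (cmp g f) = cmp (cmp h g) f }.
Arguments hom {_} _ _.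
Arguments idm {_} _.
Arguments cmp {_ _ _ _} _ _.

Record functor_data (C D : category) := FunctorData {
  fob :> C -> D;
  fhom : forall a b : C, hom a b -> hom (fob a) (fob b) }.
Arguments fhom {C D} _ {a b}.

Record is_functor (C D : category) (F : functor_data C D) : Prop := IsFunctor {
  functor_id : forall a : C, fhom F (idm a) = idm (F a);
  functor_cmp : forall (a b c : C) (g : hom b c) (f : hom a b),
    fhom F (cmp g f) = cmp (fhom F g) (fhom F f) }.

Definition functor_idm (C : category) : functor_data C C :=
  FunctorData (fun (a b : C) (f : hom a b) => f).

Definition functor_comp (C D E : category) (G : functor_data D E)
    (F : functor_data C D) : functor_data C E :=
  @FunctorData C E (fun a => G (F a)) (fun a b f => fhom G (fhom F f)).

Definition is_iso (C : category) (a b : C) (f : hom a b) : Prop :=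
  exists2 g : hom b a, cmp g f = idm a & cmp f g = idm b.

Definition naturally_isomorphic (C D : category) (F G : functor_data C D) :=
  exists eta : forall a : C, hom (F a) (G a),
    (forall a, is_iso (eta a)) /\
    (forall (a b : C) (f : hom a b),
       cmp (eta b) (fhom F f) = cmp (fhom G f) (eta a)).

Definition is_equivalence (C D : category)
    (F : functor_data C D) (G : functor_data D C) : Prop :=
  [/\ is_functor F, is_functor G,
      naturally_isomorphic (functor_comp G F) (functor_idm C) &
      naturally_isomorphic (functor_comp F G) (functor_idm D)].

Record sg_data := SgData {
  sg_car :> Type;
  sg_mul : sg_car -> sg_car -> sg_car;
  sg_star : sg_car -> sg_car;
  sg_zero : sg_car }.
Arguments sg_zero {s}.

Notation "s ** t" := (sg_mul s t) (at level 40, left associativity).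
Notation "s ^-*" := (sg_star s) (at level 2, format "s ^-*").

Record inverse_semigroup (S : sg_data) : Prop := InverseSemigroup {
  sgA : forall s t u : S, s ** (t ** u) = (s ** t) ** u;
  sg0s : forall s : S, sg_zero ** s = sg_zero;
  sgs0 : forall s : S, s ** sg_zero = sg_zero;
  sg_starK : forall s : S, s ** s^-* ** s = s;
  sg_starV : forall s : S, s^-* ** s ** s^-* = s^-*;
  sg_star_uniq : forall s t : S, s ** t ** s = s -> t ** s ** t = t -> t = s^-* }.

Section SemigroupNotions.
Variable S : sg_data.
Implicit Types s t e f : S.

Definition idem : set S := [set e | e ** e = e].

Definition sg_le s t := exists2 e, idem e & s = t ** e.

Definition orthogonal s t := s^-* ** t = sg_zero /\ s ** t^-* = sg_zero.

(* [g] is the least upper bound of [s] and [t] inside [E] *)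
Definition is_join (E : set S) s t g :=
  [/\ E g, sg_le s g, sg_le t g &
      forall k, E k -> sg_le s k -> sg_le t k -> sg_le g k].

End SemigroupNotions.
Arguments idem {S}.

(* The meet of two idempotents is their product; [bool_diff] provides the
   relative complement of [e] in [f] (there need not be a unit). *)
Record boolean_idem (S : sg_data) : Prop := BooleanIdem {
  bool_join : forall e f : S, idem e -> idem f -> exists g, is_join idem e f g;
  bool_distr : forall e f g k : S, idem e -> idem f -> idem g ->
    is_join idem f g k -> is_join idem (e ** f) (e ** g) (e ** k);
  bool_diff : forall e f : S, idem e -> idem f ->
    exists g, [/\ idem g, g ** e = sg_zero & is_join idem (e ** f) g f] }.

Record boolean_isg (G : sg_data) : Prop := BooleanIsg {
  bisg_isg : inverse_semigroup G;
  bisg_bool : boolean_idem G;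
  bisg_join : forall s t : G, orthogonal s t -> exists u, is_join setT s t u }.

(* Relative complements are preserved as soon as 0, meets and joins are. *)
Record boolean_morphism (H G : sg_data) (j : H -> G) : Prop := BooleanMorphism {
  bmorM : forall s t : H, j (s ** t) = j s ** j t;
  bmor0 : j sg_zero = sg_zero;
  bmor_join : forall e f g : H, idem e -> idem f ->
    is_join idem e f g -> is_join idem (j e) (j f) (j g);
  bmor_nondeg : forall e : G, idem e -> exists2 f : H, idem f & sg_le e (j f) }.

(* A nonzero Boolean homomorphism from the idempotents to {0, 1}, given by the
   ultrafilter of the idempotents of value 1 *)
Record boolean_character (G : sg_data) (x : set G) : Prop := BooleanCharacter {
  char_sub : x `<=` idem;
  char_neq0 : exists e, x e;
  char_0 : ~ x sg_zero;
  char_meet : forall e f, idem e -> idem f -> x (e ** f) <-> x e /\ x f;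
  char_join : forall e f g, idem e -> idem f -> is_join idem e f g ->
    x g <-> x e \/ x f }.

Definition dual (G : sg_data) : Type := {x : set G | boolean_character x}.

Definition ideal_open (G : sg_data) (e : G) : set (dual G) :=
  [set x | sval x e].

HB.instance Definition _ (G : sg_data) := gen_eqMixin (dual G).
HB.instance Definition _ (G : sg_data) := gen_choiceMixin (dual G).
HB.instance Definition _ (G : sg_data) :=
  @isSubBaseTopological.Build (dual G) (set (dual G))
    [set U | exists2 e : G, idem e & U = ideal_open e] id.

Definition isg_dom (G : sg_data) (s : G) : set (dual G) := ideal_open (s^-* ** s).
Definition isg_ran (G : sg_data) (s : G) : set (dual G) := ideal_open (s ** s^-*).

(* For [x] in [isg_dom s], [phi s x] is the unique character whose pull-back
   along the map e |-> s e s^* is [x]; the value outside [isg_dom s] is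
   irrelevant. *)
Definition phi (G : sg_data) (s : G) (x : dual G) : dual G :=
  xget x [set y | forall e, idem e -> sval x e <-> sval y (s ** e ** s^-*)].

Section Twisted.
Variable R : realType.

Definition C : numFieldType := R[i].

Definition circle : set C := [set z | `|z| = 1].

(* The inverse semigroup T(X), each h : supp(h) -> circle being extended by 0
   outside its support; the multiplication is then the pointwise one. *)
Record is_TX (X : topologicalType) (h : X -> C) : Prop := IsTX {
  TX_compact : compact [set x | h x != 0];
  TX_open : open [set x | h x != 0];
  TX_circle : forall x, h x != 0 -> circle (h x);
  TX_cont : {within [set x | h x != 0], continuous h} }.

Definition indicator (X : Type) (U : set X) (x : X) : C := (x \in U)%:R.

(* [tbG], [tbS], [tbp] are the calligraphic G, S and p; [tbi] is the
   embedding of T(X) into S, whose values outside T(X) are irrelevant. *)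
Record tbis_data := TbisData {
  tbG : sg_data;
  tbS : sg_data;
  tbp : tbS -> tbG;
  tbi : (dual tbG -> C) -> tbS }.

(* h o phi_s^-1, extended by 0, where phi_s^-1 = phi_{s^-*} on the range *)
Definition push (G : sg_data) (s : G) (h : dual G -> C) : dual G -> C :=
  fun y => if `[< isg_ran s y >] then h (phi s^-* y) else 0.

Record is_tbis (D : tbis_data) : Prop := IsTbis {
  tbisG : boolean_isg (tbG D);
  tbisS : inverse_semigroup (tbS D);
  tbisM : forall s t : tbS D, tbp (s ** t) = tbp s ** tbp t;
  tbis_surj : forall g : tbG D, exists s, tbp s = g;
  tbis_idem : forall e f : tbS D, idem e -> idem f -> tbp e = tbp f -> e = f;
  tbis_iM : forall h k, is_TX h -> is_TX k ->
    tbi (fun x => h x * k x) = tbi h ** tbi k :> tbS D;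
  tbis_i_inj : forall h k, is_TX h -> is_TX k ->
    tbi h = tbi k :> tbS D -> h = k;
  tbis_ker : forall s : tbS D, idem (tbp s) <-> exists2 h, is_TX h & tbi h = s;
  tbis_i1 : forall e : tbG D, idem e ->
    tbp (tbi (indicator (ideal_open e)) : tbS D) = e;
  tbis_covariant : forall (s : tbS D) h, is_TX h ->
    s ** tbi h ** s^-* = tbi (push (tbp s) h) }.

(* The map [rho] dual to the restriction of [j] to the idempotents *)
Definition is_dual_map (H G : sg_data) (j : H -> G) (rho : dual G -> dual H) :=
  forall (x : dual G) (e : H), idem e -> sval (rho x) e <-> sval x (j e).

Record tbis_arrow_data (D D' : tbis_data) := TbisArrowData {
  tbj : tbG D -> tbG D';
  tbj1 : tbS D -> tbS D' }.

Record is_tbis_arrow (D D' : tbis_data) (f : tbis_arrow_data D D') : Prop :=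
  IsTbisArrow {
  tba_j : boolean_morphism (tbj f);
  tba_j1 : boolean_morphism (tbj1 f);
  tba_p : forall s, tbp (tbj1 f s) = tbj f (tbp s);
  tba_ker : exists2 rho, is_dual_map (tbj f) rho &
    forall h, is_TX h ->
      is_TX (h \o rho) /\ tbj1 f (tbi h) = tbi (h \o rho) }.

Record tbis := Tbis { tbis_dat :> tbis_data; tbisP : is_tbis tbis_dat }.

Record tbis_arrow (D D' : tbis) := TbisArrow {
  tba_dat :> tbis_arrow_data D D'; tbaP : is_tbis_arrow tba_dat }.

Lemma tbis_arrow_eq (D D' : tbis) (f g : tbis_arrow D D') :
  tbj f = tbj g -> tbj1 f = tbj1 g -> f = g.
Proof.
case: f g => [[j j1] fP] [[k k1] gP] /= e e1; subst k k1.
by congr TbisArrow; exact: Prop_irrelevance.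
Qed.

Lemma tbis_id_subproof (D : tbis) :
  is_tbis_arrow (@TbisArrowData D D id id).
Proof.
have bid (S : sg_data) : (forall e : S, idem e -> sg_le e e) ->
    @boolean_morphism S S id.
  by move=> le; split=> // e Ee; exists e => //; exact: le.
have le (S : sg_data) (e : S) : idem e -> sg_le e e.
  by move=> Ee; exists e => //; rewrite Ee.
split=> //=; [exact/bid/le|exact/bid/le|].
by exists id.
Qed.

Definition tbis_id (D : tbis) : tbis_arrow D D :=
  TbisArrow (tbis_id_subproof D).

Lemma boolean_morphism_idem (H G : sg_data) (j : H -> G) e :
  boolean_morphism j -> idem e -> idem (j e).
Proof. by move=> bj Ee; rewrite /idem /= -bmorM// Ee. Qed.

Lemma boolean_morphism_comp (H G K : sg_data) (k : G -> K) (j : H -> G) :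
  (forall s t u : K, s ** (t ** u) = (s ** t) ** u) ->
  (forall e f : K, idem e -> idem f -> idem (e ** f)) ->
  boolean_morphism k -> boolean_morphism j -> boolean_morphism (k \o j).
Proof.
move=> KA KM bk bj; split=> /=.
- by move=> s t; rewrite !bmorM.
- by rewrite !bmor0.
- move=> e f g Ee Ef efg; apply: (bmor_join bk);
    [exact: boolean_morphism_idem|exact: boolean_morphism_idem|].
  exact: (bmor_join bj).
- move=> e Ee; have [f Ef [e' Ee' ef]] := bmor_nondeg bk Ee.
  have [g Eg [g' Eg' fg]] := bmor_nondeg bj Ef.
  exists g => //; exists (k g' ** e').
    by apply: KM => //; exact: boolean_morphism_idem.
  by rewrite ef fg bmorM// KA.
Qed.

Lemma inverse_semigroup_idemM (S : sg_data) (e f : S) :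
  inverse_semigroup S -> idem e -> idem f -> idem (e ** f).
Proof.
move=> iS; rewrite /idem /= => Ee Ef.
have A := sgA iS.
(* x = (ef)^*; f x e is an inverse of ef and is idempotent, so x is idempotent
   and equal to its own inverse ef *)
set x := (e ** f)^-*.
have xK : e ** f ** x ** e ** f = e ** f.
  by have := sg_starK iS (e ** f); rewrite -/x !A.
have xV : x ** e ** f ** x = x.
  by have := sg_starV iS (e ** f); rewrite -/x !A.
have fxe : f ** x ** e = x.
  apply: (sg_star_uniq iS (s := e ** f)); rewrite !A.
    by rewrite -(A e f f) Ef -(A _ e e) Ee xK.
  rewrite -(A (f ** x) e e) Ee -(A (f ** x ** e) f f) Ef.
  by rewrite -(A f x e) -(A f _ f) -(A f _ x) xV.
have Ex : x ** x = x.
  have : (f ** x ** e) ** (f ** x ** e) = f ** x ** e.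
    by rewrite !A -(A f x e) -(A f _ f) -(A f _ x) xV.
  by rewrite fxe.
have xx : e ** f = x.
  rewrite [RHS](_ : x = x^-*); last first.
    by apply: (sg_star_uniq iS); rewrite Ex Ex.
  by apply: (sg_star_uniq iS); rewrite !A.
by rewrite xx.
Qed.

Lemma tbis_comp_subproof (D1 D2 D3 : tbis)
    (g : tbis_arrow D2 D3) (f : tbis_arrow D1 D2) :
  is_tbis_arrow (@TbisArrowData D1 D3 (tbj g \o tbj f) (tbj1 g \o tbj1 f)).
Proof.
have [fj fj1 fp [rf rfE fi]] := tbaP f.
have [gj gj1 gp [rg rgE gi]] := tbaP g.
have iG := bisg_isg (tbisG (tbisP D3)).
have iS := tbisS (tbisP D3).
have iG2 := bisg_isg (tbisG (tbisP D2)).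
split=> /=.
- apply: boolean_morphism_comp => //; first exact: (sgA iG).
  by move=> e e'; exact: inverse_semigroup_idemM.
- apply: boolean_morphism_comp => //; first exact: (sgA iS).
  by move=> e e'; exact: inverse_semigroup_idemM.
- by move=> s; rewrite gp fp.
- exists (rf \o rg) => [x e Ee|h hT] /=.
    rewrite rfE// rgE//; exact: boolean_morphism_idem.
  have [hfT ->] := fi _ hT.
  by have [? ->] := gi _ hfT.
Qed.


Definition tbis_comp (D1 D2 D3 : tbis)
    (g : tbis_arrow D2 D3) (f : tbis_arrow D1 D2) : tbis_arrow D1 D3 :=
  TbisArrow (tbis_comp_subproof g f).

Definition TBIS : category.
Proof.
refine (@Category tbis tbis_arrow tbis_id tbis_comp _ _ _);
  by move=> *; exact: tbis_arrow_eq.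
Defined.

(* A groupoid with unit space [X], [gu] being the inclusion of the units;
   [gm g h] is meaningful when [gd g = gr h]. *)
Record gpd_data (X : topologicalType) := GpdData {
  garr :> topologicalType;
  gd : garr -> X;
  gr : garr -> X;
  gu : X -> garr;
  gm : garr -> garr -> garr;
  gi : garr -> garr }.
Arguments gu {X g}.

Record topological_groupoid (X : topologicalType) (G : gpd_data X) : Prop :=
  TopologicalGroupoid {
  gd_u : forall x : X, gd (gu x : G) = x;
  gr_u : forall x : X, gr (gu x : G) = x;
  gd_m : forall g h : G, gd g = gr h -> gd (gm g h) = gd h;
  gr_m : forall g h : G, gd g = gr h -> gr (gm g h) = gr g;
  gmA : forall g h k : G, gd g = gr h -> gd h = gr k ->
    gm g (gm h k) = gm (gm g h) k;
  gm1g : forall g : G, gm (gu (gr g)) g = g;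
  gmg1 : forall g : G, gm g (gu (gd g)) = g;
  gd_i : forall g : G, gd (gi g) = gr g;
  gr_i : forall g : G, gr (gi g) = gd g;
  gmVg : forall g : G, gm (gi g) g = gu (gd g);
  gmgV : forall g : G, gm g (gi g) = gu (gr g);
  gd_cont : continuous (@gd X G);
  gr_cont : continuous (@gr X G);
  gu_cont : continuous (@gu X G);
  gi_cont : continuous (@gi X G);
  gm_cont : {within [set z : G * G | gd z.1 = gr z.2],
               continuous (fun z => gm z.1 z.2)} }.

(* For spaces which need not be Hausdorff; the definition of the library asks
   for closed compact neighbourhoods. *)
Definition has_compact_nbhs (X : topologicalType) :=
  forall (x : X) (U : set X), nbhs x U ->
    exists K, [/\ nbhs x K, compact K & K `<=` U].

Definition homeo_on (A B : topologicalType) (f : A -> B) (S : set A) :=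
  {within S, continuous f} /\
  exists2 g : B -> A, (forall a, S a -> g (f a) = a) &
    {within f @` S, continuous g}.

Definition homeo_onto_open (A B : topologicalType) (f : A -> B) (S : set A) :=
  homeo_on f S /\ open (f @` S).

Definition local_homeo (A B : topologicalType) (f : A -> B) :=
  forall a, exists U, [/\ open U, U a & homeo_onto_open f U].

Definition locally_closed (X : topologicalType) (A : set X) :=
  exists O F, [/\ open O, closed F & A = O `&` F].

Record boolean_space (X : topologicalType) : Prop := BooleanSpace {
  bs_lc : locally_compact [set: X];
  bs_hausdorff : hausdorff_space X;
  bs_td : totally_disconnected [set: X] }.

Record boolean_groupoid (X : topologicalType) (G : gpd_data X) : Prop :=
  BooleanGroupoid {
  bgpd_gpd : topological_groupoid G;
  bgpd_lc : has_compact_nbhs G;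
  bgpd_d : local_homeo (@gd X G);
  bgpd_r : local_homeo (@gr X G);
  bgpd_X : boolean_space X }.

(* [tgi x z] is the image of (x, z) for [z] in the circle, and is irrelevant
   otherwise. *)
Record tgpd_data := TgpdData {
  tgX : topologicalType;
  tgG : gpd_data tgX;
  tgS : gpd_data tgX;
  tgp : tgS -> tgG;
  tgi : tgX -> C -> tgS }.

(* The element z s of Sigma, the circle acting through X x T *)
Definition tsc (D : tgpd_data) (z : C) (s : tgS D) : tgS D :=
  gm (tgi (gr s) z) s.

Definition XT (X : topologicalType) : set (X * C) := [set u | circle u.2].
Arguments XT : clear implicits.

Record is_tgpd (D : tgpd_data) : Prop := IsTgpd {
  tgpdG : boolean_groupoid (tgG D);
  tgpdS : topological_groupoid (tgS D);
  tgpdS_lc : has_compact_nbhs (tgS D);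
  tgpd_d : forall s : tgS D, gd (tgp s) = gd s;
  tgpd_r : forall s : tgS D, gr (tgp s) = gr s;
  tgpd_pM : forall s t : tgS D, gd s = gr t -> tgp (gm s t) = gm (tgp s) (tgp t);
  tgpd_surj : forall g : tgG D, exists s, tgp s = g;
  tgpd_cont : continuous (@tgp D);
  tgpd_open : forall U : set (tgS D), open U -> open (@tgp D @` U);
  tgpd_di : forall (x : tgX D) z, circle z -> gd (tgi x z : tgS D) = x;
  tgpd_ri : forall (x : tgX D) z, circle z -> gr (tgi x z : tgS D) = x;
  tgpd_iM : forall (x : tgX D) z w, circle z -> circle w ->
    tgi x (z * w) = gm (tgi x z) (tgi x w) :> tgS D;
  tgpd_i1 : forall x : tgX D, tgi x 1 = gu x :> tgS D;
  tgpd_ihomeo : homeo_on (fun u => tgi u.1 u.2 : tgS D) (XT (tgX D));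
  tgpd_iclosed : locally_closed ((fun u => tgi u.1 u.2 : tgS D) @` XT (tgX D));
  tgpd_ker : forall s : tgS D, tgp s = gu (gr s) <->
    exists2 z, circle z & s = tgi (gr s) z;
  tgpd_central : forall (s : tgS D) z, circle z ->
    gm (tgi (gr s) z) s = gm s (tgi (gd s) z) }.

(* An action of Lambda on Sigma with moment map [tanc]; [tact l s] is
   meaningful when [gd l = tanc s]. *)
Record tgpd_arrow_data (D D' : tgpd_data) := TgpdArrowData {
  tanc : tgS D' -> tgX D;
  tact : tgS D -> tgS D' -> tgS D' }.

Definition anchor0 (D D' : tgpd_data) (f : tgpd_arrow_data D D') :
    tgX D' -> tgX D :=
  fun x => tanc f (gu x).

(* [tga_junk] only normalizes [tact] where the action is not defined, so that
   the equality of arrows is that of their moment maps and actions. *)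
Record is_tgpd_arrow (D D' : tgpd_data) (f : tgpd_arrow_data D D') : Prop :=
  IsTgpdArrow {
  tga_anc_cont : continuous (tanc f);
  tga_act_cont : {within [set z : tgS D * tgS D' | gd z.1 = tanc f z.2],
    continuous (fun z => tact f z.1 z.2)};
  tga_anc : forall l s, gd l = tanc f s -> tanc f (tact f l s) = gr l;
  tga_1 : forall s, tact f (gu (tanc f s)) s = s;
  tga_M : forall l m s, gd l = gr m -> gd m = tanc f s ->
    tact f (gm l m) s = tact f l (tact f m s);
  tga_ancM : forall s t, gd s = gr t -> tanc f (gm s t) = tanc f s;
  tga_d : forall l s, gd l = tanc f s -> gd (tact f l s) = gd s;
  tga_mult : forall l s t, gd l = tanc f s -> gd s = gr t ->
    tact f l (gm s t) = gm (tact f l s) t;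
  tga_equi : forall l s z, circle z -> gd l = tanc f s ->
    tact f (tsc z l) s = tact f l (tsc z s);
  tga_proper : forall K, compact K -> compact (anchor0 f @^-1` K);
  tga_junk : forall l s, gd l <> tanc f s -> tact f l s = s }.

Record tgpd := Tgpd { tgpd_dat :> tgpd_data; tgpdP : is_tgpd tgpd_dat }.

Record tgpd_arrow (D D' : tgpd) := TgpdArrow {
  tga_dat :> tgpd_arrow_data D D'; tgaP : is_tgpd_arrow tga_dat }.

Lemma tgpd_arrow_eq (D D' : tgpd) (f g : tgpd_arrow D D') :
  tanc f = tanc g -> (forall l s, tact f l s = tact g l s) -> f = g.
Proof.
case: f g => [[r a] fP] [[r' a'] gP] /= e e1.
have {}e1 : a = a' by apply/funext => l; apply/funext => s; exact: e1.
subst r' a'.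
by congr TgpdArrow; exact: Prop_irrelevance.
Qed.

Lemma within_continuous_comp (A B E : topologicalType) (S : set A) (T : set B)
    (f : A -> B) (g : B -> E) :
  (forall a, S a -> T (f a)) ->
  {within S, continuous f} -> {within T, continuous g} ->
  {within S, continuous (g \o f)}.
Proof.
move=> ST /subspace_continuousP cf /subspace_continuousP cg.
apply/subspace_continuousP => a Sa U /= nU.
have /= nV := cg _ (ST _ Sa) _ nU.
have := cf _ Sa _ nV; rewrite !nbhs_simpl /= /within /=.
by apply: filterS => a' h Sa'; apply: h => //; exact: ST.
Qed.

Lemma within_continuous_pair (A B E : topologicalType) (S : set A)
    (f : A -> B) (g : A -> E) :
  {within S, continuous f} -> {within S, continuous g} ->
  {within S, continuous (fun a => (f a, g a))}.
Proof.
move=> /subspace_continuousP cf /subspace_continuousP cg.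
apply/subspace_continuousP => a Sa.
by apply: cvg_pair; [exact: cf|exact: cg].
Qed.

Lemma tgpd_id_subproof (D : tgpd) :
  is_tgpd_arrow (@TgpdArrowData D D (@gr _ (tgS D))
    (fun l s => if `[< gd l = gr s >] then gm l s else s)).
Proof.
have S := tgpdS (tgpdP D).
have aE (l s : tgS D) : gd l = gr s ->
    (if `[< gd l = gr s >] then gm l s else s) = gm l s.
  by move=> ls; case: asboolP.
split=> /=.
- exact: gr_cont.
- apply: (subspace_eq_continuous (f := fun z => gm z.1 z.2)) => [z|].
    by rewrite inE /= => zz; rewrite /from_subspace /= aE.
  exact: gm_cont.
- by move=> l s ls; rewrite aE// gr_m.
- by move=> s; rewrite aE ?gd_u// gm1g.
- move=> l m s lm ms; rewrite (aE m)//.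
  by rewrite !aE ?gmA// ?gd_m ?gr_m.
- by move=> s t st; rewrite gr_m.
- by move=> l s ls; rewrite aE// gd_m.
- by move=> l s t ls st; rewrite !aE ?gmA// gr_m.
- move=> l s z cz ls; rewrite /tsc.
  have P := tgpdP D.
  rewrite !aE.
  + rewrite (tgpd_central P)// -gmA ?(tgpd_ri P)// ?(tgpd_di P)//.
    by rewrite ls.
  + by rewrite gr_m ?(tgpd_ri P) ?(tgpd_di P).
  + by rewrite gd_m ?(tgpd_di P).
- move=> K cK; rewrite (_ : _ @^-1` K = K)//.
  by rewrite /anchor0 /=; apply/seteqP; split=> x /=; rewrite gr_u.
- by move=> l s ls; case: asboolP.
Qed.

Definition tgpd_id (D : tgpd) : tgpd_arrow D D :=
  TgpdArrow (tgpd_id_subproof D).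

Lemma tgpd_comp_subproof (D1 D2 D3 : tgpd)
    (g : tgpd_arrow D2 D3) (f : tgpd_arrow D1 D2) :
  is_tgpd_arrow (@TgpdArrowData D1 D3 (anchor0 f \o tanc g)
    (fun l s => tact g (tact f l (gu (tanc g s))) s)).
Proof.
have S1 := tgpdS (tgpdP D1); have S2 := tgpdS (tgpdP D2).
have S3 := tgpdS (tgpdP D3).
have F := tgaP f; have G := tgaP g.
have dfu l y : gd l = anchor0 f y -> gd (tact f l (gu y)) = y.
  by move=> ly; rewrite (tga_d F)// gd_u.
have anc_r s : tanc f s = anchor0 f (gr s).
  by rewrite /anchor0 -{1}(gm1g S2 s) (tga_ancM F)// gd_u.
have rfu l y : gd l = anchor0 f y -> anchor0 f (gr (tact f l (gu y))) = gr l.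
  by move=> ly; rewrite -anc_r (tga_anc F).
have anc_sc (z : C) (s : tgS D3) : circle z -> tanc g (tsc z s) = tanc g s.
  move=> cz; rewrite /tsc (tgpd_central (tgpdP D3))// (tga_ancM G)//.
  by rewrite (tgpd_ri (tgpdP D3)).
split=> /=.
- move=> s; apply: continuous_comp; first exact: (tga_anc_cont G).
  apply: (@continuous_comp _ _ _ gu (tanc f)); first exact: (gu_cont S2).
  exact: (tga_anc_cont F).
- pose T := [set z : tgS D1 * tgS D3 | gd z.1 = (anchor0 f \o tanc g) z.2].
  have c1 : {within T, continuous (fun z : tgS D1 * tgS D3 => z.1)}.
    by apply: continuous_subspaceT => z; exact: cvg_fst.
  have c2 : {within T, continuous (fun z : tgS D1 * tgS D3 => z.2)}.
    by apply: continuous_subspaceT => z; exact: cvg_snd.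
  have c3 : {within T, continuous
      (fun z : tgS D1 * tgS D3 => gu (tanc g z.2) : tgS D2)}.
    apply: continuous_subspaceT => z.
    apply: (@continuous_comp _ _ _ (fun z : tgS D1 * tgS D3 => tanc g z.2) gu);
      last exact: (gu_cont S2).
    apply: (@continuous_comp _ _ _ snd (tanc g)); first exact: cvg_snd.
    exact: (tga_anc_cont G).
  have c4 : {within T, continuous
      (fun z : tgS D1 * tgS D3 => tact f z.1 (gu (tanc g z.2)))}.
    apply: (within_continuous_comp
      (f := fun z : tgS D1 * tgS D3 => (z.1, gu (tanc g z.2) : tgS D2))
      (g := fun w => tact f w.1 w.2) _ _ (tga_act_cont F)).
      by move=> z; rewrite /T /= => ->.
    exact: within_continuous_pair.
  apply: (within_continuous_comp
    (f := fun z : tgS D1 * tgS D3 => (tact f z.1 (gu (tanc g z.2)), z.2))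
    (g := fun w => tact g w.1 w.2) _ _ (tga_act_cont G)).
    by move=> z; rewrite /= => zz; rewrite dfu.
  exact: within_continuous_pair.
- by move=> l s ls; rewrite (tga_anc G) ?dfu// rfu.
- by move=> s; rewrite (tga_1 F (gu (tanc g s))) (tga_1 G).
- move=> l m s lm ms; rewrite (tga_M F)//.
  set m' := tact f m (gu (tanc g s)).
  have dm' : gd m' = tanc g s by rewrite dfu.
  rewrite (tga_anc G)// -(tga_M G)//; last by rewrite dfu// rfu.
  rewrite -(tga_mult F) ?gm1g ?gd_u//.
  by rewrite -/(anchor0 f _) rfu.
- by move=> s t st; rewrite (tga_ancM G).
- by move=> l s ls; rewrite (tga_d G)// dfu.
- by move=> l s t ls st; rewrite (tga_ancM G)// (tga_mult G)// dfu.
- move=> l s z cz ls; rewrite anc_sc//.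
  rewrite (tga_equi F)//.
  have -> : tsc z (gu (tanc g s)) = gm (gu (tanc g s)) (tgi (tanc g s) z) :> tgS D2.
    by rewrite /tsc (tgpd_central (tgpdP D2))// gd_u.
  rewrite (tga_mult F) ?gd_u ?(tgpd_ri (tgpdP D2))//.
  have -> : gm (tact f l (gu (tanc g s))) (tgi (tanc g s) z) =
            tsc z (tact f l (gu (tanc g s))).
    by rewrite /tsc (tgpd_central (tgpdP D2))// dfu.
  by rewrite (tga_equi G)// dfu.
- move=> K cK; rewrite (_ : _ @^-1` K = anchor0 g @^-1` (anchor0 f @^-1` K))//.
  by apply: (tga_proper G); exact: (tga_proper F).
- move=> l s ls; rewrite (tga_junk F)// (tga_1 G)//.
Qed.

Definition tgpd_comp (D1 D2 D3 : tgpd)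
    (g : tgpd_arrow D2 D3) (f : tgpd_arrow D1 D2) : tgpd_arrow D1 D3 :=
  TgpdArrow (tgpd_comp_subproof g f).

Lemma tgpd_anchorE (a b : tgpd) (f : tgpd_arrow a b) s :
  tanc f s = tanc f (gu (gr s)).
Proof.
have Sb := tgpdS (tgpdP b).
by rewrite -{1}(gm1g Sb s) (tga_ancM (tgaP f))// (gd_u Sb).
Qed.

Lemma tgpd_1f (a b : tgpd) (f : tgpd_arrow a b) : tgpd_comp (tgpd_id b) f = f.
Proof.
have Sb := tgpdS (tgpdP b); have F := tgaP f.
apply: tgpd_arrow_eq => /= [|l s].
  by apply/funext => s; rewrite /anchor0 /= -tgpd_anchorE.
have [ls|ls] := pselect (gd l = tanc f (gu (gr s))).
  rewrite (tga_d F)// (gd_u Sb); case: asboolP => // _.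
  by rewrite -(tga_mult F) ?(gd_u Sb)// (gm1g Sb).
rewrite (tga_junk F)// (gd_u Sb); case: asboolP => // _.
by rewrite (gm1g Sb) (tga_junk F)// tgpd_anchorE.
Qed.

Lemma tgpd_f1 (a b : tgpd) (f : tgpd_arrow a b) : tgpd_comp f (tgpd_id a) = f.
Proof.
have Sa := tgpdS (tgpdP a); have F := tgaP f.
apply: tgpd_arrow_eq => /= [|l s].
  by apply/funext => s; rewrite /= /anchor0 /= (gr_u Sa).
rewrite (gr_u Sa); case: asboolP => [ls|ls].
  by rewrite -ls (gmg1 Sa).
by rewrite (tga_1 F) (tga_junk F).
Qed.

Lemma tgpd_compA (a b c d : tgpd) (h : tgpd_arrow c d) (g : tgpd_arrow b c)
    (f : tgpd_arrow a b) :
  tgpd_comp h (tgpd_comp g f) = tgpd_comp (tgpd_comp h g) f.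
Proof. by apply: tgpd_arrow_eq. Qed.

Definition TBG : category := Category tgpd_1f tgpd_f1 tgpd_compA.

Section Germs.
Variable D : tbis.
Let G := tbG D.
Let S := tbS D.
Let X : topologicalType := dual G.

Definition sdomain (s : S) : set X := isg_dom (tbp s).
Definition sphi (s : S) (x : X) : X := phi (tbp s) x.

Definition gpair : Type := {a : S * X | sdomain a.1 a.2}.

(* s a = t b with a, b in T(X) and a(x), b(x) in [V]: this is the relation ~
   for V = {1}, and the relation ~~ when [V] is the circle. *)
Definition germ_rel (V : set C) (u v : gpair) : Prop :=
  (sval u).2 = (sval v).2 /\
  exists a b, [/\ is_TX a, is_TX b, V (a (sval u).2), V (b (sval u).2) &
    (sval u).1 ** tbi a = (sval v).1 ** tbi b :> S].

Definition germs (V : set C) : Type :=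
  {A : set gpair | exists u, A = germ_rel V u}.

HB.instance Definition _ (V : set C) := gen_eqMixin (germs V).
HB.instance Definition _ (V : set C) := gen_choiceMixin (germs V).

Definition germ (V : set C) (s : S) (x : X) (sx : sdomain s x) : germs V :=
  let u : gpair := exist _ (s, x) sx in
  exist _ (germ_rel V u) (ex_intro _ u erefl).
Arguments germ : clear implicits.

Definition germ_rep (V : set C) (g : germs V) : gpair := sval (cid (svalP g)).

Definition germ_d (V : set C) (g : germs V) : X := (sval (germ_rep g)).2.
Definition germ_r (V : set C) (g : germs V) : X :=
  sphi (sval (germ_rep g)).1 (sval (germ_rep g)).2.

(* [s, phi_t(x)] [t, x] = [s t, x]; here as below, [xget] selects the element
   given by the formula, and its first argument where there is none. *)
Definition germ_m (V : set C) (g h : germs V) : germs V :=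
  xget g [set k | exists s t x (tx : sdomain t x) (sx : sdomain s (sphi t x))
    (stx : sdomain (s ** t) x),
    [/\ g = germ V s (sphi t x) sx, h = germ V t x tx &
        k = germ V (s ** t) x stx]].

Definition germ_i (V : set C) (g : germs V) : germs V :=
  xget g [set k | exists s x (sx : sdomain s x)
    (sx' : sdomain (s^-*) (sphi s x)),
    g = germ V s x sx /\ k = germ V (s^-*) (sphi s x) sx'].

(* The unit at [x] is [e, x] for any idempotent [e] with [x] in its domain. *)
Definition char_elt (x : X) : G := sval (cid (char_neq0 (svalP x))).

Lemma char_elt_idem (x : X) : idem (char_elt x).
Proof. exact: (char_sub (svalP x) (svalP (cid (char_neq0 (svalP x))))). Qed.

Lemma unit_domain (x : X) :
  sdomain (tbi (indicator (ideal_open (char_elt x)))) x.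
Proof.
rewrite /sdomain /isg_dom /ideal_open /=.
have Ee := char_elt_idem x.
rewrite (tbis_i1 (tbisP D))//; rewrite (_ : _ ** _ = char_elt x).
  exact: (svalP (cid (char_neq0 (svalP x)))).
have iG := bisg_isg (tbisG (tbisP D)).
have <- : char_elt x = (char_elt x)^-*.
  by apply: (sg_star_uniq iG); rewrite !Ee.
exact: Ee.
Qed.

Definition germ_u (V : set C) (x : X) : germs V := germ V _ x (unit_domain x).

(* [s, x] z = [s c, x] for c in T(X) with c(x) = z *)
Definition germ_sc (g : germs [set 1]) (z : C) : germs [set 1] :=
  xget g [set k | exists s x (sx : sdomain s x) c
    (sx' : sdomain (s ** tbi c) x),
    [/\ is_TX c, c x = z, g = germ [set 1] s x sx &
        k = germ [set 1] (s ** tbi c) x sx']].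

Definition germ_p (g : germs [set 1]) : germs circle :=
  germ circle _ _ (svalP (germ_rep g)).

Definition germ_basisG : set (set (germs circle)) :=
  [set B | exists s U, open U /\
    B = [set g | exists x (sx : sdomain s x), U x /\ g = germ circle s x sx]].

Definition germ_basisS : set (set (germs [set 1])) :=
  [set B | exists s W, open W /\
    B = [set g | exists x (sx : sdomain s x) z,
           [/\ circle z, W z & g = germ_sc (germ [set 1] s x sx) z]]].

Definition germG : Type := germs circle.
Definition germS : Type := germs [set 1].

HB.instance Definition _ := Choice.on germG.
HB.instance Definition _ :=
  @isSubBaseTopological.Build germG (set germG) germ_basisG id.

HB.instance Definition _ := Choice.on germS.
HB.instance Definition _ :=
  @isSubBaseTopological.Build germS (set germS) germ_basisS id.

Definition germ_gpdG : gpd_data X :=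
  @GpdData X germG (@germ_d circle) (@germ_r circle) (germ_u circle)
    (@germ_m circle) (@germ_i circle).

Definition germ_gpdS : gpd_data X :=
  @GpdData X germS (@germ_d [set 1]) (@germ_r [set 1]) (germ_u [set 1])
    (@germ_m [set 1]) (@germ_i [set 1]).

Definition germ_tgpd : tgpd_data :=
  @TgpdData X germ_gpdG germ_gpdS germ_p
    (fun x z => germ_sc (germ_u [set 1] x) z).

Definition phi_formula : Prop :=
  forall (s : G) x, isg_dom s x -> isg_ran s (phi s x) /\
    forall e, idem e -> sval x e <-> sval (phi s x) (s ** e ** s^-*).

Definition germ_formulas_in (V : set C) : Prop :=
  [/\ forall s x (sx : sdomain s x),
        germ_d (germ V s x sx) = x /\ germ_r (germ V s x sx) = sphi s x,
      forall s t x (tx : sdomain t x) (sx : sdomain s (sphi t x)),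
        exists stx : sdomain (s ** t) x,
        germ_m (germ V s (sphi t x) sx) (germ V t x tx) = germ V (s ** t) x stx &
      forall s x (sx : sdomain s x), exists sx' : sdomain (s^-*) (sphi s x),
        germ_i (germ V s x sx) = germ V (s^-*) (sphi s x) sx'].

(* The defining formulas hold, i.e. they do not depend on representatives, and
   the two families of basic sets are bases. *)
Definition germ_formulas : Prop :=
  [/\ [/\ phi_formula, germ_formulas_in circle & germ_formulas_in [set 1]],
      forall s x (sx : sdomain s x),
        germ_p (germ [set 1] s x sx) = germ circle s x sx,
      forall s x (sx : sdomain s x) c, is_TX c -> circle (c x) ->
        exists sx' : sdomain (s ** tbi c) x,
        germ_sc (germ [set 1] s x sx) (c x) = germ [set 1] (s ** tbi c) x sx',
      basis (germ_basisG : set (set germG)) &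
      basis (germ_basisS : set (set germS))].

End Germs.
Arguments germ {D} V s x sx.

Section GermArrow.
Variables (D D' : tbis) (f : tbis_arrow D D').

Definition dual_map : dual (tbG D') -> dual (tbG D) :=
  sval (cid2 (tba_ker (tbaP f))).

Definition germ_tact (l : germS D) (g : germS D') : germS D' :=
  xget g [set k | exists s t x (tx : sdomain t x)
    (sx : sdomain s (dual_map (sphi t x)))
    (stx : sdomain (tbj1 f s ** t) x),
    [/\ l = germ [set 1] s (dual_map (sphi t x)) sx, g = germ [set 1] t x tx &
        k = germ [set 1] (tbj1 f s ** t) x stx]].

Definition germ_arrow : tgpd_arrow_data (germ_tgpd D) (germ_tgpd D') :=
  @TgpdArrowData (germ_tgpd D) (germ_tgpd D')
    (fun g : germS D' => dual_map (germ_r g)) germ_tact.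

Definition germ_arrow_formula : Prop :=
  forall s t x (tx : sdomain t x) (sx : sdomain s (dual_map (sphi t x))),
    exists stx : sdomain (tbj1 f s ** t) x,
    germ_tact (germ [set 1] s (dual_map (sphi t x)) sx) (germ [set 1] t x tx) =
    germ [set 1] (tbj1 f s ** t) x stx.

End GermArrow.

Section Bisections.
Variables (X : topologicalType) (G : gpd_data X).

Record is_bisection (A : set G) : Prop := IsBisection {
  bis_compact : compact A;
  bis_d : homeo_onto_open (@gd X G) A;
  bis_r : homeo_onto_open (@gr X G) A }.

Lemma is_bisection0 : is_bisection set0.
Proof.
have h (f : G -> X) : homeo_onto_open f set0.
  split; last by rewrite image_set0; exact: open0.
  split; first by apply/subspace_continuousP.
  by exists gu => //; rewrite image_set0; apply/subspace_continuousP.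
by split=> //; exact: compact0.
Qed.

Definition bis : Type := {A : set G | is_bisection A}.

HB.instance Definition _ := gen_eqMixin bis.
HB.instance Definition _ := gen_choiceMixin bis.

Definition bis0 : bis := exist _ set0 is_bisection0.

(* The bisection with underlying set [A] (empty if [A] is not a bisection) *)
Definition to_bis (A : set G) : bis := xget bis0 [set B | sval B = A].

Definition set_gm (A B : set G) : set G :=
  [set k | exists g h, [/\ A g, B h, gd g = gr h & k = gm g h]].

Definition bis_sg : sg_data :=
  @SgData bis (fun A B => to_bis (set_gm (sval A) (sval B)))
    (fun A => to_bis (@gi X G @` sval A)) bis0.

Definition bis_formulas : Prop :=
  (forall A B : bis_sg, sval (A ** B) = set_gm (sval A) (sval B)) /\
  (forall A : bis_sg, sval (A^-*) = @gi X G @` sval A).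

(* The character of [bis_sg] corresponding to the unit [x]: the identification
   of [X] with the dual space of the idempotents *)
Definition is_point (c : dual bis_sg) (x : X) : Prop :=
  forall A : bis_sg, sval c A <-> idem A /\ sval A (gu x).

End Bisections.

Section BisTwisted.
Variable D : tgpd.

Definition bis_p_set (A : set (tgS D)) : set (tgG D) := @tgp D @` A.

Definition bis_i_set (h : dual (bis_sg (tgG D)) -> C) : set (tgS D) :=
  [set s | exists x c, [/\ is_point c x, h c != 0 & s = tgi x (h c)]].

Definition bis_tbis : tbis_data :=
  @TbisData (bis_sg (tgG D)) (bis_sg (tgS D))
    (fun A => to_bis (bis_p_set (sval A)))
    (fun h => to_bis (bis_i_set h)).

Definition bis_tbis_formulas : Prop :=
  [/\ bis_formulas (tgG D) /\ bis_formulas (tgS D),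
      forall x, exists c : dual (bis_sg (tgG D)), is_point c x,
      forall c : dual (bis_sg (tgG D)), exists! x, is_point c x,
      forall A : tbS bis_tbis, sval (tbp A) = bis_p_set (sval A) &
      forall h, is_TX h -> sval (tbi h : tbS bis_tbis) = bis_i_set h].

End BisTwisted.

Section BisArrow.
Variables (D D' : tgpd) (f : tgpd_arrow D D').

Definition quotient_act (l : tgG D) (g : tgG D') : tgG D' :=
  xget g [set k | exists l' s, [/\ tgp l' = l, tgp s = g, gd l' = tanc f s &
    k = tgp (tact f l' s)]].

Definition bis_j_set (A : set (tgG D)) : set (tgG D') :=
  [set k | exists l x, [/\ A l, anchor0 f x = gd l &
    k = quotient_act l (gu x)]].

Definition bis_j1_set (A : set (tgS D)) : set (tgS D') :=
  [set k | exists l x, [/\ A l, anchor0 f x = gd l & k = tact f l (gu x)]].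

Definition bis_arrow : tbis_arrow_data (bis_tbis D) (bis_tbis D') :=
  @TbisArrowData (bis_tbis D) (bis_tbis D')
    (fun A => to_bis (bis_j_set (sval A)))
    (fun A => to_bis (bis_j1_set (sval A))).

Definition bis_arrow_formulas : Prop :=
  [/\ forall l s, gd l = tanc f s ->
        quotient_act (tgp l) (tgp s) = tgp (tact f l s),
      forall A, sval (tbj bis_arrow A) = bis_j_set (sval A) &
      forall A, sval (tbj1 bis_arrow A) = bis_j1_set (sval A)].

End BisArrow.

Definition germ_functor
    (obP : forall D : tbis, is_tgpd (germ_tgpd D))
    (homP : forall (D D' : tbis) (f : tbis_arrow D D'),
      is_tgpd_arrow (germ_arrow f)) : functor_data TBIS TBG :=
  @FunctorData TBIS TBG (fun D => Tgpd (obP D))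
    (fun D D' f => @TgpdArrow (Tgpd (obP D)) (Tgpd (obP D')) _ (homP D D' f)).

Definition bis_functor
    (obP : forall D : tgpd, is_tbis (bis_tbis D))
    (homP : forall (D D' : tgpd) (f : tgpd_arrow D D'),
      is_tbis_arrow (bis_arrow f)) : functor_data TBG TBIS :=
  @FunctorData TBG TBIS (fun D => Tbis (obP D))
    (fun D D' f => @TbisArrow (Tbis (obP D)) (Tbis (obP D')) _ (homP D D' f)).

End Twisted.

(* Main.v *)
(* From a twisted Boolean inverse semigroup, s is sent to the compact bisection
   {[s, x] : x in dom(s)} of its twisted groupoid of germs. Equality of germs is
   a local condition on X, so, cutting a compact open set into finitely many
   disjoint pieces on which it holds and gluing with orthogonal joins, one gets
   that s -> {[s, x]} is injective and reaches every compact bisection.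
   Conversely, from a twisted Boolean groupoid, the germ [A, x] of a compact
   bisection A of Sigma is sent to the element of A with domain x; this is a
   homeomorphism because every element of Sigma lies in such a bisection. For
   that, a compact open bisection of G is lifted to Sigma: over a compact open
   set of the totally disconnected space X the circle bundle p has a continuous
   section, obtained by refining open subsets of Sigma of smaller and smaller
   diameter in the circle direction and passing to the limit.
   A multiplier action is determined by the elements l x with x a unit, and an
   arrow of semigroups by j_1, hence naturality is a comparison of l x with
   [j_1(s), x]. *)
Require Import Defs.
From mathcomp Require Import all_boot all_order all_algebra.
From mathcomp Require Import all_classical all_reals all_analysis.
From mathcomp Require Import finmap complex ring lra.
Import numFieldNormedType.Exports.

Set Implicit Arguments.
Unset Strict Implicit.
Unset Printing Implicit Defensive.

Import Order.TTheory GRing.Theory Num.Theory.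
Local Open Scope classical_set_scope.
Local Open Scope ring_scope.

Arguments gu {X g} _.
Arguments gi {X g} _.

(** Neither G nor Sigma is assumed Hausdorff, so a compact subset of them need not be closed. Clopen
    partitions are therefore made in the unit space X only. A bisection is handled as the image of a
    continuous section of d over a compact open subset of X, together with the same for its inverse;
    such sections are pasted because compact open subsets of X are closed. On the semigroup side,
    joins of orthogonal pairs are assumed in the Boolean quotient only, not in S. Cutting and gluing
    thus take place in the quotient, and S follows: two elements of S with the same image differ by
    an element of T(X), and the circle acts freely on germs. The converse direction has the same
    shape. Compact bisections of Sigma are not open, but their images in G are; two bisections
    through the same element of Sigma agree locally in G, hence up to scalars in Sigma, and freeness
    removes the scalar at the given point. *)

(** * Continuity and compactness relative to a subset *)

Lemma continuous_near (A B : topologicalType) (f : A -> B) x W :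
  {for x, continuous f} -> nbhs (f x) W -> \forall y \near x, W (f y).
Proof. by move=> cf; exact: cf. Qed.

Lemma within_contP (A B : topologicalType) (S : set A) (f : A -> B) :
  {within S, continuous f} <->
  forall x, S x -> forall W, nbhs (f x) W -> \forall y \near x, S y -> W (f y).
Proof. by rewrite subspace_continuousP; split=> h x Sx W; exact: h. Qed.

Lemma within_cont_at (A B : topologicalType) (S : set A) (f : A -> B) x :
  open S -> {within S, continuous f} -> S x -> {for x, continuous f}.
Proof.
move=> oS /within_contP cf Sx W /(cf _ Sx) nW.
by apply: filterS2 nW (open_nbhs_nbhs (conj oS Sx)) => y h Sy; exact: h.
Qed.

Lemma within_cont_open (A B : topologicalType) (S : set A) (f : A -> B) :
  (forall x, S x -> {for x, continuous f}) -> {within S, continuous f}.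
Proof. move=> cf; apply/within_contP => x Sx W nW.
have := cf _ Sx _ nW; rewrite nbhs_simpl /=.
by apply: filterS. Qed.

Lemma within_cont_eq (A B : topologicalType) (S : set A) (f g : A -> B) :
  (forall x, S x -> f x = g x) -> {within S, continuous f} ->
  {within S, continuous g}.
Proof.
move=> fg /within_contP cf; apply/within_contP => x Sx W.
by rewrite -fg// => /(cf _ Sx); apply: filterS => y h Sy; rewrite -fg//; exact: h.
Qed.

Lemma within_cont_sub (A B : topologicalType) (S T : set A) (f : A -> B) :
  T `<=` S -> {within S, continuous f} -> {within T, continuous f}.
Proof.
move=> TS /within_contP cf; apply/within_contP => x Tx W /(cf _ (TS _ Tx)).
by apply: filterS => y h /TS.
Qed.

Lemma open_near (X : topologicalType) (A : set X) :
  (forall x, A x -> nbhs x A) -> open A.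
Proof. by move=> h; rewrite openE. Qed.

Lemma within_open_preimage (A B : topologicalType) (S : set A) (f : A -> B) O :
  open S -> {within S, continuous f} -> open O -> open (S `&` f @^-1` O).
Proof.
move=> oS cf oO; apply: open_near => x [Sx fx].
apply: filterI; first exact: open_nbhs_nbhs.
exact: (within_cont_at oS cf Sx (open_nbhs_nbhs (conj oO fx))).
Qed.

Lemma within_compact_image (A B : topologicalType) (S : set A) (f : A -> B) :
  compact S -> {within S, continuous f} -> compact (f @` S).
Proof. by move=> cS cf; exact: continuous_compact. Qed.

(** The source need not be Hausdorff, so [S] may fail to be closed. A filter on the preimage
    clusters at a point of [S], and continuity along [S] with closedness of [F] puts that point in
    the preimage. *)
Lemma within_compact_preimage (A B : topologicalType) (S : set A) (f : A -> B) F :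
  compact S -> {within S, continuous f} -> closed F ->
  compact (S `&` f @^-1` F).
Proof.
move=> cS /within_contP cf cF FF PF h.
have FS : FF S by apply: filterS h => x [].
have [x [Sx cx]] := cS _ PF FS; exists x; split=> //; split=> //=.
apply: cF => V nV; have := cf _ Sx _ nV => nV'.
have [y [[Sy Fy] /(_ Sy) Vy]] := cx _ _ h nV'.
by exists (f y).
Qed.

Definition copen (X : topologicalType) (U : set X) := compact U /\ open U.

(** * Boolean spaces *)

Section BooleanSpace.
Variable X : topologicalType.
Implicit Types U V K : set X.

Lemma copen0 : copen (@set0 X).
Proof. by split; [exact: compact0|exact: open0]. Qed.

Lemma copenU U V : copen U -> copen V -> copen (U `|` V).
Proof. by case=> ? ? [? ?]; split; [exact: compactU|exact: openU]. Qed.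

Hypothesis HX : hausdorff_space X.

Lemma copen_closed U : copen U -> closed U.
Proof. by case=> cU _; exact: compact_closed. Qed.

Lemma copenI U V : copen U -> copen V -> copen (U `&` V).
Proof.
move=> cU cV; have clV := copen_closed cV; case: cU cV => ? ? [? ?].
by split; [exact: compact_closedI|exact: openI].
Qed.

Lemma copenD U V : copen U -> copen V -> copen (U `\` V).
Proof.
move=> cU cV; have clV := copen_closed cV; case: cU cV => ? ? [? ?].
rewrite setDE; split; last by apply: openI => //; exact: closed_openC.
by apply: compact_closedI => //; exact: open_closedC.
Qed.

Lemma copen_preimage (A : topologicalType) (S : set A) (f : A -> X) U :
  copen S -> {within S, continuous f} -> copen U -> copen (S `&` f @^-1` U).
Proof.
move=> [cS oS] cf cU; split; last exact: within_open_preimage (cU.2).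
exact: within_compact_preimage (copen_closed cU).
Qed.

(** Compactness as an induction principle: if no member of [Q] contains [K], the differences of [K]
    with the members generate a proper filter, whose cluster point in [K] contradicts the local
    hypothesis. *)
Lemma compact_ideal (Q : set X -> Prop) K :
  Q set0 -> (forall U V, Q U -> Q V -> Q (U `|` V)) ->
  (forall x, K x -> exists2 U, nbhs x U & Q U) -> compact K ->
  exists2 U, Q U & K `<=` U.
Proof.
move=> Q0 QU QK cK.
pose F : set_system X := [set A | exists2 U, Q U & K `\` U `<=` A].
have [//|nQ] := pselect (exists2 U, Q U & K `<=` U).
have FF : ProperFilter F.
  apply: Build_ProperFilter_ex.
    move=> A [U QU' UA]; apply: contrapT => nA; apply: nQ; exists U => // x Kx.
    by apply: contrapT => Ux; apply: nA; exists x; exact: UA.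
  split.
  - by exists set0.
  - move=> A B [U QU' UA] [V QV VB]; exists (U `|` V); first exact: QU.
    move=> x [Kx nx]; split; first by apply: UA; split=> // ?; apply: nx; left.
    by apply: VB; split=> // ?; apply: nx; right.
  - by move=> A B AB [U QU' UA]; exists U => // x /UA /AB.
have FK : F K by exists set0 => // x [].
have [x [Kx cx]] := cK _ FF FK.
have [U nU QU'] := QK _ Kx.
have FU : F (K `\` U) by exists U.
by have [y [[_ nUy] Uy]] := cx _ _ FU nU.
Qed.

(** The gluing principle for local statements. A finite cover can be made disjoint because compact
    open sets of a Hausdorff space are stable under difference. *)
Lemma copen_ind (P : set X -> Prop) K :
  P set0 ->
  (forall U V, copen U -> copen V -> U `&` V = set0 -> P U -> P V -> P (U `|` V)) ->
  (forall x, K x -> exists2 U, nbhs x U &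
     forall V, copen V -> V `<=` U -> V `<=` K -> P V) ->
  (forall x, K x -> forall U, nbhs x U -> exists V, [/\ copen V, V x & V `<=` U]) ->
  copen K -> P K.
Proof.
move=> P0 PU PK zd cK.
(* [P] need not pass to subsets, so the statement carried along the cover quantifies over all
   compact open subsets. *)
pose Q U := copen U /\ forall V, copen V -> V `<=` U -> V `<=` K -> P V.
suff [U [_ QU] KU] : exists2 U, Q U & K `<=` U by exact: QU.
apply: compact_ideal cK.1.
- by split=> [|V _]; [exact: copen0|rewrite subset0 => ->].
- move=> U V [cU QU] [cV QV]; split; first exact: copenU.
  move=> W cW WUV WK.
  have -> : W = (W `&` U) `|` (W `\` U).
    apply/seteqP; split=> x; last by case=> [[]//|[]].
    by move=> Wx; have [Ux|Ux] := pselect (U x); [left|right].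
  apply: PU; [exact: copenI|exact: copenD| | |].
  + by apply/seteqP; split=> // x [[_ ?] []].
  + by apply: QU; [exact: copenI|move=> x []|move=> x [/WK]].
  + apply: QV; [exact: copenD| |by move=> x [/WK]].
    by move=> x [/WUV []].
- move=> x Kx; have [U nU PU'] := PK _ Kx.
  have [V [cV Vx VU]] := zd _ Kx _ nU; exists V.
    by apply: open_nbhs_nbhs; split=> //; case: cV.
  by split=> // W cW WV; apply: PU' => // y /WV /VU.
Qed.

(** The open sets disjoint from some neighbourhood of [x] are stable under finite unions, the
    neighbourhoods being intersected. *)
Lemma point_compact_separate (x : X) K : compact K -> ~ K x ->
  exists V W, [/\ open V, open W, V x, K `<=` W & V `&` W = set0].
Proof.
move=> cK nKx.
pose Q W := open W /\ exists V, [/\ open V, V x & V `&` W = set0].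
suff [W [oW [V [oV Vx VW]]] KW] : exists2 W, Q W & K `<=` W by exists V, W.
apply: compact_ideal cK.
- by split; [exact: open0|exists setT; split; [exact: openT| |rewrite setI0]].
- move=> A B [oA [V [oV Vx VA]]] [oB [W [oW Wx WB]]].
  split; first exact: openU.
  exists (V `&` W); split; [exact: openI|by []|].
  apply/seteqP; split=> // y [[Vy Wy] [Ay|By]]; first by rewrite -VA.
  by rewrite -WB.
- move=> y Ky.
  have xy : x != y by apply/eqP => xy; rewrite xy in nKx.
  move: HX; rewrite open_hausdorff => /(_ _ _ xy).
  move=> [[V W] /= [/set_mem Vx /set_mem Wy] [oV oW /eqP VW]].
  exists W; first exact: open_nbhs_nbhs.
  by split=> //; exists V.
Qed.

Lemma compact_separate U K : compact U -> compact K -> U `&` K = set0 ->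
  exists V W, [/\ open V, open W, U `<=` V, K `<=` W & V `&` W = set0].
Proof.
move=> cU cK UK.
pose Q V := open V /\ exists W, [/\ open W, K `<=` W & V `&` W = set0].
suff [V [oV [W [oW KW VW]]] UV] : exists2 V, Q V & U `<=` V by exists V, W.
apply: compact_ideal cU.
- by split; [exact: open0|exists setT; split; [exact: openT| |rewrite set0I]].
- move=> A B [oA [V [oV KV VA]]] [oB [W [oW KW WB]]].
  split; first exact: openU.
  exists (V `&` W); split; [exact: openI|by move=> y Ky; split; auto|].
  apply/seteqP; split=> // y [[Ay|By] [Vy Wy]]; first by rewrite -VA.
  by rewrite -WB.
- move=> x Ux; have nKx : ~ K x by move=> Kx; rewrite -[False]/(set0 x) -UK.
  have [V [W [oV oW Vx KW VW]]] := point_compact_separate cK nKx.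
  by exists V; [exact: open_nbhs_nbhs|split=> //; exists W].
Qed.

(* In a compact set the intersection of the relatively clopen neighbourhoods of
   a point is connected, hence reduced to the point here. *)
Lemma totally_disconnected_copen (x : X) U : totally_disconnected [set: X] ->
  (exists2 K, nbhs x K & compact K) -> nbhs x U ->
  exists V, [/\ copen V, V x & V `<=` U].
Proof.
move=> td [K nK cK] nU.
(* The relatively clopen subsets of [K] containing [x]; compactness stands for closedness. *)
pose D V := [/\ V x, compact V & exists2 O, open O & V = K `&` O].
have DK : D K.
  by split; [exact: nbhs_singleton|by []|exists setT; [exact: openT|rewrite setIT]].
have DI V W : D V -> D W -> D (V `&` W).
  move=> [Vx KV [ O oO VE]] [Wx KW [ O' oO' WE]]; split=> //.
    by apply: compact_closedI => //; exact: compact_closed.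
  by exists (O `&` O'); [exact: openI|rewrite VE WE setIACA setIid].
(* By compactness of the part of [K] outside [O], an open set containing the intersection of this
   filtered family contains one of its members. *)
have Dsmall O : open O -> (forall y, (forall V, D V -> V y) -> O y) ->
    exists2 V, D V & V `<=` O.
  move=> oO DO.
  pose Q B := exists2 V, D V & B `&` V = set0.
  have cKO : compact (K `\` O).
    by rewrite setDE; apply: compact_closedI => //; exact: open_closedC.
  have [B [V DV BV] KB] : exists2 B, Q B & K `\` O `<=` B.
    apply: compact_ideal cKO.
    - by exists K => //; rewrite set0I.
    - move=> A B [V DV AV] [W DW BW]; exists (V `&` W); first exact: DI.
      apply/seteqP; split=> // y [[Ay|By] [Vy Wy]]; first by rewrite -AV.
      by rewrite -BW.
    - move=> y [Ky nOy]; have [V nV] : exists V, ~ (D V -> V y).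
        by apply: contrapT => /forallNP h; apply: nOy; apply: DO => V; apply: contrapT.
      move: nV => /not_implyP[DV nVy]; exists (~` V).
        apply: open_nbhs_nbhs; split=> //; apply: closed_openC.
        by case: DV => _ cV _; exact: compact_closed.
      by exists V => //; rewrite setICl.
  exists (V `&` K); first exact: DI.
  move=> y [Vy Ky]; apply: contrapT => nO.
  by rewrite -[False]/(set0 y) -BV; split=> //; exact: KB.
pose C := \bigcap_(V in D) V.
have CK : C `<=` K by move=> y Cy; exact: Cy.
have clC : closed C by apply: closed_bigI => V [_ cV _]; exact: compact_closed.
have cC : compact C by exact: subclosed_compact CK.
have Cx : C x by move=> V [].
have conC : connected C.
  (* Take disjoint open [V], [W] around the two pieces and a member [E] inside their union. The part
     of [E] in [V] is also the part outside [W], hence is again a member; so the intersection [C]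
     lies in [V] and [B] is empty. *)
  have key A B : closed A -> closed B -> C = A `|` B -> A `&` B = set0 -> A x ->
      B = set0.
    move=> cA cB CE AB Ax.
    have [|||V [W [oV oW AV BW VW]]] := @compact_separate A B.
    + by apply: subclosed_compact cC _ => //; rewrite CE; left.
    + by apply: subclosed_compact cC _ => //; rewrite CE; right.
    + by [].
    have [|y Cy|E DE EVW] := Dsmall (V `|` W); first exact: openU.
      have : C y by move=> ? ?; exact: Cy.
      by rewrite CE => -[/AV|/BW]; [left|right].
    have DEV : D (E `&` V).
      case: DE => Ex cE [ O oO EE]; split.
      - by split=> //; exact: AV.
      - rewrite (_ : _ `&` _ = E `\` W).
          by rewrite setDE; apply: compact_closedI => //; exact: open_closedC.
        apply/seteqP; split=> y [Ey h]; split=> //.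
          by move=> Wy; rewrite -[False]/(set0 y) -VW.
        by case: (EVW _ Ey).
      - by exists (O `&` V); [exact: openI|rewrite EE setIA].
    apply/seteqP; split=> // y By.
    have [_ Vy] : (E `&` V) y by have : C y; [rewrite CE; right|exact].
    by rewrite -VW; split=> //; exact: BW.
  move=> B [b Bb] [ O oO BO] [F cF BF].
  have CE : C = (C `&` F) `|` (C `&` ~` O).
    rewrite -BF BO -setIUr; apply/seteqP; split=> y; last by case.
    by move=> Cy; split=> //; have [?|?] := pselect (O y); [left|right].
  have cl1 : closed (C `&` F) by exact: closedI.
  have cl2 : closed (C `&` ~` O) by apply: closedI => //; exact: open_closedC.
  have dj : (C `&` F) `&` (C `&` ~` O) = set0.
    by rewrite -BF BO; apply/seteqP; split=> // y [[_ Oy] [_]].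
  have [Bx|nBx] := pselect (B x).
    have := key _ _ cl1 cl2 CE dj; rewrite -BF => /(_ Bx) e.
    by rewrite [RHS]CE -BF e setU0.
  have : (C `&` F) = set0.
    apply: (key _ _ cl2 cl1); first by rewrite setUC.
      by rewrite setIC.
    by split=> //; move=> Ox; apply: nBx; rewrite BO.
  by rewrite -BF => e; rewrite e in Bb.
have C1 : C = [set x].
  apply/seteqP; split; last by move=> y ->.
  by rewrite -(td x I) => y Cy; exists C.
(* Lying in the interior of [U] and [K] makes the relatively open set [V] open in [X]. *)
have [||V DV VO] := Dsmall (U `&` K)°; first exact: open_interior.
  move=> y h; have : C y by move=> ? ?; exact: h.
  by rewrite C1 => ->; apply: nbhs_singleton; apply: nbhs_interior; exact: filterI.
exists V; case: (DV) => Vx cV [ O oO VE]; split=> //.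
  split=> //; rewrite (_ : V = O `&` (U `&` K)°).
    by apply: openI => //; exact: open_interior.
  apply/seteqP; split=> y.
    by move=> Vy; split; [move: Vy; rewrite VE => -[]|exact: VO].
  by move=> [Oy /interior_subset[_ Ky]]; rewrite VE.
by move=> y /VO /interior_subset[].
Qed.

End BooleanSpace.

Lemma boolean_space_copen (X : topologicalType) (x : X) U : boolean_space X ->
  nbhs x U -> exists V, [/\ copen V, V x & V `<=` U].
Proof.
move=> [lc HX td]; apply: totally_disconnected_copen => //.
have [K nK [cK _]] := lc x I; exists K => //.
by move: nK; rewrite withinET.
Qed.

Lemma zero_dimensional_boolean_space (X : topologicalType) :
  (forall x : X, exists2 U, copen U & U x) -> zero_dimensional X ->
  boolean_space X.
Proof.
move=> cX sX.
have HX : hausdorff_space X.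
  rewrite open_hausdorff => x y xy; have [U [[oU cU] Ux nUy]] := sX _ _ xy.
  exists (U, ~` U); first by split; exact/mem_set.
  split=> //; first exact: closed_openC.
  by apply/eqP; rewrite setICr.
split=> //; last exact: zero_dimension_totally_disconnected.
move=> x _; have [U [cU oU] Ux] := cX x; exists U.
  by apply: filterS (open_nbhs_nbhs (conj oU Ux)) => y.
by split=> //; exact: compact_closed.
Qed.

(** The first hypothesis is how a topology declared from a subbase describes its open sets. A cover
    that is downward filtered at each point absorbs finite intersections. *)
Lemma subbase_basis (T : topologicalType) (B : set (set T)) :
  (forall O, open O <->
    exists2 D, D `<=` finI_from B id & \bigcup_(A in D) A = O) ->
  (forall x, exists2 U, B U & U x) ->
  (forall U V x, B U -> B V -> U x -> V x ->
     exists W, [/\ B W, W x & W `<=` U `&` V]) ->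
  basis B.
Proof.
move=> oE cB BI; split.
  move=> U BU; apply/oE; exists [set U].
  move=> _ ->; exists [fset U]%fset; first by move=> V; rewrite inE => /eqP ->; exact/mem_set.
    by rewrite set_fset1 bigcap_set1.
  by rewrite bigcup_set1.
move=> x A; rewrite nbhsE => -[ O [/oE [D DB <-] [I DI Ix]] OA].
suff [W [BW Wx WI]] : exists W, [/\ B W, W x & W `<=` I].
  by exists W => //= y /WI Iy; apply: OA; exists I.
move: Ix; have [F FB <-] := DB _ DI => Ix.
suff key (s : seq (set T)) : (forall V, V \in s -> B V /\ V x) ->
    exists W, [/\ B W, W x & forall V, V \in s -> W `<=` V].
  have [|W [BW Wx WV]] := key F.
    move=> V VF; split; last exact: Ix.
    exact/set_mem/FB.
  by exists W; split=> // y Wy V VF; exact: WV Wy.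
elim: s => [_|U s IH h].
  by have [W BW Wx] := cB x; exists W.
have [|W [BW Wx WV]] := IH; first by move=> V Vs; apply: h; rewrite inE Vs orbT.
have [BU Ux] := h U (mem_head _ _).
have [W' [BW' Wx' WW]] := BI _ _ _ BW BU Wx Ux.
exists W'; split=> // V; rewrite inE => /orP[/eqP ->|Vs] y /WW [Wy Uy] //.
exact: (WV _ Vs).
Qed.

Lemma basis_nbhs (T : topologicalType) (B : set (set T)) x A : basis B ->
  nbhs x A <-> exists U, [/\ B U, U x & U `<=` A].
Proof.
move=> [oB cB]; split.
  by move=> /cB [U [BU Ux] UA]; exists U.
move=> [U [BU Ux UA]]; apply: filterS UA _.
by apply: open_nbhs_nbhs; split=> //; exact: oB.
Qed.

(** * Topology of the complex numbers and the circle *)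

Section Circle.
Variable R : realType.
Local Notation C := (C R).

Lemma circle1 : circle (1 : C).
Proof. by rewrite /circle /= normr1. Qed.

Lemma circleM (z w : C) : circle z -> circle w -> circle (z * w).
Proof. by rewrite /circle /= normrM => -> ->; rewrite mulr1. Qed.

Lemma circleV (z : C) : circle z -> circle z^-1.
Proof. by rewrite /circle /= normfV => ->; rewrite invr1. Qed.

Lemma circle_neq0 (z : C) : circle z -> z != 0.
Proof. by rewrite /circle /= -normr_eq0 => ->; exact: oner_neq0. Qed.

Lemma mul_nbhs (z w : C) W : nbhs (z * w) W ->
  exists U V, [/\ nbhs z U, nbhs w V & forall a b, U a -> V b -> W (a * b)].
Proof.
move=> nW; have := @mul_continuous _ (z, w) _ nW.
rewrite nbhs_simpl /= => -[[U V] [nU nV] UV].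
by exists U, V; split=> // a b Ua Vb; exact: (UV (a, b)).
Qed.

Lemma inv_nbhs (z : C) W : z != 0 -> nbhs z^-1 W -> \forall a \near z, W a^-1.
Proof. by move=> z0 nW; exact: (inv_continuous z0 nW). Qed.

Lemma C_hausdorff : hausdorff_space C.
Proof. exact: norm_hausdorff. Qed.

(** The topology of [R[i]] comes from its norm; this comparison with the product topology supplies
    its compact sets. *)
Lemma complex_pair_continuous :
  continuous (fun p : R * R => (Complex p.1 p.2 : C)).
Proof.
move=> [a b] W /= /nbhs_normP [e /= e0 eW].
(* A positive element of [R[i]] is real, so the radius can be measured in [R]. *)
have eE : e = (complex.Re e)%:C%C by rewrite RRe_real// gtr0_real.
have r0 : 0 < complex.Re e by rewrite -ltcR -eE.
set r := complex.Re e in eE r0.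
have nr (c : R) : nbhs c [set t | `|c - t| < r / 2].
  by apply/nbhs_normP; exists (r / 2) => //=; rewrite divr_gt0.
exists ([set t | `|a - t| < r / 2], [set t | `|b - t| < r / 2]) => //.
move=> [a' b'] /= [ha hb]; apply: eW => /=.
rewrite (_ : _ - _ = ((a - a')%:C + 'i * (b - b')%:C)%C); last first.
  apply/eqP; rewrite eq_complex /=; apply/andP; split;
    by rewrite ?(mul0r,mul1r,mulr0,add0r,addr0,oppr0,subr0).
apply: le_lt_trans (ler_normD _ _) _; rewrite normrM.
have ni : `|'i%C| = 1 :> R[i] by rewrite complexiE normCi.
rewrite ni mul1r !normc_def /= !expr0n /= !addr0 !sqrtr_sqr.
by rewrite eE -rmorphD /= ltcR; lra.
Qed.

Lemma complex_Re_continuous : continuous (fun z : C => complex.Re z : R).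
Proof.
move=> z W /nbhs_normP [e /= e0 eW]; apply/nbhs_normP.
exists (e%:C%C : C) => /= [|w /= hw]; first by rewrite ltcR.
apply: eW => /=; rewrite -ltcR; apply: le_lt_trans hw.
by have := normc_ge_Re (z - w); case: (z) (w) => [? ?] [? ?].
Qed.

Lemma complex_Im_continuous : continuous (fun z : C => complex.Im z : R).
Proof.
move=> z W nW.
have cM : continuous (fun z : C => z * (- 'i)) by move=> w; exact: mulrr_continuous.
have E (w : C) : complex.Im w = complex.Re (w * - 'i).
  by case: w => u v; rewrite -complexiE /= ?(mulr0,mulr1,oppr0,add0r,subr0,sub0r,opprK,mulrN).
rewrite (_ : (fun z : C => _) = (fun z : C => complex.Re z : R) \o (fun z : C => z * (- 'i))).
  rewrite E in nW.
  exact: (continuous_comp (@cM z) (@complex_Re_continuous (z * - 'i)) nW).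
by apply/funext => w; exact: E.
Qed.

Lemma C_compact_nbhs : has_compact_nbhs C.
Proof.
move=> [a b] W nW; have := complex_pair_continuous (x := (a, b)) nW.
rewrite nbhs_simpl /= => -[[U V] /= [nU nV] UV].
have key (c : R) U' : nbhs c U' -> exists K, [/\ nbhs c K, compact K & K `<=` U'].
  move=> nU'; have := @locally_compactR R c I => -[K].
  rewrite withinET => nK [cK clK].
  have [A nA AU] := @compact_regular R c K (@Rhausdorff R) cK nK U' nU'.
  exists (K `&` closure A); split.
  - by apply: filterI => //; apply: filterS nA; exact: subset_closure.
  - by apply: compact_closedI => //; exact: closed_closure.
  - by move=> x [_ /AU].
have [K [nK cK KU]] := key _ _ nU; have [L [nL cL LV]] := key _ _ nV.
exists ((fun p : R * R => (Complex p.1 p.2 : C)) @` (K `*` L)); split.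
- have h1 := continuous_near (@complex_Re_continuous (Complex a b)) nK.
  have h2 := continuous_near (@complex_Im_continuous (Complex a b)) nL.
  apply: filterS2 h1 h2 => -[x y] /= Kx Ly.
  by exists (x, y).
- apply: within_compact_image; first exact: compact_setX.
  by apply: continuous_subspaceT; exact: complex_pair_continuous.
- by move=> _ [[x y] [Kx Ly] <-]; apply: (UV (x, y)); split; [exact: KU|exact: LV].
Qed.
End Circle.

(** * Inverse semigroups and the dual space *)

Section InverseSemigroup.
Variable S : sg_data.
Hypothesis iS : inverse_semigroup S.
Implicit Types s t u e f g : S.
Let A := sgA iS.

Lemma idem_star e : idem e -> e^-* = e.
Proof. by move=> Ee; apply/esym/(sg_star_uniq iS); rewrite !Ee. Qed.

Lemma starK s : s^-*^-* = s.
Proof. by apply/esym/(sg_star_uniq iS); [exact: (sg_starV iS)|exact: (sg_starK iS)]. Qed.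

Lemma idemM e f : idem e -> idem f -> idem (e ** f).
Proof. exact: inverse_semigroup_idemM. Qed.

Lemma idem0 : idem (sg_zero : S).
Proof. exact: sg0s. Qed.

(** [e ** f] is idempotent, hence its own inverse, and [f ** e] is an inverse of it. *)
Lemma idemC e f : idem e -> idem f -> e ** f = f ** e.
Proof.
move=> Ee Ef; have Eef := idemM Ee Ef; have Efe := idemM Ef Ee.
rewrite -[LHS](idem_star Eef); apply/esym/(sg_star_uniq iS).
  rewrite !A -(A e f f) Ef -(A _ e e) Ee -A; exact: Eef.
by rewrite !A -(A f e e) Ee -(A _ f f) Ef -A; exact: Efe.
Qed.

Lemma idem_d s : idem (s^-* ** s).
Proof. by rewrite /idem /= !A (sg_starV iS). Qed.

Lemma idem_r s : idem (s ** s^-*).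
Proof. by rewrite /idem /= !A (sg_starK iS). Qed.

Lemma starM s t : (s ** t)^-* = t^-* ** s^-*.
Proof.
apply/esym/(sg_star_uniq iS).
  have -> : s ** t ** (t^-* ** s^-*) ** (s ** t) =
    s ** ((t ** t^-*) ** (s^-* ** s)) ** t by rewrite !A.
  rewrite (idemC (idem_r t) (idem_d s)).
  have -> : s ** (s^-* ** s ** (t ** t^-*)) ** t =
    (s ** s^-* ** s) ** (t ** t^-* ** t) by rewrite !A.
  by rewrite !(sg_starK iS).
have -> : t^-* ** s^-* ** (s ** t) ** (t^-* ** s^-*) =
  t^-* ** ((s^-* ** s) ** (t ** t^-*)) ** s^-* by rewrite !A.
rewrite (idemC (idem_d s) (idem_r t)).
have -> : t^-* ** (t ** t^-* ** (s^-* ** s)) ** s^-* =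
  (t^-* ** t ** t^-*) ** (s^-* ** s ** s^-*) by rewrite !A.
by rewrite !(sg_starV iS).
Qed.

Lemma mul_d s : s ** (s^-* ** s) = s.
Proof. by rewrite A (sg_starK iS). Qed.

Lemma idem_mulr s e : idem e -> e ** s = s ** (s^-* ** e ** s).
Proof.
move=> Ee; have -> : s ** (s^-* ** e ** s) = (s ** s^-*) ** e ** s by rewrite !A.
by rewrite (idemC (idem_r s) Ee) -A (sg_starK iS).
Qed.

Lemma idemJ s e : idem e -> idem (s ** e ** s^-*).
Proof.
move=> Ee; rewrite /idem /= !A -(A _ s^-* s) -(A s e) (idemC Ee (idem_d s)).
by rewrite !A (sg_starK iS) -(A _ e e) Ee.
Qed.

Lemma idemJV s e : idem e -> idem (s^-* ** e ** s).
Proof. by move=> /(idemJ s^-*); rewrite starK. Qed.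

Lemma sleP s t : sg_le s t <-> s = t ** (s^-* ** s).
Proof.
split; last by move=> E; exists (s^-* ** s) => //; exact: idem_d.
move=> [e Ee ->]; rewrite starM (idem_star Ee).
have -> : t ** (e ** t^-* ** (t ** e)) = t ** (e ** (t^-* ** t)) ** e by rewrite !A.
by rewrite (idemC Ee (idem_d t)) -!A Ee !A (sg_starK iS).
Qed.

Lemma sle_refl s : sg_le s s.
Proof. by apply/sleP; rewrite mul_d. Qed.

Lemma sle_trans t s u : sg_le s t -> sg_le t u -> sg_le s u.
Proof.
by move=> [e Ee ->] [f Ef ->]; exists (f ** e); [exact: idemM|rewrite A].
Qed.

Lemma sle_idem e f : idem e -> sg_le e f <-> e = f ** e.
Proof. by move=> Ee; rewrite sleP (idem_star Ee) Ee. Qed.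

Lemma sle_d s t : sg_le s t -> sg_le (s^-* ** s) (t^-* ** t).
Proof.
move=> [e Ee ->]; exists e => //; rewrite starM (idem_star Ee) !A.
by rewrite -(A e) (idemC Ee (idem_d t)) -!A Ee.
Qed.

Lemma sle_anti s t : sg_le s t -> sg_le t s -> s = t.
Proof.
move=> st ts; have d1 := sle_d st; have d2 := sle_d ts.
have dE : s^-* ** s = t^-* ** t.
  move: d1 d2; rewrite (sle_idem _ (idem_d s)) (sle_idem _ (idem_d t)) => da db.
  by rewrite [LHS]da [RHS]db idemC //; exact: idem_d.
by move/sleP: st => ->; rewrite dE mul_d.
Qed.

Lemma idem_le e f : sg_le e f -> idem f -> idem e.
Proof. by move=> [g Eg ->] Ef; exact: idemM. Qed.

Lemma sle_mulr s e : idem e -> sg_le (s ** e) s.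
Proof. by exists e. Qed.

Lemma sle_mul_idem e f : idem e -> idem f -> sg_le (e ** f) e /\ sg_le (e ** f) f.
Proof. by move=> Ee Ef; split; [|rewrite idemC//]; exact: sle_mulr. Qed.

Lemma sle0 s : sg_le sg_zero s.
Proof. by exists sg_zero; [exact: idem0|rewrite (sgs0 iS)]. Qed.

Lemma sle_meet e f g : idem e -> idem f -> sg_le g e -> sg_le g f -> sg_le g (e ** f).
Proof.
move=> Ee Ef ge gf; have Eg := idem_le ge Ee; move: ge gf.
rewrite !sle_idem// => ge gf; by rewrite -A -gf.
Qed.

Lemma join_uniq (E : set S) s t g g' :
  is_join E s t g -> is_join E s t g' -> g = g'.
Proof. by move=> [? ? ? h] [? ? ? h']; apply: sle_anti; [exact: h|exact: h']. Qed.

Lemma dM s t : (s ** t)^-* ** (s ** t) = t^-* ** (s^-* ** s) ** t.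
Proof. by rewrite starM !A. Qed.

Lemma d_mulr s e : idem e -> (s ** e)^-* ** (s ** e) = s^-* ** s ** e.
Proof.
move=> Ee; rewrite dM (idem_star Ee) (idemC Ee (idem_d s)).
by rewrite -A Ee.
Qed.

Lemma sle_mul s s' t t' : sg_le s s' -> sg_le t t' -> sg_le (s ** t) (s' ** t').
Proof.
move=> [e Ee ->] [f Ef ->]; exists (t'^-* ** e ** t' ** f).
  by apply: idemM => //; exact: idemJV.
have -> : s' ** e ** (t' ** f) = s' ** (e ** t') ** f by rewrite !A.
by rewrite (idem_mulr t' Ee) !A.
Qed.

End InverseSemigroup.

Section Dual.
Variable G : sg_data.
Hypothesis bG : boolean_isg G.
Let iG := bisg_isg bG.
Let B := bisg_bool bG.
Let A := sgA iG.
Implicit Types (e f g s t : G) (x y : dual G).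

Lemma dual_eq x y : (forall e, idem e -> sval x e <-> sval y e) -> x = y.
Proof.
case: x y => [x bx] [y By] /= h; apply: eq_exist; apply/funext => e; apply/propext.
split=> xe; apply/h => //; [exact: (char_sub bx)|exact: (char_sub By)].
Qed.

Lemma char_idem x e : sval x e -> idem e.
Proof. exact: (char_sub (svalP x)). Qed.

Lemma charM x e f : idem e -> idem f -> sval x (e ** f) <-> sval x e /\ sval x f.
Proof. exact: (char_meet (svalP x)). Qed.

Lemma char_le x e f : sg_le e f -> idem f -> sval x e -> sval x f.
Proof.
move=> ef Ef xe; have Ee := char_idem xe.
by move: xe; move/(sle_idem iG _ Ee): ef => ->; rewrite charM// => -[].
Qed.

Lemma ideal_openI e f : idem e -> idem f ->
  ideal_open (e ** f) = ideal_open e `&` ideal_open f.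
Proof. by move=> Ee Ef; apply/seteqP; split=> x; rewrite /ideal_open /= charM. Qed.

Lemma ideal_open0 : ideal_open (sg_zero : G) = set0.
Proof. by apply/seteqP; split=> // x /(char_0 (svalP x)). Qed.

Lemma ideal_openU e f g : idem e -> idem f -> is_join idem e f g ->
  ideal_open g = ideal_open e `|` ideal_open f.
Proof.
by move=> Ee Ef j; apply/seteqP; split=> x; rewrite /ideal_open /= (char_join (svalP x) Ee Ef j).
Qed.

Lemma ideal_openD e f : idem e -> idem f -> exists2 g, idem g &
  ideal_open g = ideal_open f `\` ideal_open e.
Proof.
move=> Ee Ef; have [g [Eg ge j]] := bool_diff B Ee Ef; exists g => //.
have := ideal_openU (idemM iG Ee Ef) Eg j; rewrite ideal_openI// => ->.
have ge0 : ideal_open g `&` ideal_open e = set0.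
  by rewrite -ideal_openI// ge ideal_open0.
apply/seteqP; split=> x.
  move=> gx; split; first by right.
  by move=> ex; rewrite -[False]/(set0 x) -ge0.
by case=> [[[ex _]|gx] nex].
Qed.

Lemma dual_basis : basis [set U | exists2 e : G, idem e & U = ideal_open e].
Proof.
apply: subbase_basis => [ O|x|_ _ x [e Ee ->] [f Ef ->] ex fx].
- by [].
- have [e xe] := char_neq0 (svalP x); exists (ideal_open e) => //.
  by exists e => //; exact: char_idem xe.
- exists (ideal_open (e ** f)); split; last by rewrite ideal_openI.
    by exists (e ** f) => //; exact: idemM.
  by rewrite ideal_openI.
Qed.

Lemma dual_nbhs x (W : set (dual G)) :
  nbhs x W <-> exists e, [/\ idem e, sval x e & ideal_open e `<=` W].
Proof.
rewrite (basis_nbhs _ _ dual_basis); split.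
  by move=> [_ [[e Ee ->] xe eW]]; exists e.
by move=> [e [Ee xe eW]]; exists (ideal_open e); split=> //; exists e.
Qed.

Lemma ideal_open_open e : idem e -> open (ideal_open e).
Proof. by move=> Ee; apply: dual_basis.1; exists e. Qed.

Lemma char_nbhs x e : sval x e -> nbhs x (ideal_open e).
Proof. by move=> xe; apply/dual_nbhs; exists e; split=> //; exact: char_idem xe. Qed.

(* The limit of an ultrafilter F is the character of the e such that F contains
   the basic open set of e. *)
Lemma ideal_open_compact e : idem e -> compact (ideal_open e).
Proof.
move=> Ee; rewrite compact_ultra => F UF Fe.
pose x : set G := [set f | idem f /\ F (ideal_open f)].
have xP : boolean_character x.
  split.
  - by move=> f [].
  - by exists e.
  - by move=> [_]; rewrite ideal_open0; exact: filter_not_empty.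
  - move=> f g Ef Eg; rewrite /x /= ideal_openI//; split.
      by move=> [_ Ffg]; split; split=> //; apply: filterS Ffg => ? [].
    by move=> [[_ ?] [_ ?]]; split; [exact: idemM|exact: filterI].
  - move=> f g k Ef Eg j; rewrite /x /= (ideal_openU Ef Eg j); split.
      move=> [_ Ffg]; have [Ff|] := in_ultra_setVsetC (ideal_open f) UF; first by left.
      move=> nFf; right; split=> //; apply: filterS2 Ffg nFf => z [].
        by move=> ? [].
      by [].
    have [Ek _ _ _] := j.
    by case=> -[_ Ff]; split=> //; apply: filterS Ff => z ?; [left|right].
exists (exist _ x xP); split; first by split.
by move=> W /dual_nbhs [f [Ef [_ Ff] fW]]; rewrite /nbhs/=; apply: filterS Ff.
Qed.

Lemma ideal_open_copen e : idem e -> copen (ideal_open e).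
Proof. by split; [exact: ideal_open_compact|exact: ideal_open_open]. Qed.

Lemma dual_boolean : boolean_space (dual G).
Proof.
have clo e : idem e -> closed (ideal_open e).
  move=> Ee; rewrite -[ideal_open e]setCK; apply: open_closedC.
  apply: open_near => x nex; have [f xf] := char_neq0 (svalP x).
  have Ef := char_idem xf; have [g Eg gE] := ideal_openD Ee Ef.
  apply/dual_nbhs; exists g; split=> //; rewrite -?[sval x g]/(ideal_open g x) gE //.
apply: zero_dimensional_boolean_space => [x|x y xy].
  have [e xe] := char_neq0 (svalP x); exists (ideal_open e) => //.
  exact/ideal_open_copen/(char_idem xe).
have [e [Ee h]] : exists e, idem e /\ ~ (sval x e <-> sval y e).
  apply: contrapT => /forallNP h; move/eqP: xy; apply; apply: dual_eq => e Ee.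
  by apply: contrapT => n; apply: (h e).
have [xe|xe] := pselect (sval x e); have [ye|ye] := pselect (sval y e).
- by case: h.
- by exists (ideal_open e); split=> //; split; [exact: ideal_open_open|exact: clo].
- exists (~` ideal_open e); split=> //=.
  by split; [exact/closed_openC/clo|exact/open_closedC/ideal_open_open].
- by case: h; split.
Qed.

Lemma dual_hausdorff : hausdorff_space (dual G).
Proof. exact: bs_hausdorff dual_boolean. Qed.

(** The ultrafilter theorem: a filter of idempotents that is maximal among those whose members all
    meet [g] is a character. *)
Lemma char_exists g : idem g -> g <> sg_zero -> exists x, sval x g.
Proof.
move=> Eg g0.
pose P (M : set G) := [/\ M `<=` idem,
  forall a b, M a -> M b -> M (a ** b),
  forall a b, M a -> idem b -> sg_le a b -> M b &
  forall a, M a -> a ** g <> sg_zero].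
have [F FP Ftot|M [PM maxM]] := @Zorn_bigcup G P.
  split.
  - by move=> a [M FM Ma]; have [h _ _ _] := FP _ FM; exact: h.
  - move=> a b [M FM Ma] [N FN Nb].
    have [MN|NM] := Ftot _ _ FM FN.
      by exists N => //; have [_ h _ _] := FP _ FN; apply: h => //; exact: MN.
    by exists M => //; have [_ h _ _] := FP _ FM; apply: h => //; exact: NM.
  - by move=> a b [M FM Ma] Eb ab; exists M => //; have [_ _ h _] := FP _ FM; exact: h ab.
  - by move=> a [M FM Ma]; have [_ _ _ h] := FP _ FM; exact: h.
have [ME MM Mup M0] := PM.
(* Otherwise [M] and [e] generate a strictly larger such filter. The condition on [e ** g] alone
   covers the case where [M] is empty, which the maximality argument does not exclude beforehand. *)
have ext e : idem e -> e ** g <> sg_zero -> (forall a, M a -> a ** e ** g <> sg_zero) -> M e.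
  move=> Ee eg0 h.
  pose N := [set b | idem b /\ (sg_le e b \/ exists2 a, M a & sg_le (a ** e) b)].
  have PN : P N.
    split.
    - by move=> b [].
    - move=> b c [Eb Nb] [Ec Nc]; split; first exact: idemM.
      have mono (u v w z : G) : sg_le u v -> sg_le w z -> sg_le (u ** w) (v ** z) by exact: (sle_mul iG).
      case: Nb Nc => [eb|[a Ma ab]] [ec|[a' Ma' ac]].
      + by left; exact: sle_meet.
      + right; exists a' => //; have := mono _ _ _ _ eb ac.
        by rewrite A (idemC iG Ee (ME _ Ma')) -A Ee.
      + right; exists a => //; have := mono _ _ _ _ ab ec.
        by rewrite -A Ee.
      + right; exists (a ** a'); first exact: MM.
        have := mono _ _ _ _ ab ac.
        by rewrite A -(A a e) (idemC iG Ee (ME _ Ma')) A -(A _ e e) Ee.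
    - move=> b c [Eb Nb] Ec bc; split=> //; case: Nb => [eb|[a Ma ab]].
        by left; exact: sle_trans bc.
      by right; exists a => //; exact: sle_trans bc.
    - move=> b [Eb Nb] bg0.
      have sle0' u : sg_le u b -> u ** g = sg_zero.
        move=> ub; apply: (sle_anti iG); last exact: sle0.
        by rewrite -bg0; apply: sle_mul => //; exact: sle_refl.
      by case: Nb => [/sle0'//|[a Ma /sle0']]; exact: h.
  have Ne : N e by split=> //; left; exact: sle_refl.
  apply: contrapT => nMe; apply: (maxM N) => //; split.
    move=> a Ma; split; first exact: ME.
    right; exists a => //; apply: sle_mulr => //.
  by move=> NM; exact/nMe/NM.
have Mg : M g.
  apply: ext => //; first by rewrite Eg.
  by move=> a Ma; rewrite -A Eg; exact: M0.
have xP : boolean_character M.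
  split=> //.
  - by exists g.
  - by move=> /M0; rewrite (sg0s iG).
  - move=> e f Ee Ef; split; last by case; exact: MM.
    have [? ?] := sle_mul_idem iG Ee Ef.
    by move=> Mef; split; apply: Mup Mef _ _.
  - move=> e f k Ee Ef j; have [Ek ek fk kmin] := j; split; last first.
      by case=> /Mup; apply.
    (* An idempotent outside [M] is annihilated by a member of [M]. Applied to [e] and [f], with
       distributivity, this gives a member annihilating their join [k]. *)
    have bad h : idem h -> ~ M h -> exists2 a, M a & a ** h = sg_zero.
      move=> Eh nMh; apply: contrapT => n; apply: nMh; apply: ext => //.
        by move=> h0; apply: n; exists g => //; rewrite (idemC iG).
      move=> a Ma ah0; apply: n; exists (a ** g); first exact: MM.
      by rewrite -A (idemC iG Eg Eh) A.
    move=> Mk; apply: contrapT => /not_orP[nMe nMf].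
    have [a Ma ae] := bad _ Ee nMe; have [b Mb bf] := bad _ Ef nMf.
    have Mab : M (a ** b) by exact: MM.
    have Eab := ME _ Mab.
    have jj := bool_distr B Eab Ee Ef j.
    have : a ** b ** k = sg_zero.
      apply: (join_uniq iG jj); rewrite -!A bf (sgs0 iG).
      rewrite (idemC iG (ME _ Mb) Ee) A ae (sg0s iG).
      split; [exact: idem0|exact: sle_refl|exact: sle_refl|by []].
    move=> abk0; apply: (M0 _ (MM _ _ Mab Mk)).
    by rewrite abk0 (sg0s iG).
by exists (exist _ M xP).
Qed.

(** If the relative complement of [f] in [e] were non-zero, a character containing it would contain
    [e] but not [f]. *)
Lemma ideal_open_le e f : idem e -> idem f -> ideal_open e `<=` ideal_open f ->
  sg_le e f.
Proof.
move=> Ee Ef ef; have [g [Eg gf j]] := bool_diff B Ef Ee.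
have [g0|g0] := pselect (g = sg_zero).
  have : e = f ** e.
    apply: (join_uniq iG j); rewrite g0.
    have Efe := idemM iG Ef Ee.
    by split=> //; [exact: sle_refl|exact: sle0].
  by move=> h; apply/(sle_idem iG).
have [x xg] := char_exists Eg g0; have [_ _ ge _] := j.
have xe : sval x e by apply: char_le xg.
have xf : sval x f by exact: ef.
have : sval x (g ** f) by rewrite charM.
by rewrite gf => /(char_0 (svalP x)).
Qed.

Lemma ideal_open_inj e f : idem e -> idem f -> ideal_open e = ideal_open f -> e = f.
Proof.
by move=> Ee Ef ef; apply: (sle_anti iG); apply: ideal_open_le => //; rewrite ef.
Qed.

(** A finite union of basic sets is basic, because idempotents have joins. *)
Lemma copen_ideal_open (U : set (dual G)) : copen U ->
  exists2 e, idem e & U = ideal_open e.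
Proof.
move=> [cU oU].
pose Q (V : set (dual G)) := V `<=` U /\ exists2 e, idem e & V = ideal_open e.
have [|||V [VU [e Ee VE]] UV] := @compact_ideal _ Q U _ _ _ cU.
- by split=> //; exists sg_zero; [exact: idem0|rewrite ideal_open0].
- move=> V W [VU [e Ee VE]] [WU [f Ef WE]]; rewrite {}VE in VU *; rewrite {}WE in WU *; split.
  + by move=> x [/VU|/WU].
  + have [g j] := bool_join B Ee Ef; exists g; first by case: j.
    by rewrite (ideal_openU Ee Ef j).
- move=> x Ux; have /dual_nbhs [e [Ee xe eU]] := open_nbhs_nbhs (conj oU Ux).
  exists (ideal_open e); first exact: char_nbhs.
  by split=> //; exists e.
by exists e => //; rewrite -VE; apply/seteqP.
Qed.

(** The image point is built as the pull-back of [x] along f |-> s^-* f s, whereas [phi] is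
    characterized by the opposite conjugation; only joins need an argument. *)
Lemma phi_exists s x : isg_dom s x ->
  exists y : dual G, forall f, idem f -> sval y f <-> sval x (s^-* ** f ** s).
Proof.
move=> sx; have Jid f : idem f -> idem (s^-* ** f ** s) by exact: idemJV.
have JM f g : idem f -> idem g ->
    (s^-* ** f ** s) ** (s^-* ** g ** s) = s^-* ** (f ** g) ** s.
  move=> Ef Eg; have -> : (s^-* ** f ** s) ** (s^-* ** g ** s) =
    s^-* ** f ** ((s ** s^-*) ** g) ** s by rewrite !A.
  by rewrite (idemC iG (idem_r iG s) Eg) !A -(A _ s s^-*) -(A _ (s ** _)) (sg_starK iG).
pose y : set G := [set f | idem f /\ sval x (s^-* ** f ** s)].
have yP : boolean_character y.
  split.
  - by move=> f [].
  - exists (s ** s^-*); split; first exact: idem_r.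
    by rewrite A (sg_starV iG).
  - by move=> [_]; rewrite (sgs0 iG) (sg0s iG) => /(char_0 (svalP x)).
  - move=> e f Ee Ef; rewrite /y /= -JM// charM; [|exact: Jid|exact: Jid].
    by split=> [[_ [? ?]]|[[_ ?] [_ ?]]]; split=> //; exact: idemM.
  - move=> e f g Ee Ef j; have [Eg eg fg gmin] := j.
    have jJ : is_join idem (s^-* ** e ** s) (s^-* ** f ** s) (s^-* ** g ** s).
      split; [exact: Jid| | |].
      + by apply: sle_mul (sle_refl iG _) => //; apply: sle_mul (sle_refl iG _) _.
      + by apply: sle_mul (sle_refl iG _) => //; apply: sle_mul (sle_refl iG _) _.
      + move=> k Ek ek fk.
        (* An upper bound [k] of the conjugates is carried to s k s^-*. It bounds the join of the
           two original idempotents cut down to the range of [s], and distributivity identifies that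
           join; conjugating back gives the bound for [g]. *)
        have := bool_distr B (idem_r iG s) Ee Ef j => j'.
        have [_ _ _] := j'.
        move=> /(_ (s ** k ** s^-*) (idemJ iG s Ek)) h.
        have c a : idem a -> s ** s^-* ** a = s ** (s^-* ** a ** s) ** s^-*.
          move=> Ea; rewrite -[in LHS](idem_r iG s) -A (idemC iG (idem_r iG s) Ea) !A.
          by rewrite -(A (s ** s^-*)).
        have := h.
        rewrite (c e)// (c f)// (c g)// => {}h.
        have le1 : sg_le (s ** (s^-* ** g ** s) ** s^-*) (s ** k ** s^-*).
          apply: h; apply: sle_mul (sle_refl iG _) => //;
            exact: sle_mul (sle_refl iG _) _.
        have := sle_mul iG (sle_mul iG (sle_refl iG s^-*) le1) (sle_refl iG s).
        have -> a : s^-* ** (s ** a ** s^-*) ** s = (s^-* ** s) ** a ** (s^-* ** s) by rewrite !A.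
        have -> : (s^-* ** s) ** (s^-* ** g ** s) ** (s^-* ** s) = s^-* ** g ** s.
          by rewrite !A (sg_starV iG) -!A (mul_d iG).
        move=> h1; apply: sle_trans h1 _ => //.
        have -> : s^-* ** (s ** k ** s^-*) ** s = (s^-* ** s ** k) ** (s^-* ** s) by rewrite !A.
        rewrite (idemC iG (idem_d iG s) Ek) -A.
        exact: sle_mulr (idemM iG (idem_d iG s) (idem_d iG s)).
    rewrite /y /= (char_join (svalP x) (Jid _ Ee) (Jid _ Ef) jJ).
    by split=> [[_ [?|?]]|[[_ ?]|[_ ?]]]; [left|right| |]; split=> //; [left|right].
exists (exist _ y yP) => f Ef; rewrite /= /y /=; split=> [[]//|]; by split.
Qed.

Lemma charMM e f x : idem e -> idem f -> sval x f ->
  sval x (f ** (e ** f)) <-> sval x e.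
Proof.
move=> Ee Ef xf; rewrite charM//; last exact: idemM.
by rewrite charM//; tauto.
Qed.

(** A character containing r = s s^-* does not distinguish [f] from r f r, so its values on the
    conjugates s e s^-* determine it. *)
Lemma phi_uniq s x y : isg_dom s x ->
  (forall e, idem e -> sval x e <-> sval y (s ** e ** s^-*)) -> phi s x = y.
Proof.
move=> sx yE; rewrite /phi.
have key (z : dual G) : (forall e, idem e -> sval x e <-> sval z (s ** e ** s^-*)) ->
    forall f, idem f -> sval z f <-> sval x (s^-* ** f ** s).
  move=> zE f Ef; rewrite zE; last exact: idemJV.
  have zr : sval z (s ** s^-*).
    have := (zE (s^-* ** s) (idem_d iG s)).1 sx.
    by rewrite A (sg_starK iG).
  have -> : s ** (s^-* ** f ** s) ** s^-* = (s ** s^-*) ** (f ** (s ** s^-*)) by rewrite !A.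
  by rewrite (charMM Ef (idem_r iG s) zr).
apply: xget_unique => // z /key zE; apply: dual_eq => f Ef.
by rewrite zE// (key _ yE).
Qed.

Lemma phiP s x : isg_dom s x ->
  forall f, idem f -> sval (phi s x) f <-> sval x (s^-* ** f ** s).
Proof.
move=> sx; have [y yE] := phi_exists sx.
suff -> : phi s x = y by [].
apply: phi_uniq => // e Ee; rewrite yE; last exact: idemJ.
have -> : s^-* ** (s ** e ** s^-*) ** s = (s^-* ** s) ** (e ** (s^-* ** s)) by rewrite !A.
by rewrite (charMM Ee (idem_d iG s) sx).
Qed.

Lemma phi_ran s x : isg_dom s x -> isg_ran s (phi s x).
Proof.
move=> sx; rewrite /isg_ran /ideal_open /= phiP//; last exact: idem_r.
by rewrite A (sg_starV iG).
Qed.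

Lemma phi_formulaP s x : isg_dom s x -> isg_ran s (phi s x) /\
    forall e, idem e -> sval x e <-> sval (phi s x) (s ** e ** s^-*).
Proof.
move=> sx; split; first exact: phi_ran.
move=> e Ee; rewrite phiP//; last exact: idemJ.
have -> : s^-* ** (s ** e ** s^-*) ** s = (s^-* ** s) ** (e ** (s^-* ** s)) by rewrite !A.
by rewrite (charMM Ee (idem_d iG s) sx).
Qed.

Lemma isg_dom_star s : isg_dom s^-* = isg_ran s.
Proof. by rewrite /isg_dom starK. Qed.

Lemma isg_ran_star s : isg_ran s^-* = isg_dom s.
Proof. by rewrite /isg_ran starK. Qed.

Lemma isg_domM s t x :
  isg_dom (s ** t) x <-> isg_dom t x /\ isg_dom s (phi t x).
Proof.
split.
  move=> stx; have tx : isg_dom t x.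
    apply: char_le stx; last exact: idem_d.
    rewrite dM//; apply: (sle_trans iG (t := t^-* ** t)); last exact: sle_refl.
    rewrite -!A; exists (t^-* ** (s^-* ** s) ** t); first exact/idemJV/idem_d.
    by rewrite !A (sg_starV iG).
  by split=> //; rewrite /isg_dom /ideal_open /= phiP//; [rewrite -dM|exact: idem_d].
by move=> [tx]; rewrite /isg_dom /ideal_open /= phiP//; [rewrite -dM|exact: idem_d].
Qed.

Lemma phiM s t x : isg_dom t x -> isg_dom s (phi t x) ->
  phi (s ** t) x = phi s (phi t x).
Proof.
move=> tx stx; have stx' : isg_dom (s ** t) x by apply/isg_domM.
apply: dual_eq => f Ef; rewrite !phiP//; last exact: idemJV.
by rewrite starM// !A.
Qed.

Lemma isg_dom_idem e x : idem e -> isg_dom e x <-> sval x e.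
Proof. by move=> Ee; rewrite /isg_dom /ideal_open /= (idem_star iG Ee) Ee. Qed.

Lemma phi_idem e x : sval x e -> phi e x = x.
Proof.
move=> xe; have Ee := char_idem xe; have ex : isg_dom e x by apply/isg_dom_idem.
apply: dual_eq => f Ef; rewrite phiP// (idem_star iG Ee) charM ?charM//; first tauto.
exact: idemM.
Qed.

Lemma phiK s x : isg_dom s x -> phi s^-* (phi s x) = x.
Proof.
move=> sx; rewrite -phiM//; last by rewrite isg_dom_star; exact: phi_ran.
exact: phi_idem.
Qed.

Lemma phi_open s e : idem e ->
  isg_dom s `&` phi s @^-1` ideal_open e = ideal_open (s^-* ** e ** s).
Proof.
move=> Ee; apply/seteqP; split=> x; first by move=> [sx]; rewrite /ideal_open /= phiP.
rewrite /ideal_open /= => xe.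
have sx : isg_dom s x.
  apply: char_le xe; last exact: idem_d.
  exists (s^-* ** e ** s); first exact: idemJV.
  by rewrite !A (sg_starV iG).
by split=> //=; rewrite phiP.
Qed.

Lemma phi_continuous s x : isg_dom s x -> {for x, continuous (phi s)}.
Proof.
move=> sx W /dual_nbhs [e [Ee xe eW]]; apply/dual_nbhs.
exists (s^-* ** e ** s); split; [exact: idemJV|by rewrite -phiP|].
by rewrite -phi_open// => y [_ /eW].
Qed.

Lemma isg_dom_open s : open (isg_dom s).
Proof. exact/ideal_open_open/idem_d. Qed.

Lemma isg_dom_nbhs s x : isg_dom s x -> nbhs x (isg_dom s).
Proof. by move=> sx; apply: open_nbhs_nbhs; split=> //; exact: isg_dom_open. Qed.

End Dual.

(** * The semigroup T(X) *)

Section TX.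
Variables (R : realType) (X : topologicalType).
Implicit Types (h k : X -> C R) (U : set X).

Lemma TX_copen h : is_TX h -> copen [set x | h x != 0].
Proof. by case. Qed.

Lemma TX_continuous h x : is_TX h -> h x != 0 -> {for x, continuous h}.
Proof. by move=> [_ oU _ ch] h0; exact: (within_cont_at oU ch). Qed.

Definition restrict0 U (f : X -> C R) : X -> C R :=
  fun x => if `[< U x >] then f x else 0.

Lemma TX_restrict0 U f : copen U -> (forall x, U x -> circle (f x)) ->
  {within U, continuous f} -> is_TX (restrict0 U f).
Proof.
move=> [cU oU] fc cf; have sE : [set x | restrict0 U f x != 0] = U.
  apply/seteqP; split=> x; rewrite /restrict0 /=; case: asboolP => //.
    by rewrite eqxx.
  by move=> Ux _; exact/circle_neq0/fc.
apply: IsTX; [by rewrite sE|by rewrite sE| |rewrite sE].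
  by move=> x; rewrite /restrict0; case: asboolP => [/fc//|_]; rewrite eqxx.
by apply: within_cont_eq cf => x Ux; rewrite /restrict0; case: asboolP.
Qed.

Lemma indicatorE U : indicator R U = restrict0 U (fun=> 1) :> (X -> C R).
Proof.
apply/funext => x; rewrite /indicator /restrict0; case: asboolP => Ux.
  by rewrite mem_set.
by rewrite memNset.
Qed.

Lemma TX_indicator U : copen U -> is_TX (indicator R U : X -> C R).
Proof.
move=> cU; rewrite indicatorE; apply: TX_restrict0 => // [x _|]; first exact: circle1.
by apply: within_cont_open => x _; exact: cst_continuous.
Qed.

Lemma TX_cst U (z : C R) : circle z -> copen U -> is_TX (restrict0 U (fun=> z)).
Proof.
move=> cz cU; apply: TX_restrict0 => //.
by apply: within_cont_open => x _; exact: cst_continuous.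
Qed.

Lemma TX_V h : is_TX h -> is_TX (fun x => (h x)^-1).
Proof.
move=> hT; rewrite (_ : (fun _ => _) = restrict0 [set x | h x != 0] (fun x => (h x)^-1)).
  apply: TX_restrict0; first exact: TX_copen.
    by move=> x; move/(TX_circle hT)/circleV.
  apply: within_cont_open => x h0 W nW.
  have := continuous_near (TX_continuous hT h0) (inv_nbhs h0 nW).
  by rewrite nbhs_simpl.
by apply/funext => x; rewrite /restrict0; case: asboolP => //= /negP; rewrite negbK => /eqP ->; rewrite invr0.
Qed.

Hypothesis HX : hausdorff_space X.

Lemma TX_M h k : is_TX h -> is_TX k -> is_TX (fun x => h x * k x).
Proof.
move=> hT kT.
rewrite (_ : (fun _ => _) = restrict0 ([set x | h x != 0] `&` [set x | k x != 0]) (fun x => h x * k x)).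
  apply: TX_restrict0; first by apply: copenI => //; exact: TX_copen.
    by move=> x [/(TX_circle hT) ? /(TX_circle kT) ?]; exact: circleM.
  apply: within_cont_open => x [h0 k0] W /mul_nbhs [U [V [nU nV UV]]].
  have n1 := continuous_near (TX_continuous hT h0) nU.
  have n2 := continuous_near (TX_continuous kT k0) nV.
  by rewrite nbhs_simpl; apply: filterS2 n1 n2 => y; exact: UV.
apply/funext => x; rewrite /restrict0; case: asboolP => // n.
have [->|h0] := eqVneq (h x) 0; first by rewrite mul0r.
have [->|k0] := eqVneq (k x) 0; first by rewrite mulr0.
by case: n.
Qed.

Lemma TX_near h x W : is_TX h -> h x != 0 -> nbhs (h x) W ->
  \forall y \near x, h y != 0 /\ W (h y).
Proof.
move=> hT h0 nW; have n1 := continuous_near (TX_continuous hT h0) nW.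
have n2 := open_nbhs_nbhs (conj (TX_open hT) h0).
by apply: filterS2 n1 n2.
Qed.
End TX.

Lemma TX_comp (R : realType) (X Y : topologicalType) (rho : Y -> X) (h : X -> C R) :
  continuous rho -> (forall U, copen U -> compact (rho @^-1` U)) ->
  is_TX h -> is_TX (h \o rho).
Proof.
move=> crho prho hT; have [cU oU hc ch] := hT.
split=> /=; first exact: (prho [set x | h x != 0]).
- by move/continuousP: crho => /(_ _ oU).
- by move=> x; exact: hc.
- apply: within_cont_open => x h0.
  exact: (continuous_comp (crho x) (TX_continuous hT h0)).
Qed.

Lemma push_TX (R : realType) (G : sg_data) (bG : boolean_isg G) (g : G)
    (h : dual G -> C R) : is_TX h -> is_TX (push g h).
Proof.
have iG := bisg_isg bG; have HX := dual_hausdorff bG.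
move=> hT; pose f := h \o phi g^-*.
pose U := isg_ran g `&` phi g^-* @^-1` [set x | h x != 0].
have rE : isg_ran g = isg_dom g^-* by rewrite isg_dom_star.
have cphi : {within isg_ran g, continuous (phi g^-*)}.
  by apply: within_cont_open => x gx; apply: phi_continuous => //; rewrite -rE.
have cU : copen U.
  by apply: copen_preimage => //; [exact/ideal_open_copen/idem_r|exact: TX_copen].
rewrite (_ : push g h = restrict0 U f).
  apply: TX_restrict0 => //; first by move=> x [_ /(TX_circle hT)].
  apply: within_cont_open => x [gx h0].
  apply: continuous_comp; last exact: TX_continuous.
  by apply: phi_continuous => //; rewrite -rE.
apply/funext => x; rewrite /push /restrict0 /f /=.
case: asboolP => gx; case: asboolP => //; last by case.
by move=> n; apply/eqP/negPn/negP => h0; apply: n; split.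
Qed.

(** * Calculus in a twisted Boolean inverse semigroup *)

Section Tbis.
Variables (R : realType) (D : tbis R).
Local Notation G := (tbG D).
Local Notation S := (tbS D).
Local Notation X := (dual (tbG D)).
Let P := tbisP D.
Let bG : boolean_isg G := tbisG P.
Let iG : inverse_semigroup G := bisg_isg bG.
Let iS : inverse_semigroup S := tbisS P.
Let A := sgA iS.
Let HX : hausdorff_space X := dual_hausdorff bG.
Implicit Types (s t : S) (x : X) (h k : X -> C R).

(** The inverse of [tbp] on idempotents. *)
Definition tunit (e : G) : S := tbi (indicator R (ideal_open e)).

Lemma TX_ideal e : idem e -> is_TX (indicator R (ideal_open e) : X -> C R).
Proof. by move=> Ee; apply: TX_indicator; exact: ideal_open_copen. Qed.

Lemma TX_mul h k : is_TX h -> is_TX k -> is_TX (fun x : X => h x * k x).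
Proof. exact: TX_M. Qed.

Lemma tiC h k : is_TX h -> is_TX k -> tbi h ** tbi k = tbi k ** tbi h :> S.
Proof.
move=> hT kT; rewrite -!(tbis_iM P)//.
by congr tbi; apply/funext => x; rewrite mulrC.
Qed.

Lemma tunit_idem e : idem e -> idem (tunit e).
Proof.
move=> Ee; rewrite /idem /= -(tbis_iM P); [|exact: TX_ideal|exact: TX_ideal].
by congr tbi; apply/funext => x; rewrite /indicator -natrM mulnb andbb.
Qed.

Lemma p_star s : tbp s^-* = (tbp s)^-* :> G.
Proof.
apply: (sg_star_uniq iG); rewrite -!(tbisM P).
  by rewrite (sg_starK iS).
by rewrite (sg_starV iS).
Qed.

Lemma p_idem s : idem s -> idem (tbp s : G).
Proof. by rewrite /idem /= -(tbisM P) => ->. Qed.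

Lemma p_tunit e : idem e -> tbp (tunit e) = e.
Proof. exact: (tbis_i1 P). Qed.

Lemma idem_tunit s : idem s -> tunit (tbp s) = s.
Proof.
move=> Es; apply: (tbis_idem P) => //; first exact/tunit_idem/p_idem.
exact/p_tunit/p_idem.
Qed.

Lemma tunit_d s : s^-* ** s = tunit ((tbp s)^-* ** tbp s).
Proof. by rewrite -p_star -(tbisM P) idem_tunit//; exact: idem_d. Qed.

Lemma tunit_r s : s ** s^-* = tunit (tbp s ** (tbp s)^-*).
Proof. by rewrite -p_star -(tbisM P) idem_tunit//; exact: idem_r. Qed.

Lemma p_ti_idem h : is_TX h -> idem (tbp (tbi h : S)).
Proof. by move=> hT; apply/(tbis_ker P); exists h. Qed.

Lemma ti_tunit e h : idem e -> is_TX h -> [set x | h x != 0] `<=` ideal_open e ->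
  tbi h ** tunit e = tbi h.
Proof.
move=> Ee hT he; rewrite /tunit -(tbis_iM P)//; last exact: TX_ideal.
congr tbi; apply/funext => x; rewrite /indicator.
have [->|h0] := eqVneq (h x) 0; first by rewrite mul0r.
by rewrite mem_set ?mulr1//; exact: he.
Qed.

(** Let [e] be the idempotent of the support. From h 1_e = h the image of [h] lies below [e], and
    from h h^-1 = 1_e it lies above. *)
Lemma p_ti h : is_TX h -> ideal_open (tbp (tbi h : S)) = [set x | h x != 0].
Proof.
move=> hT; have [e Ee hE] := copen_ideal_open bG (TX_copen hT).
rewrite hE; congr ideal_open; have Eh := p_ti_idem hT.
have h1 : tbi h ** tunit e = tbi h by apply: ti_tunit => //; rewrite hE.
have hVT := TX_V hT; have EhV := p_ti_idem hVT.
have h2 : tbi h ** tbi (fun x => (h x)^-1) = tunit e.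
  rewrite -(tbis_iM P)//; congr tbi; rewrite -hE indicatorE.
  apply/funext => x; rewrite /restrict0; case: asboolP => /= [h0|/negP].
    by rewrite mulfV.
  by rewrite negbK => /eqP ->; rewrite mul0r.
have := congr1 (@tbp _ D) h2; rewrite (tbisM P) p_tunit// => h3.
have := congr1 (@tbp _ D) h1; rewrite (tbisM P) p_tunit// => h4.
by rewrite -h4 (idemC iG Eh Ee) -{1}h3 -(sgA iG) (idemC iG EhV Eh) (sgA iG) Eh.
Qed.

Lemma ti_starE h : is_TX h -> (tbi h : S)^-* = tbi (fun x => (h x)^-1).
Proof.
move=> hT; have hVT := TX_V hT; apply/esym/(sg_star_uniq iS);
  rewrite -!(tbis_iM P) //; try exact: TX_mul.
all: congr tbi; apply/funext => x; have [->|h0] := eqVneq (h x) 0;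
  by rewrite ?(invr0, mul0r)// ?mulfV// ?mulVf// mul1r.
Qed.

Lemma TX_push (g : G) h : is_TX h -> is_TX (push g h).
Proof. exact: push_TX. Qed.

Definition pull (g : G) h : X -> C R := push g^-* h.

Lemma pullE g h x : isg_dom g x -> pull g h x = h (phi g x).
Proof.
move=> gx; rewrite /pull /push (isg_ran_star bG) starK//.
by case: asboolP.
Qed.

Lemma TX_pull g h : is_TX h -> is_TX (pull g h).
Proof. exact: TX_push. Qed.

(** Covariance turned into a commutation rule: functions move to the right of [s], which is how
    products of representatives of germs are compared. *)
Lemma ti_mul s h : is_TX h -> tbi h ** s = s ** tbi (pull (tbp s) h).
Proof.
move=> hT; rewrite /pull -p_star -(tbis_covariant P)// starK//.
rewrite !A tunit_r /tunit tiC//; last exact/TX_ideal/idem_r.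
by rewrite -/(tunit _) -tunit_r -A (sg_starK iS).
Qed.

Lemma ti_free s h k : is_TX h -> is_TX k -> s ** tbi h = s ** tbi k ->
  forall x, isg_dom (tbp s) x -> h x = k x.
Proof.
move=> hT kT /(congr1 (fun t => s^-* ** t)); rewrite !A tunit_d /tunit.
have Ed := idem_d iG (tbp s); have dT := TX_ideal Ed.
rewrite -!(tbis_iM P)// => /(tbis_i_inj P); move=> /(_ (TX_mul dT hT) (TX_mul dT kT)).
by move=> e x sx; have := congr1 (@^~ x) e; rewrite /indicator mem_set//= !mul1r.
Qed.

(** The function is s^-* t, which lies in the kernel because its image is the idempotent of the
    domain. *)
Lemma p_eq s t : tbp s = tbp t -> exists c, [/\ is_TX c, t = s ** tbi c &
  forall x, c x != 0 <-> isg_dom (tbp s) x].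
Proof.
move=> st; have /(tbis_ker P) [c cT cE] : idem (tbp (s^-* ** t) : G).
  by rewrite (tbisM P) p_star st; exact: idem_d.
exists c; split=> //.
  by rewrite cE A tunit_r st -tunit_r (sg_starK iS).
move=> x; have := p_ti cT; rewrite cE (tbisM P) p_star -st => h.
by rewrite -[X in X <-> _]/([set x | c x != 0] x) -h.
Qed.

Lemma sdomain_ti s c x : is_TX c ->
  sdomain (s ** tbi c) x <-> sdomain s x /\ c x != 0.
Proof.
move=> cT; rewrite /sdomain (tbisM P) isg_domM// isg_dom_idem//; last exact: p_ti_idem.
have cx : sval x (tbp (tbi c : S)) <-> c x != 0.
  by rewrite -[X in X <-> _]/(ideal_open _ x) p_ti.
by split=> [[/cx ?]|[? /cx ?]]; rewrite phi_idem//; apply/cx.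
Qed.

Lemma sphi_ti s c x : is_TX c -> sdomain (s ** tbi c) x ->
  sphi (s ** tbi c) x = sphi s x.
Proof.
move=> cT; rewrite /sdomain /sphi (tbisM P) isg_domM// => -[h1 h2].
have Ec := p_ti_idem cT; have cx : sval x (tbp (tbi c : S)) by apply/isg_dom_idem.
by rewrite phiM// (phi_idem bG cx).
Qed.

Lemma sdomain_mul s t x : sdomain (s ** t) x <-> sdomain t x /\ sdomain s (sphi t x).
Proof. by rewrite /sdomain (tbisM P) isg_domM. Qed.

Lemma sphi_mul s t x : sdomain t x -> sdomain s (sphi t x) ->
  sphi (s ** t) x = sphi s (sphi t x).
Proof. by move=> tx sx; rewrite /sphi (tbisM P) phiM. Qed.

Lemma sdomain_star s x : sdomain s x -> sdomain s^-* (sphi s x).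
Proof.
by move=> sx; rewrite /sdomain p_star (isg_dom_star bG); exact: phi_ran.
Qed.

Lemma sphi_star s x : sdomain s x -> sphi s^-* (sphi s x) = x.
Proof. by move=> sx; rewrite /sphi p_star phiK. Qed.

Lemma sdomain_idem (s : S) x : idem s -> sdomain s x <-> sval x (tbp s).
Proof. by move=> Es; rewrite /sdomain isg_dom_idem//; exact: p_idem. Qed.

Lemma sphi_idem (s : S) x : idem s -> sdomain s x -> sphi s x = x.
Proof. by move=> Es /(sdomain_idem _ Es) sx; rewrite /sphi phi_idem. Qed.

End Tbis.

(** The properties of the set of allowed values that make germs a groupoid; the two relations, with
    values in {1} and in the circle, are treated together. *)
Record scalar_group (R : realType) (V : set (C R)) : Prop := ScalarGroup {
  scalar1 : V 1;
  scalarM : forall z w, V z -> V w -> V (z * w);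
  scalarV : forall z, V z -> V z^-1;
  scalar_circle : V `<=` @circle R }.

Lemma scalar_group_circle (R : realType) : scalar_group (@circle R).
Proof. by split; [exact: circle1|exact: circleM|exact: circleV|]. Qed.

Lemma scalar_group1 (R : realType) : scalar_group ([set 1] : set (C R)).
Proof.
split=> [//|z w -> ->|z ->|z ->]; [by rewrite /= mulr1|by rewrite /= invr1|].
exact: circle1.
Qed.

(** * The twisted groupoid of germs *)

Section GermAlgebra.
Variables (R : realType) (D : tbis R) (V : set (C R)).
Hypothesis hV : scalar_group V.
Let V1 := scalar1 hV.
Let VM := scalarM hV.
Let VV := scalarV hV.
Let Vcircle := scalar_circle hV.
Local Notation G := (tbG D).
Local Notation S := (tbS D).
Local Notation X := (dual (tbG D)).
Let P := tbisP D.
Let bG : boolean_isg G := tbisG P.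
Let iG : inverse_semigroup G := bisg_isg bG.
Let iS : inverse_semigroup S := tbisS P.
Let A := sgA iS.
Implicit Types (s t : S) (x y : X) (g h : germs D V).

(* The value is the unit at x, a junk value, when x is not in the domain of s. *)
Definition gtot s x : germs D V :=
  if pselect (sdomain s x) is left sx then germ V sx else germ_u V x.

Lemma gtotE s x (sx : sdomain s x) : germ V sx = gtot s x.
Proof.
by rewrite /gtot; case: pselect => // sx'; rewrite (Prop_irrelevance sx sx').
Qed.

Definition germ_sim s t x := exists a b, [/\ is_TX a, is_TX b, V (a x), V (b x) &
  s ** tbi a = t ** tbi b].

Lemma germ_sim_refl s x : sdomain s x -> germ_sim s s x.
Proof.
move=> sx; have dT := @TX_ideal R D _ (idem_d iG (tbp s)).
exists (indicator R (isg_dom (tbp s))), (indicator R (isg_dom (tbp s))).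
by split=> //; rewrite /indicator mem_set.
Qed.

Lemma germ_sim_sym s t x : germ_sim s t x -> germ_sim t s x.
Proof. by move=> [a [b [? ? ? ? e]]]; exists b, a. Qed.

(** The witnesses are multiplied crosswise, T(X) being commutative. *)
Lemma germ_sim_trans t s u x : germ_sim s t x -> germ_sim t u x -> germ_sim s u x.
Proof.
move=> [a [b [aT bT Va Vb e]]] [c [d [cT dT Vc Vd e']]].
exists (fun x => a x * c x), (fun x => d x * b x).
split; [exact: TX_mul|exact: TX_mul|exact: VM|exact: VM|].
by rewrite !(tbis_iM P)// A e -A (tiC bT cT) A e' -A.
Qed.

Lemma germ_eqP s t x y (sx : sdomain s x) (ty : sdomain t y) :
  germ V sx = germ V ty <-> x = y /\ germ_sim s t x.
Proof.
split.
  move=> /(congr1 sval) /= e.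
  have : germ_rel V (exist _ (t, y) ty) (exist _ (t, y) ty).
    by split=> //=; exact: germ_sim_refl.
  by rewrite -e => -[/= -> ].
move=> [xy]; subst y => st; apply: eq_exist; apply/funext => -[[u z] uz] /=; apply/propext.
rewrite /germ_rel /=; split=> -[xz h]; split=> //.
  exact: germ_sim_trans (germ_sim_sym st) h.
exact: germ_sim_trans st h.
Qed.

Lemma gtot_eq s t x : sdomain s x -> sdomain t x ->
  gtot s x = gtot t x <-> germ_sim s t x.
Proof.
move=> sx tx; rewrite -(gtotE sx) -(gtotE tx) germ_eqP.
by split=> [[]|].
Qed.

Lemma germ_dE s x (sx : sdomain s x) : germ_d (germ V sx) = x.
Proof.
rewrite /germ_d /germ_rep; case: cid => -[[t y] ty] /= e.
have : germ V sx = germ V ty by apply: eq_exist.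
by move/germ_eqP => [].
Qed.

Lemma gtot_d s x : germ_d (gtot s x) = x.
Proof. by rewrite /gtot; case: pselect => *; exact: germ_dE. Qed.

Lemma gtotP g : exists s, sdomain s (germ_d g) /\ g = gtot s (germ_d g).
Proof.
case: g => B [[[s x] sx] E]; exists s.
have -> : exist _ B (ex_intro _ (exist _ (s, x) sx) E) = germ V sx.
  by apply: eq_exist.
by rewrite germ_dE gtotE.
Qed.

Lemma germ_sim_sphi s t x : sdomain s x -> sdomain t x -> germ_sim s t x ->
  sphi s x = sphi t x.
Proof.
move=> sx tx [a [b [aT bT /Vcircle/circle_neq0 a0 /Vcircle/circle_neq0 b0 e]]].
have sa : sdomain (s ** tbi a) x by apply/sdomain_ti.
have tb : sdomain (t ** tbi b) x by apply/sdomain_ti.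
by rewrite -(sphi_ti aT sa) e (sphi_ti bT tb).
Qed.

Lemma gtot_r s x : sdomain s x -> germ_r (gtot s x) = sphi s x.
Proof.
move=> sx; rewrite -gtotE /germ_r /germ_rep; case: cid => -[[t y] ty] /= e.
have /= : germ V sx = germ V ty by apply: eq_exist.
rewrite germ_eqP /= => -[xy st]; move: ty e; rewrite /= -xy => ty _.
exact/esym/germ_sim_sphi.
Qed.

(** Witnesses for the left factor pass to the right of [t] as pull-backs, whose value at [x] is the
    original value at the image of [x]. *)
Lemma germ_simM s s' t t' x : sdomain t x -> sdomain t' x ->
  germ_sim s s' (sphi t x) -> germ_sim t t' x -> germ_sim (s ** t) (s' ** t') x.
Proof.
move=> tx tx' ss tt; have tE := germ_sim_sphi tx tx' tt.
have [a [b [aT bT Va Vb e]]] := ss; have [c [d [cT dT Vc Vd e']]] := tt.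
exists (fun x => pull (tbp t) a x * c x), (fun x => pull (tbp t') b x * d x).
split.
- by apply: TX_mul => //; exact: TX_pull.
- by apply: TX_mul => //; exact: TX_pull.
- by apply: VM => //; rewrite pullE.
- by apply: VM => //; rewrite pullE // -?[phi _ _]tE; move: Vb; rewrite tE.
- rewrite !(tbis_iM P)//; try exact: TX_pull.
  by rewrite !A -!(A _ _ (tbi (pull _ _))) -!ti_mul// !A e -A e' A.
Qed.

Lemma gtot_m s t x : sdomain t x -> sdomain s (sphi t x) ->
  germ_m (gtot s (sphi t x)) (gtot t x) = gtot (s ** t) x.
Proof.
move=> tx sx; have stx : sdomain (s ** t) x by apply/sdomain_mul.
rewrite -!gtotE /germ_m; apply: xget_unique.
  by exists s, t, x, tx, sx, stx.
move=> _ [s' [t' [x' [tx' [sx' [stx' [/germ_eqP[xE e1] /germ_eqP[xx e2] ->]]]]]]].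
subst x'; apply/germ_eqP; split=> //.
by apply: germ_sim_sym; exact: germ_simM.
Qed.

Lemma germ_simV s t x : sdomain s x -> sdomain t x -> germ_sim s t x ->
  germ_sim s^-* t^-* (sphi s x).
Proof.
move=> sx tx st; have sE := germ_sim_sphi sx tx st.
have [a [b [aT bT Va Vb e]]] := st.
have aVT := TX_V aT; have bVT := TX_V bT.
exists (pull (tbp s)^-* (fun x => (a x)^-1)), (pull (tbp t)^-* (fun x => (b x)^-1)).
have sx' := sdomain_star sx; have tx' := sdomain_star tx.
move: sx' tx'; rewrite /sdomain !p_star => sx' tx'.
split; [exact: TX_pull|exact: TX_pull| | |].
- by rewrite pullE//; apply: VV; rewrite -p_star -/(sphi _ _) sphi_star.
- by rewrite sE pullE//; apply: VV; rewrite -p_star -/(sphi _ _) sphi_star.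
- by rewrite -!p_star -!ti_mul// -!ti_starE// -!starM// e.
Qed.

Lemma gtot_i s x : sdomain s x -> germ_i (gtot s x) = gtot s^-* (sphi s x).
Proof.
move=> sx; have sx' := sdomain_star sx; rewrite -!gtotE /germ_i.
apply: xget_unique; first by exists s, x, sx, sx'.
move=> _ [t [y [ty [ty' [/germ_eqP[xy st] ->]]]]]; subst y.
apply/germ_eqP; split; first exact/esym/germ_sim_sphi.
rewrite -(germ_sim_sphi sx ty st); apply: germ_sim_sym; exact: germ_simV.
Qed.

Lemma gtot_u (e : S) x : idem e -> sdomain e x -> gtot e x = germ_u V x.
Proof.
move=> Ee ex; rewrite -gtotE; apply/germ_eqP; split=> //.
have Ec := @char_elt_idem _ D x.
have := @unit_domain _ D x; rewrite -/(@tunit R D (char_elt x)).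
move: (@tunit_idem R D _ Ec); set f := tunit _ => Ef fx.
have p1 : sval x (tbp e) by apply/sdomain_idem.
have p2 : sval x (tbp f) by apply/sdomain_idem.
(* Each of the two idempotents is multiplied by the other. *)
exists (indicator R (ideal_open (tbp f))), (indicator R (ideal_open (tbp e))).
split.
- exact/TX_ideal/p_idem.
- exact/TX_ideal/p_idem.
- by rewrite /indicator mem_set.
- by rewrite /indicator mem_set.
- by rewrite -!/(tunit _) !idem_tunit//; exact: idemC.
Qed.

Lemma gtot_uP x : exists e, [/\ idem e, sdomain e x & germ_u V x = gtot e x].
Proof.
have Ef := @tunit_idem R D _ (@char_elt_idem _ D x).
have fx := @unit_domain _ D x.
by exists (@tunit R D (char_elt x)); split=> //; rewrite gtot_u.
Qed.

Lemma gtot_mul_idem s e x : idem e -> sdomain s x -> sdomain e x ->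
  gtot (s ** e) x = gtot s x.
Proof.
move=> Ee sx ex; have eT := @TX_ideal R D _ (p_idem Ee).
have p1 : sval x (tbp e) by apply/sdomain_idem.
have sex : sdomain (s ** e) x by apply/sdomain_mul; rewrite sphi_idem.
apply/gtot_eq => //; exists (indicator R (ideal_open (tbp e))), (indicator R (ideal_open (tbp e))).
split=> //; try by rewrite /indicator mem_set.
by rewrite -!/(tunit _) !idem_tunit// -A Ee.
Qed.

Lemma germ_gpd_laws :
  [/\ forall x, germ_d (germ_u V x) = x /\ germ_r (germ_u V x) = x,
      forall g h, germ_d g = germ_r h ->
        germ_d (germ_m g h) = germ_d h /\ germ_r (germ_m g h) = germ_r g,
      forall g h k : germs D V, germ_d g = germ_r h -> germ_d h = germ_r k ->
        germ_m g (germ_m h k) = germ_m (germ_m g h) k,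
      forall g, germ_m (germ_u V (germ_r g)) g = g /\
        germ_m g (germ_u V (germ_d g)) = g &
      forall g, [/\ germ_d (germ_i g) = germ_r g, germ_r (germ_i g) = germ_d g,
        germ_m (germ_i g) g = germ_u V (germ_d g) &
        germ_m g (germ_i g) = germ_u V (germ_r g)]].
Proof.
have gP g : exists s x, sdomain s x /\ g = gtot s x.
  by have [s [? ?]] := gtotP g; exists s, (germ_d g).
split.
- move=> x; have [e [Ee ex ->]] := gtot_uP x.
  by rewrite gtot_d gtot_r// sphi_idem.
- move=> g h; have [s [x [sx ->]]] := gP g; have [t [y [ty ->]]] := gP h.
  rewrite gtot_d gtot_r// => xy; subst x.
  by rewrite gtot_m// !gtot_d !gtot_r ?sphi_mul//; apply/sdomain_mul.
- move=> g h k; have [s [x [sx ->]]] := gP g; have [t [y [ty ->]]] := gP h.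
  have [u [z [uz ->]]] := gP k; rewrite !gtot_d !gtot_r// => xy yz; subst x y.
  have sy : sdomain s (sphi (t ** u) z) by rewrite sphi_mul.
  have stz : sdomain (s ** t) (sphi u z) by apply/sdomain_mul.
  have tuz : sdomain (t ** u) z by apply/sdomain_mul.
  rewrite (gtot_m ty sx) (gtot_m uz ty) (gtot_m uz stz).
  by rewrite -(sphi_mul uz ty) (gtot_m tuz sy) A.
- move=> g; have [s [x [sx ->]]] := gP g; rewrite gtot_d gtot_r//.
  have Ed := idem_d iS s; have Er := idem_r iS s; split.
    have h : sdomain (s ** s^-*) (sphi s x).
      by apply/sdomain_mul; rewrite sphi_star//; split=> //; exact: sdomain_star.
    by rewrite -(gtot_u Er h) gtot_m// sg_starK.
  have h : sdomain (s^-* ** s) x by apply/sdomain_mul; split=> //; exact: sdomain_star.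
  rewrite -(gtot_u Ed h) -{1}(sphi_idem Ed h) gtot_m//; last by rewrite sphi_idem.
  by rewrite mul_d.
- move=> g; have [s [x [sx ->]]] := gP g; rewrite gtot_i// !gtot_d !gtot_r//; last exact: sdomain_star.
  have sx' := sdomain_star sx.
  split=> //; first by rewrite sphi_star.
    by rewrite gtot_m// gtot_u//; [exact: idem_d|apply/sdomain_mul].
  rewrite -{1}(sphi_star sx) gtot_m//; last by rewrite sphi_star.
  rewrite gtot_u//; first exact: idem_r.
  by apply/sdomain_mul; rewrite sphi_star.
Qed.

(** Dividing both witnesses by [a] turns the left one into the idempotent of the support of [a].
    Equality of germs at one point thus becomes an equality in the semigroup, valid over a
    neighbourhood. *)
Lemma germ_sim_local s t x : sdomain s x -> germ_sim s t x ->
  exists e k, [/\ idem e, sdomain e x, is_TX k, V (k x) & s ** e = t ** tbi k].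
Proof.
move=> sx [a [b [aT bT Va Vb e]]].
have aVT := TX_V aT; have aaT := TX_mul aT aVT.
have h0 z : V z -> z != 0 by move/Vcircle/circle_neq0.
exists (tbi a ** tbi (fun x => (a x)^-1)), (fun x => b x * (a x)^-1).
have -> : tbi a ** tbi (fun x => (a x)^-1) = (tbi a ** (tbi a)^-* : S) by rewrite ti_starE.
split.
- exact: idem_r.
- rewrite ti_starE// -(tbis_iM P)// sdomain_idem.
    by rewrite -[sval x _]/(ideal_open _ x) p_ti//= mulfV ?oner_eq0//; exact: h0.
  by rewrite (tbis_iM P)// -ti_starE//; exact: idem_r.
- exact: TX_mul.
- by apply: VM => //; exact: VV.
- by rewrite (tbis_iM P)// A e ti_starE// A.
Qed.

Lemma germ_formulas_inP : germ_formulas_in D V.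
Proof.
split.
- by move=> s x sx; rewrite gtotE gtot_d gtot_r.
- move=> s t x tx sx; have stx : sdomain (s ** t) x by apply/sdomain_mul.
  by exists stx; rewrite !gtotE gtot_m.
- move=> s x sx; have sx' := sdomain_star sx.
  by exists sx'; rewrite !gtotE gtot_i.
Qed.
End GermAlgebra.

(** * The circle action on germs, and equality of germs near a point *)

Section GermScalar.
Variables (R : realType) (D : tbis R).
Local Notation G := (tbG D).
Local Notation S := (tbS D).
Local Notation X := (dual (tbG D)).
Local Notation C := (C R).
Let P := tbisP D.
Let bG : boolean_isg G := tbisG P.
Let iG : inverse_semigroup G := bisg_isg bG.
Let iS : inverse_semigroup S := tbisS P.
Let A := sgA iS.
Let h1 := @scalar_group1 R.
Let hc := @scalar_group_circle R.
Implicit Types (s t : S) (x y : X) (g h : germs D [set 1]) (z w : C).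
Local Notation gS := (gtot [set 1]).
Local Notation gG := (gtot (@circle R)).

Lemma circle_TX s x z : sdomain s x -> circle z ->
  exists c, [/\ is_TX c, c x = z & sdomain (s ** tbi c) x].
Proof.
move=> sx cz; pose c := restrict0 (isg_dom (tbp s)) (fun=> z).
have cT : is_TX c by apply: TX_cst => //; exact/ideal_open_copen/idem_d.
have cx : c x = z by rewrite /c /restrict0; case: asboolP.
by exists c; split=> //; apply/sdomain_ti => //; rewrite cx; split=> //; exact: circle_neq0.
Qed.

Lemma sc_ti s x c : sdomain s x -> is_TX c -> c x != 0 ->
  germ_sc (gS s x) (c x) = gS (s ** tbi c) x.
Proof.
move=> sx cT c0; have sx' : sdomain (s ** tbi c) x by apply/sdomain_ti.
rewrite -!gtotE /germ_sc; apply: xget_unique.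
  by exists s, x, sx, c, sx'.
move=> _ [t [y [ty [d [tdx [dT dx /(germ_eqP h1)[xy [a [b [aT bT ax bx e]]]] ->]]]]]].
subst y; apply/(germ_eqP h1); split=> //.
have cVT := TX_V cT; have ccT := TX_mul cT cVT; have dcT := TX_mul dT cVT.
(* The factor c/c cuts one side down to the support of [c], and d/c on the other has value 1 at [x],
   where [c] and [d] take the same value. *)
exists (fun y => b y * (c y * (c y)^-1)), (fun y => a y * (d y * (c y)^-1)).
split; [exact: TX_mul|exact: TX_mul| | |].
- by rewrite /= mulfV// mulr1.
- by rewrite /= dx mulfV// mulr1.
- rewrite !(tbis_iM P)// [tbi c ** tbi _]tiC// [tbi d ** tbi _]tiC//.
  have -> u : t ** tbi d ** (tbi b ** u) = t ** (tbi d ** tbi b) ** u by rewrite !A.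
  have -> u v : s ** tbi c ** (tbi a ** (u ** v)) = s ** (tbi c ** tbi a) ** u ** v by rewrite !A.
  rewrite (tiC dT bT) (tiC cT aT) !A -e -(A (s ** tbi a)) (tiC dT cVT).
  rewrite -!(A (s ** tbi a)); congr (_ ** _).
  have acT : tbi (fun u => (c u)^-1) ** tbi d ** tbi c = tbi c ** (tbi (fun u => (c u)^-1) ** tbi d) :> S.
    by rewrite -(tbis_iM P)// tiC//; exact: TX_mul.
  by rewrite acT A.
Qed.

Lemma scE s x c z : sdomain s x -> is_TX c -> c x = z -> circle z ->
  germ_sc (gS s x) z = gS (s ** tbi c) x.
Proof. by move=> sx cT <- cz; apply: sc_ti => //; exact: circle_neq0. Qed.

Lemma sc_junk g z : ~ circle z -> germ_sc g z = g.
Proof.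
move=> ncz; rewrite /germ_sc; case: xgetP => // h -> [t [y [ty [c [tcy [cT cy _ _]]]]]].
have [_ c0] := (sdomain_ti _ _ cT).1 tcy.
by case: ncz; rewrite -cy; exact: (TX_circle cT).
Qed.

Lemma gSP g : exists s x, sdomain s x /\ g = gS s x.
Proof. by have [s [? ?]] := gtotP h1 g; exists s, (germ_d g). Qed.

Lemma scP s x z : sdomain s x -> circle z ->
  exists c, [/\ is_TX c, c x = z, sdomain (s ** tbi c) x &
    germ_sc (gS s x) z = gS (s ** tbi c) x].
Proof.
move=> sx cz; have [c [cT cx sc]] := circle_TX sx cz.
exists c; split=> //; rewrite -cx sc_ti//.
by move: cz; rewrite -cx; exact: circle_neq0.
Qed.

Lemma sc_sc g z w : circle z -> circle w -> germ_sc (germ_sc g z) w = germ_sc g (z * w).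
Proof.
move=> cz cw; have [s [x [sx ->]]] := gSP g.
have [c [cT cx sc ->]] := scP sx cz; have [d [dT dx sd ->]] := scP sc cw.
rewrite -A -(tbis_iM P)//; apply/esym/scE => //.
- exact: TX_mul.
- by rewrite /= cx dx.
- exact: circleM.
Qed.

Lemma sc_1 g : germ_sc g 1 = g.
Proof.
have [s [x [sx ->]]] := gSP g; have [e [Ee ex _]] := gtot_uP h1 x.
have p1 : sval x (tbp e) by apply/sdomain_idem.
pose i := indicator R (ideal_open (tbp e)).
have ix : i x = 1 by rewrite /i /indicator mem_set.
rewrite (scE sx _ ix (circle1 R)); last exact/TX_ideal/p_idem.
by rewrite -/(tunit _) idem_tunit// gtot_mul_idem.
Qed.

Lemma sc_d g z : germ_d (germ_sc g z) = germ_d g.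
Proof.
have [cz|/sc_junk ->//] := pselect (circle z).
have [s [x [sx ->]]] := gSP g; have [c [_ _ _ ->]] := scP sx cz.
by rewrite !gtot_d.
Qed.

Lemma sc_r g z : germ_r (germ_sc g z) = germ_r g.
Proof.
have [cz|/sc_junk ->//] := pselect (circle z).
have [s [x [sx ->]]] := gSP g; have [c [cT _ sc ->]] := scP sx cz.
by rewrite !gtot_r// sphi_ti.
Qed.

Lemma m_sc g h z w : circle z -> circle w -> germ_d g = germ_r h ->
  germ_m (germ_sc g z) (germ_sc h w) = germ_sc (germ_m g h) (z * w).
Proof.
move=> cz cw; have [s [x [sx ->]]] := gSP g; have [t [y [ty ->]]] := gSP h.
rewrite (gtot_d h1) (gtot_r h1)// => xy; subst x.
have [c [cT cx sc ->]] := scP sx cz; have [d [dT dx td ->]] := scP ty cw.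
rewrite (gtot_m h1)// -(sphi_ti dT td) (gtot_m h1)//; last by rewrite sphi_ti.
have -> : s ** tbi c ** (t ** tbi d) = s ** (tbi c ** t) ** tbi d by rewrite !A.
have pT := TX_pull (tbp t) cT.
rewrite ti_mul// A -A -(tbis_iM P)//.
apply/esym/scE.
- by apply/sdomain_mul.
- exact: TX_mul.
- by rewrite /= pullE// -/(sphi t y) cx dx.
- exact: circleM.
Qed.

Lemma i_sc g z : circle z -> germ_i (germ_sc g z) = germ_sc (germ_i g) z^-1.
Proof.
move=> cz; have [s [x [sx ->]]] := gSP g.
have [c [cT cx sc ->]] := scP sx cz.
rewrite !(gtot_i h1)// (sphi_ti cT sc) starM// ti_starE//.
have cVT := TX_V cT; rewrite ti_mul//.
have sx' := sdomain_star sx.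
apply/esym/scE => //; first exact: TX_pull.
  by rewrite pullE// -/(sphi _ _) sphi_star// cx.
exact: circleV.
Qed.

Lemma sc_inj g z w : circle z -> circle w -> germ_sc g z = germ_sc g w -> z = w.
Proof.
move=> cz cw; have [s [x [sx ->]]] := gSP g.
have [c [cT cx sc ->]] := scP sx cz; have [d [dT dx sd ->]] := scP sx cw.
move=> /(gtot_eq h1 sc sd) [a [b [aT bT ax bx]]].
rewrite -!A -!(tbis_iM P)// => e.
have := ti_free (TX_mul cT aT) (TX_mul dT bT) e sx.
by rewrite ax bx cx dx !mulr1.
Qed.

Lemma germ_pE s x : sdomain s x -> germ_p (gS s x) = gG s x.
Proof.
move=> sx; rewrite -!gtotE /germ_p /germ_rep; case: cid => -[[t y] ty] /= e.
have /= : germ [set 1] sx = germ [set 1] ty by apply: eq_exist.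
rewrite (germ_eqP h1) /= => -[xy [a [b [aT bT ax bx st]]]].
apply/(germ_eqP hc); split=> //=; exists b, a; rewrite -xy.
by split=> //; rewrite ?ax ?bx; exact: circle1.
Qed.

Lemma p_sc g z : germ_p (germ_sc g z) = germ_p g.
Proof.
have [cz|/sc_junk ->//] := pselect (circle z).
have [s [x [sx ->]]] := gSP g; have [c [cT cx sc ->]] := scP sx cz.
rewrite !germ_pE//; apply/(gtot_eq hc) => //.
have cVT := TX_V cT; have ccT := TX_mul cT cVT.
exists (fun y => (c y)^-1), (fun y => c y * (c y)^-1); split=> //.
- by rewrite cx; exact: circleV.
- by rewrite cx mulfV; [exact: circle1|exact: circle_neq0].
- by rewrite (tbis_iM P)// A.
Qed.

(** Two representatives of the same class are related by a function whose value at the base point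
    has modulus one; acting by this value turns one germ into the other. *)
Lemma gS_p_eq g h : germ_p g = germ_p h -> exists2 z, circle z & h = germ_sc g z.
Proof.
have [s [x [sx ->]]] := gSP g; have [t [y [ty ->]]] := gSP h.
rewrite !germ_pE// => e.
have xy : x = y by rewrite -(gtot_d hc s x) e gtot_d.
subst y; move: e => /(gtot_eq hc sx ty) /(germ_sim_sym) st.
have [e [k [Ee ex kT kx E]]] := germ_sim_local hc ty st.
exists (k x) => //; rewrite sc_ti//; last exact: circle_neq0.
by rewrite -E gtot_mul_idem.
Qed.

(** The equality comes from one in the semigroup, so nearby germs still agree up to a scalar that
    varies continuously. Chart changes of the twist have this form. *)
Lemma gS_local s t x z : sdomain s x -> circle z ->
  sdomain t x -> gS s x = germ_sc (gS t x) z ->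
  exists k U, [/\ is_TX k, k x = z, nbhs x U & forall y, U y ->
    [/\ k y != 0, sdomain s y, sdomain t y & gS s y = germ_sc (gS t y) (k y)]].
Proof.
move=> sx cz tx; have [c [cT cx tc ->]] := scP tx cz.
move=> /(gtot_eq h1 sx tc) st.
have [e [k [Ee ex kT kx E]]] := germ_sim_local h1 sx st.
have ckT := TX_mul cT kT; exists (fun y => c y * k y), (sdomain (s ** e)).
have sex : sdomain (s ** e) x by apply/sdomain_mul; rewrite sphi_idem.
split=> //; [by rewrite /= kx mulr1|exact: isg_dom_nbhs|].
move=> y sy; have /(sdomain_ti _ _ kT) [] : sdomain (t ** tbi c ** tbi k) y by rewrite -E.
move=> /(sdomain_ti _ _ cT)[ty c0] k0.
have [ey] := (sdomain_mul _ _ _).1 sy; rewrite sphi_idem// => sy'.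
have ck0 : c y * k y != 0 by exact: mulf_neq0.
split=> //.
by rewrite (sc_ti ty ckT)// (tbis_iM P)// A -E gtot_mul_idem.
Qed.

Lemma gG_local s t x : sdomain s x -> sdomain t x -> gG s x = gG t x ->
  exists2 U, nbhs x U & forall y, U y ->
    [/\ sdomain s y, sdomain t y & gG s y = gG t y].
Proof.
move=> sx tx; rewrite -!germ_pE// => /esym/gS_p_eq [z cz /(gS_local sx cz tx)].
move=> [k [U [_ _ nU kU]]]; exists U => // y /kU [_ sy ty e].
by split=> //; rewrite -!germ_pE// e p_sc.
Qed.

End GermScalar.

(** * Topology of the groupoids of germs *)

Section GermTopology.
Variables (R : realType) (D : tbis R).
Local Notation G := (tbG D).
Local Notation S := (tbS D).
Local Notation X := (dual (tbG D)).
Local Notation C := (C R).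
Let P := tbisP D.
Let bG : boolean_isg G := tbisG P.
Let iG : inverse_semigroup G := bisg_isg bG.
Let iS : inverse_semigroup S := tbisS P.
Let h1 := @scalar_group1 R.
Let hc := @scalar_group_circle R.
Implicit Types (s t : S) (x y : X) (g h : germS D) (z w : C).
Local Notation gS := (gtot [set 1]).
Local Notation gG := (gtot (@circle R)).

Lemma char_tunit x (U : set X) : nbhs x U ->
  exists e : S, [/\ idem e, sdomain e x & sdomain e `<=` U].
Proof.
move=> /(dual_nbhs bG) [e [Ee xe eU]]; exists (tunit e).
have Ef := tunit_idem Ee; have h y : sdomain (tunit e) y <-> sval y e.
  by rewrite sdomain_idem// p_tunit.
by split=> //; [exact/h|move=> y /h; exact: eU].
Qed.

Let basicS s (W : set C) := [set g : germS D | exists x (sx : sdomain s x) z,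
  [/\ circle z, W z & g = germ_sc (germ [set 1] sx) z]].

Lemma germ_basisS_in s W x z : open W -> circle z -> W z -> sdomain s x ->
  exists B, [/\ germ_basisS B, B (germ_sc (gS s x) z : germS D) &
    forall g, B g -> exists y w,
      [/\ sdomain s y, circle w, W w & g = germ_sc (gS s y) w]].
Proof.
move=> oW cz Wz sx; exists (basicS s W); split.
- by exists s, W.
- by exists x, sx, z; rewrite gtotE.
- by move=> g [y [sy [w [cw Ww ->]]]]; exists y, w; rewrite gtotE.
Qed.

(** Change of chart: the coordinate [w] over [s] becomes k w over [t], with [k] continuous and k z
    in [W] at the point. *)
Lemma germ_basisS_chart B s x z : germ_basisS B -> sdomain s x -> circle z ->
  B (germ_sc (gS s x) z) -> exists U W, [/\ nbhs x U, nbhs z W &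
    forall y w, U y -> sdomain s y -> W w -> circle w -> B (germ_sc (gS s y) w)].
Proof.
move=> [t [W [oW ->]]] sx cz [x' [tx [w [cw Ww]]]]; rewrite gtotE => e.
have xx : x = x'.
  by rewrite -(gtot_d h1 s x) -(sc_d _ z) e sc_d gtot_d.
subst x'.
have e' : gS s x = germ_sc (gS t x) (w * z^-1).
  rewrite -sc_sc//; last exact: circleV.
  rewrite -e sc_sc//; last exact: circleV.
  by rewrite mulfV ?sc_1//; exact: circle_neq0.
have cwz : circle (w * z^-1) by apply: circleM => //; exact: circleV.
have [k [U [kT kx nU kU]]] := gS_local sx cwz tx e'.
have nW : nbhs (k x * z) W.
  rewrite kx -mulrA mulVf ?mulr1; last exact: circle_neq0.
  exact: open_nbhs_nbhs.
have [W1 [W2 [n1 n2 W12]]] := mul_nbhs nW.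
have k0 : k x != 0 by rewrite kx; exact: circle_neq0.
exists (U `&` [set y | k y != 0 /\ W1 (k y)]), W2; split=> //.
  by apply: filterI => //; exact: TX_near.
move=> y v [/kU [ky sy ty ->] [_ W1k]] _ W2v cv.
have cky : circle (k y) by exact: (TX_circle kT).
exists y, ty, (k y * v); rewrite gtotE sc_sc//; split=> //; first exact: circleM.
exact: W12.
Qed.

(** The basic sets of the twist run over a whole domain; a smaller open set of base points is
    reached by multiplying [s] by an idempotent. *)
Lemma germ_chart_basisS s x z (U : set X) (W : set C) :
  sdomain s x -> circle z -> nbhs x U -> nbhs z W ->
  exists B, [/\ germ_basisS B, B (germ_sc (gS s x) z : germS D) &
    forall g, B g -> exists y w, [/\ U y, sdomain s y, W w, circle w &
      g = germ_sc (gS s y) w]].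
Proof.
move=> sx cz /char_tunit [e [Ee ex eU]]; rewrite nbhsE => -[W' [oW' W'z] WW].
have sex : sdomain (s ** e) x by apply/sdomain_mul; rewrite sphi_idem.
have [B [BB Bz BE]] := germ_basisS_in oW' cz W'z sex.
exists B; split=> //; first by move: Bz; rewrite gtot_mul_idem.
move=> g /BE [y [w [sey cw Ww ->]]]; exists y, w.
have [ey] := (sdomain_mul _ _ _).1 sey; rewrite sphi_idem// => sy.
by rewrite gtot_mul_idem//; split=> //; [exact: eU|exact: WW].
Qed.

Lemma gS_scP g : exists s x z, [/\ sdomain s x, circle z & g = germ_sc (gS s x) z].
Proof.
by have [s [x [sx ->]]] := gSP g; exists s, x, 1; rewrite sc_1; split=> //; exact: circle1.
Qed.

Lemma germ_basisS_basis : basis (@germ_basisS _ D : set (set (germS D))).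
Proof.
apply: subbase_basis => [//|g|B B' g BB BB'].
  have [s [x [z [sx cz ->]]]] := gS_scP g.
  have [B [BB Bz _]] := germ_basisS_in openT cz I sx.
  by exists B.
have [s [x [z [sx cz ->]]]] := gS_scP g => Bg B'g.
have [U [W [nU nW UW]]] := germ_basisS_chart BB sx cz Bg.
have [U' [W' [nU' nW' UW']]] := germ_basisS_chart BB' sx cz B'g.
have [B0 [BB0 B0g B0E]] := germ_chart_basisS sx cz (filterI nU nU') (filterI nW nW').
exists B0; split=> // _ /B0E [y [w [[Uy Uy'] sy [Ww Ww'] cw ->]]].
by split; [exact: UW|exact: UW'].
Qed.

(** The chart (y, w) |-> [s, y] w is open and continuous, so the topological statements on the twist
    become statements about [X] and the circle. *)
Lemma germS_nbhs s x z (A : set (germS D)) : sdomain s x -> circle z ->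
  nbhs (germ_sc (gS s x) z : germS D) A <-> exists U W, [/\ nbhs x U, nbhs z W &
    forall y w, U y -> sdomain s y -> W w -> circle w -> A (germ_sc (gS s y) w)].
Proof.
move=> sx cz; rewrite (basis_nbhs _ _ germ_basisS_basis); split.
  move=> [B [BB Bg BA]]; have [U [W [nU nW UW]]] := germ_basisS_chart BB sx cz Bg.
  by exists U, W; split=> // y w *; apply: BA; exact: UW.
move=> [U [W [nU nW UW]]].
have [B [BB Bg BE]] := germ_chart_basisS sx cz nU nW.
by exists B; split=> // _ /BE [y [w [Uy sy Ww cw ->]]]; exact: UW.
Qed.

Lemma germ_basisG_chart B s x : germ_basisG B -> sdomain s x -> B (gG s x) ->
  exists2 U, nbhs x U & forall y, U y -> sdomain s y -> B (gG s y).
Proof.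
move=> [t [W [oW ->]]] sx [x' [tx [Wx]]]; rewrite gtotE => e.
have xx : x = x' by rewrite -(gtot_d hc s x) e gtot_d.
subst x'; have [U nU UE] := gG_local sx tx e.
exists (U `&` W); first by apply: filterI => //; exact: open_nbhs_nbhs.
by move=> y [/UE [_ ty ->] Wy] _; exists y, ty; rewrite gtotE.
Qed.

Lemma germ_chart_basisG s x (U : set X) : sdomain s x -> nbhs x U ->
  exists B, [/\ germ_basisG B, B (gG s x : germG D) &
    forall g' : germG D, B g' -> exists y, [/\ U y, sdomain s y & g' = gG s y]].
Proof.
move=> sx; rewrite nbhsE => -[W [oW Wx] WU].
exists [set g | exists y (sy : sdomain s y), W y /\ g = germ (@circle R) sy]; split.
- by exists s, W.
- by exists x, sx; rewrite gtotE.
- by move=> g [y [sy [Wy ->]]]; exists y; rewrite gtotE; split=> //; exact: WU.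
Qed.

Lemma gGP (g : germG D) : exists s x, sdomain s x /\ g = gG s x.
Proof. by have [s [? ?]] := gtotP hc g; exists s, (germ_d g). Qed.

Lemma germ_basisG_basis : basis (@germ_basisG _ D : set (set (germG D))).
Proof.
apply: subbase_basis => [//|g|B B' g BB BB'].
  have [s [x [sx ->]]] := gGP g.
  have [B [BB Bz _]] := germ_chart_basisG sx (@filterT _ (nbhs x) _).
  by exists B.
have [s [x [sx ->]]] := gGP g => Bg B'g.
have [U nU UW] := germ_basisG_chart BB sx Bg.
have [U' nU' UW'] := germ_basisG_chart BB' sx B'g.
have [B0 [BB0 B0g B0E]] := germ_chart_basisG sx (filterI nU nU').
exists B0; split=> // _ /B0E [y [[Uy Uy'] sy ->]].
by split; [exact: UW|exact: UW'].
Qed.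

Lemma germG_nbhs s x (A : set (germG D)) : sdomain s x ->
  nbhs (gG s x : germG D) A <-> exists2 U, nbhs x U &
    forall y, U y -> sdomain s y -> A (gG s y).
Proof.
move=> sx; rewrite (basis_nbhs _ _ germ_basisG_basis); split.
  move=> [B [BB Bg BA]]; have [U nU UW] := germ_basisG_chart BB sx Bg.
  by exists U => // y *; apply: BA; exact: UW.
move=> [U nU UW]; have [B [BB Bg BE]] := germ_chart_basisG sx nU.
by exists B; split=> // _ /BE [y [Uy sy ->]]; exact: UW.
Qed.

Lemma germ_p_nbhs g (A : set (germG D)) :
  nbhs (germ_p g : germG D) A <-> nbhs g (@germ_p _ D @^-1` A).
Proof.
have [s [x [z [sx cz ->]]]] := gS_scP g; rewrite p_sc germ_pE//.
rewrite germG_nbhs// germS_nbhs//; split.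
  move=> [U nU UA]; exists U, setT; split=> //; first exact: filterT.
  by move=> y w Uy sy _ _; rewrite /= p_sc germ_pE//; exact: UA.
move=> [U [W [nU nW UA]]]; exists U => // y Uy sy.
by have := UA y z Uy sy (nbhs_singleton nW) cz; rewrite /= p_sc germ_pE.
Qed.

Lemma germ_p_surj (g : germG D) : exists g', germ_p g' = g.
Proof. by have [s [x [sx ->]]] := gGP g; exists (gS s x); rewrite germ_pE. Qed.

Lemma germ_p_continuous : continuous (@germ_p _ D : germS D -> germG D).
Proof. by move=> g A /germ_p_nbhs. Qed.

Lemma germ_p_near g (A : set (germS D)) : nbhs g A -> nbhs (germ_p g : germG D) (@germ_p _ D @` A).
Proof. by move=> nA; apply/germ_p_nbhs; apply: filterS nA => h Ah; exists h. Qed.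

Lemma germ_p_open (A : set (germS D)) : open A -> open ((@germ_p _ D : germS D -> germG D) @` A).
Proof.
by move=> oA; apply: open_near => _ [g Ag <-]; apply: germ_p_near; exact: open_nbhs_nbhs.
Qed.

Lemma gG_continuous s x : sdomain s x -> {for x, continuous (gG s : X -> germG D)}.
Proof.
move=> sx A /(germG_nbhs _ sx) [U nU UA]; rewrite nbhs_simpl /=.
by apply: filterS2 nU (isg_dom_nbhs bG sx) => y; exact: UA.
Qed.

Lemma germS_d_continuous : continuous (@germ_d _ D [set 1] : germS D -> X).
Proof.
move=> g A; have [s [x [z [sx cz ->]]]] := gS_scP g; rewrite sc_d gtot_d// => nA.
rewrite nbhs_simpl /=; apply/germS_nbhs => //; exists A, setT; split=> //; first exact: filterT.
by move=> y w Ay sy _ _; rewrite /= sc_d gtot_d.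
Qed.

Lemma germS_r_continuous : continuous (@germ_r _ D [set 1] : germS D -> X).
Proof.
move=> g A; have [s [x [z [sx cz ->]]]] := gS_scP g; rewrite sc_r gtot_r// => nA.
rewrite nbhs_simpl /=; apply/germS_nbhs => //.
exists (sphi s @^-1` A), setT; split; [|exact: filterT|].
  exact: (continuous_near (phi_continuous bG sx) nA).
by move=> y w Ay sy _ _; rewrite /= sc_r gtot_r.
Qed.

Lemma germS_u_continuous : continuous (germ_u [set 1] : X -> germS D).
Proof.
move=> x A; have [e [Ee ex ->]] := gtot_uP h1 x; rewrite -(sc_1 (gS e x)).
move=> /(germS_nbhs _ ex (circle1 R)) [U [W [nU nW UA]]]; rewrite nbhs_simpl /=.
apply: filterS2 nU (isg_dom_nbhs bG ex) => y Uy ey.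
rewrite /= -(gtot_u h1 Ee ey) -(sc_1 (gS e y)); apply: UA => //; last exact: circle1.
exact: nbhs_singleton.
Qed.

Lemma germS_i_continuous : continuous (@germ_i _ D [set 1] : germS D -> germS D).
Proof.
move=> g A; have [s [x [z [sx cz ->]]]] := gS_scP g.
rewrite i_sc// gtot_i// => /(germS_nbhs _ (sdomain_star sx) (circleV cz)).
move=> [U [W [nU nW UA]]]; rewrite nbhs_simpl /=; apply/germS_nbhs => //.
exists (sphi s @^-1` U), [set w | W w^-1]; split.
- exact: (continuous_near (phi_continuous bG sx) nU).
- by apply: inv_nbhs => //; exact: circle_neq0.
- move=> y w Uy sy Ww cw; rewrite /= i_sc// gtot_i//.
  by apply: UA => //; [exact: sdomain_star|exact: circleV].
Qed.

Lemma germS_m_continuous : {within [set u : germS D * germS D | germ_d u.1 = germ_r u.2],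
  continuous (fun u => germ_m u.1 u.2 : germS D)}.
Proof.
apply/within_contP => -[g h] /=.
have [s [x [z [sx cz ->]]]] := gS_scP g; have [t [y [w [ty cw ->]]]] := gS_scP h.
rewrite sc_d sc_r gtot_d// gtot_r// => xy; subst x => A.
have sty : sdomain (s ** t) y by apply/sdomain_mul.
rewrite m_sc//; last by rewrite gtot_d// gtot_r.
rewrite gtot_m// => /(germS_nbhs _ sty (circleM cz cw)) [U [W [nU nW UA]]].
have [W1 [W2 [n1 n2 W12]]] := mul_nbhs nW.
(* The base point of the left factor is left free: composability makes it the range of the right
   factor, so only the base point on the right and the two scalars are restricted. *)
exists ([set germ_sc (gS s x') z' | x' in sdomain s & z' in (W1 `&` @circle R)],
        [set germ_sc (gS t y') w' | y' in (U `&` sdomain t) & w' in (W2 `&` @circle R)]).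
  split; apply/germS_nbhs => //.
    exists setT, W1; split=> //; first exact: filterT.
    by move=> x' z' _ sx' W1z cz'; exists x' => //; exists z'.
  exists U, W2; split=> //.
  by move=> y' w' Uy' ty' W2w cw'; exists y' => //; exists w'.
move=> [_ _] [/= [x' sx' [z' [W1z cz'] <-]] [y' [Uy' ty'] [w' [W2w cw'] <-]]].
rewrite sc_d sc_r gtot_d// gtot_r// => xy; subst x'.
rewrite m_sc//; last by rewrite gtot_d// gtot_r.
rewrite gtot_m//; apply: UA => //.
- by apply/sdomain_mul.
- exact: W12.
- exact: circleM.
Qed.

Lemma germ_p_d g : germ_d (germ_p g) = germ_d g.
Proof. by have [s [x [sx ->]]] := gSP g; rewrite germ_pE// !gtot_d. Qed.

Lemma germ_p_r g : germ_r (germ_p g) = germ_r g.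
Proof. by have [s [x [sx ->]]] := gSP g; rewrite germ_pE// !gtot_r. Qed.

Lemma germ_p_m g h : germ_d g = germ_r h ->
  germ_p (germ_m g h) = germ_m (germ_p g) (germ_p h).
Proof.
have [s [x [sx ->]]] := gSP g; have [t [y [ty ->]]] := gSP h.
rewrite (gtot_d h1) (gtot_r h1)// => xy; subst x.
rewrite (gtot_m h1)// !germ_pE// ?(gtot_m hc)//.
by apply/sdomain_mul.
Qed.

Lemma germ_p_i g : germ_p (germ_i g) = germ_i (germ_p g).
Proof.
have [s [x [sx ->]]] := gSP g; have sx' := sdomain_star sx.
by rewrite (gtot_i h1)// !germ_pE// (gtot_i hc).
Qed.

Lemma germ_p_u x : germ_p (germ_u [set 1] x : germS D) = germ_u (@circle R) x.
Proof.
have [e [Ee ex ->]] := gtot_uP h1 x; rewrite germ_pE//.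
exact: gtot_u.
Qed.

(** An open continuous surjection is a quotient map, so the topological laws of the untwisted
    groupoid descend from the twisted one. *)
Lemma germ_p_quotient (Y : topologicalType) (F : germG D -> Y) :
  continuous (fun g : germS D => F (germ_p g)) -> continuous F.
Proof.
move=> cF g A; have [g' <-] := germ_p_surj g => nA.
by rewrite nbhs_simpl /=; apply/germ_p_nbhs; exact: cF.
Qed.

Lemma germG_topological : topological_groupoid (germ_gpdG D).
Proof.
have [lu lm la l1 li] := germ_gpd_laws D hc.
split=> /=.
- by move=> x; have [] := lu x.
- by move=> x; have [] := lu x.
- by move=> g h /lm [].
- by move=> g h /lm [].
- by move=> g h k gh hk; exact: la.
- by move=> g; have [] := l1 g.
- by move=> g; have [] := l1 g.
- by move=> g; have [] := li g.
- by move=> g; have [] := li g.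
- by move=> g; have [] := li g.
- by move=> g; have [] := li g.
- apply: germ_p_quotient; rewrite (_ : (fun _ => _) = (@germ_d _ D [set 1] : germS D -> X)).
    exact: germS_d_continuous.
  by apply/funext => g; exact: germ_p_d.
- apply: germ_p_quotient; rewrite (_ : (fun _ => _) = (@germ_r _ D [set 1] : germS D -> X)).
    exact: germS_r_continuous.
  by apply/funext => g; exact: germ_p_r.
- rewrite (_ : germ_u _ = fun x : X => germ_p (germ_u [set 1] x : germS D) : germG D).
    move=> x; apply: (@continuous_comp _ _ _ (germ_u [set 1] : X -> germS D) (@germ_p _ D : germS D -> germG D)).
      exact: germS_u_continuous.
    exact: germ_p_continuous.
  by apply/funext => x; rewrite germ_p_u.
- apply: germ_p_quotient.
  rewrite (_ : (fun _ => _) = fun g : germS D => germ_p (germ_i g : germS D) : germG D).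
    move=> g; apply: (@continuous_comp _ _ _ (@germ_i _ D [set 1] : germS D -> germS D) (@germ_p _ D : germS D -> germG D)).
      exact: germS_i_continuous.
    exact: germ_p_continuous.
  by apply/funext => g; rewrite germ_p_i.
- apply/within_contP => -[g h] /=.
  have [g' <-] := germ_p_surj g; have [h' <-] := germ_p_surj h.
  rewrite germ_p_d germ_p_r => gh A; rewrite -germ_p_m// => /germ_p_nbhs nA.
  have /within_contP := germS_m_continuous => /(_ (g', h') gh _ nA) [[U V] [/= nU nV] UV].
  exists (@germ_p _ D @` U, @germ_p _ D @` V).
    by split; exact: germ_p_near.
  move=> [_ _] /= [[u Uu <-] [v Vv <-]]; rewrite germ_p_d germ_p_r => uv.
  by have := UV (u, v) (conj Uu Vv) uv; rewrite /= germ_p_m.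
Qed.

Lemma germS_topological : topological_groupoid (germ_gpdS D).
Proof.
have [lu lm la l1 li] := germ_gpd_laws D h1.
split=> /=.
- by move=> x; have [] := lu x.
- by move=> x; have [] := lu x.
- by move=> g h /lm [].
- by move=> g h /lm [].
- by move=> g h k gh hk; exact: la.
- by move=> g; have [] := l1 g.
- by move=> g; have [] := l1 g.
- by move=> g; have [] := li g.
- by move=> g; have [] := li g.
- by move=> g; have [] := li g.
- by move=> g; have [] := li g.
- exact: germS_d_continuous.
- exact: germS_r_continuous.
- exact: germS_u_continuous.
- exact: germS_i_continuous.
- exact: germS_m_continuous.
Qed.

Let piece s : set (germG D) := gG s @` sdomain s.

Lemma piece_open s : open (piece s).
Proof.
apply: open_near => _ [x sx <-]; apply/germG_nbhs => //.
by exists setT; [exact: filterT|move=> y _ sy; exists y].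
Qed.

Lemma sdomain_copen s : copen (sdomain s).
Proof. exact/ideal_open_copen/idem_d. Qed.

Lemma germG_local_homeo_d : local_homeo (@germ_d _ D (@circle R) : germ_gpdG D -> X).
Proof.
move=> g; have [s [x [sx ->]]] := gGP g; exists (piece s).
have im : @germ_d _ D (@circle R) @` piece s = sdomain s.
  apply/seteqP; split=> [_ [_ [y sy <-] <-]|y sy]; first by rewrite gtot_d.
  by exists (gG s y); [exists y|rewrite gtot_d].
split; [exact: piece_open|by exists x|split]; last by rewrite im; exact: isg_dom_open.
split; first by apply: continuous_subspaceT; exact: (gd_cont germG_topological).
exists (gG s); first by move=> _ [y sy <-]; rewrite gtot_d.
by rewrite im; apply: within_cont_open => y sy; exact: gG_continuous.
Qed.

Lemma germG_local_homeo_r : local_homeo (@germ_r _ D (@circle R) : germ_gpdG D -> X).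
Proof.
move=> g; have [s [x [sx ->]]] := gGP g; exists (piece s).
have im : @germ_r _ D (@circle R) @` piece s = sdomain s^-*.
  apply/seteqP; split=> [_ [_ [y sy <-] <-]|y sy].
    by rewrite gtot_r//; exact: sdomain_star.
  have := sdomain_star sy; rewrite starK// => sy'.
  exists (gG s (sphi s^-* y)); first by exists (sphi s^-* y).
  by rewrite gtot_r//; have := sphi_star sy; rewrite starK.
split; [exact: piece_open|by exists x|split]; last by rewrite im; exact: isg_dom_open.
split; first by apply: continuous_subspaceT; exact: (gr_cont germG_topological).
exists (fun y => gG s (sphi s^-* y)).
  by move=> _ [y sy <-]; rewrite gtot_r// sphi_star.
rewrite im; apply: within_cont_open => y sy.
have := sdomain_star sy; rewrite starK// => sy'.
apply: (@continuous_comp _ _ _ (sphi s^-*) (gG s : X -> germG D)).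
  exact: phi_continuous.
exact: gG_continuous.
Qed.

Lemma germG_boolean : boolean_groupoid (germ_gpdG D).
Proof.
split.
- exact: germG_topological.
- move=> g A; have [s [x [sx ->]]] := gGP g => /(germG_nbhs _ sx) [U nU UA].
  have [e [Ee ex eU]] := char_tunit (filterI nU (isg_dom_nbhs bG sx)).
  exists (gG s @` sdomain e); split.
  + apply/germG_nbhs => //; exists (sdomain e); first exact: isg_dom_nbhs.
    by move=> y ey _; exists y.
  + apply: within_compact_image; first by case: (sdomain_copen e).
    by apply: within_cont_open => y /eU [_ sy]; exact: gG_continuous.
  + by move=> _ [y /eU [Uy sy] <-]; exact: UA.
- exact: germG_local_homeo_d.
- exact: germG_local_homeo_r.
- exact: dual_boolean.
Qed.

Lemma circle_closed : closed (@circle R : set C).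
Proof.
rewrite (_ : @circle R = (fun z : C => `|z|) @^-1` [set 1]) //.
apply: preimage_closed => [z _|]; first exact: norm_continuous.
exact: (@accessible_closed_set1 C (hausdorff_accessible (@C_hausdorff R)) 1).
Qed.

Lemma germS_compact_nbhs : has_compact_nbhs (germ_gpdS D).
Proof.
move=> g A; have [s [x [z [sx cz ->]]]] := gS_scP g.
move=> /(germS_nbhs _ sx cz) [U [W [nU nW UA]]].
have [e [Ee ex eU]] := char_tunit (filterI nU (isg_dom_nbhs bG sx)).
have [K [nK cK KW]] := C_compact_nbhs nW.
pose K' := K `&` @circle R.
exists ((fun u : X * C => germ_sc (gS s u.1) u.2 : germS D) @` (sdomain e `*` K')); split.
- apply/germS_nbhs => //; exists (sdomain e), K; split=> //; first exact: isg_dom_nbhs.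
  by move=> y w ey _ Kw cw; exists (y, w).
- apply: within_compact_image.
    apply: compact_setX; first by case: (sdomain_copen e).
    exact: compact_closedI cK circle_closed.
  apply/within_contP => -[y w] [/= /eU [_ sy] [_ cw]] B nB.
  have [V [W' [nV nW' VB]]] := (germS_nbhs B sy cw).1 nB.
  exists (V, W') => // -[y' w'] /= [Vy Ww'] [/eU [_ sy'] [_ cw']].
  exact: VB.
- by move=> _ [[y w] [/= /eU [Uy sy] [Kw cw]] <-]; apply: UA => //; exact: KW.
Qed.

Lemma germ_tgi_nbhs x z (A : set (germS D)) : circle z ->
  nbhs (germ_sc (germ_u [set 1] x) z : germS D) A <-> exists U W, [/\ nbhs x U, nbhs z W &
    forall y w, U y -> W w -> circle w -> A (germ_sc (germ_u [set 1] y) w)].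
Proof.
move=> cz; have [e [Ee ex ->]] := gtot_uP h1 x; rewrite germS_nbhs//.
split=> -[U [W [nU nW UA]]].
  exists (U `&` sdomain e), W; split=> //; first by apply: filterI => //; exact: isg_dom_nbhs.
  by move=> y w [Uy ey] Ww cw; rewrite -(gtot_u h1 Ee ey); exact: UA.
by exists U, W; split=> // y w Uy ey Ww cw; rewrite gtot_u//; exact: UA.
Qed.

Lemma germ_is_tgpd : is_tgpd (germ_tgpd D).
Proof.
have [lu lm la l1 li] := germ_gpd_laws D h1.
split=> /=.
- exact: germG_boolean.
- exact: germS_topological.
- exact: germS_compact_nbhs.
- exact: germ_p_d.
- exact: germ_p_r.
- exact: germ_p_m.
- exact: germ_p_surj.
- exact: germ_p_continuous.
- exact: germ_p_open.
- by move=> x z _; rewrite sc_d; have [] := lu x.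
- by move=> x z _; rewrite sc_r; have [] := lu x.
- move=> x z w cz cw; have [dx rx] := lu x.
  rewrite m_sc ?dx ?rx//; congr germ_sc.
  by have [] := l1 (germ_u [set 1] x); rewrite rx.
- by move=> x; rewrite sc_1.
- split.
    apply/within_contP => -[x z] /= cz A /(germ_tgi_nbhs _ _ cz) [U [W [nU nW UA]]].
    by exists (U, W) => // -[y w] /= [Uy Ww] cw; exact: UA.
  (* The fibre coordinate over a unit; 1 is the default off the image of X x T. *)
  pose zz (g : germS D) := xget 1 [set z : C | circle z /\ g = germ_sc (germ_u [set 1] (germ_d g)) z].
  have zzE x z : circle z -> zz (germ_sc (germ_u [set 1] x) z) = z.
    move=> cz; have [dx _] := lu x; apply: xget_unique; first by rewrite /= sc_d dx.
    by move=> w /= [cw]; rewrite sc_d dx => /(sc_inj cz cw).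
  exists (fun g => (germ_d g, zz g)) => [[x z] /= cz|].
    by rewrite zzE// sc_d; have [-> _] := lu x.
  apply/within_contP => _ [[x z] /= cz <-] A; rewrite zzE// sc_d.
  have [-> _] := lu x => -[[U W] /= [nU nW] UW].
  apply/germ_tgi_nbhs => //; exists U, W; split=> // y w Uy Ww cw _.
  by rewrite zzE// sc_d; have [-> _] := lu y; apply: (UW (y, w)).
(* Locally closed because open: the charts at idempotents cover this set. *)
- exists ((fun u : X * C => germ_sc (germ_u [set 1] u.1) u.2 : germS D) @` @XT R X), setT.
  split; [|exact: closedT|by rewrite setIT].
  apply: open_near => _ [[x z] /= cz <-]; apply/germ_tgi_nbhs => //.
  exists setT, setT; split; [exact: filterT|exact: filterT|].
  by move=> y w _ _ cw; exists (y, w).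
- move=> g; rewrite -germ_p_u; split.
    by move=> /esym/gS_p_eq.
  by move=> [z cz e]; rewrite {1}e p_sc.
- move=> g z cz; have [_ rx] := lu (germ_r g); have [dx rd] := lu (germ_d g).
  have [u1 u2] := l1 g.
  have [dr _] := lu (germ_r g).
  rewrite -{2}(sc_1 g) -{3}(sc_1 g) m_sc ?dr//; last exact: circle1.
  by rewrite m_sc ?rd ?mul1r ?mulr1 ?u1 ?u2//; exact: circle1.
Qed.

Lemma germ_formulasP : germ_formulas D.
Proof.
split.
- split; [|exact: germ_formulas_inP|exact: germ_formulas_inP].
  by move=> s x; exact: phi_formulaP.
- by move=> s x sx; rewrite !gtotE germ_pE.
- move=> s x sx c cT cx; have sx' : sdomain (s ** tbi c) x.
    by apply/sdomain_ti => //; split=> //; exact: circle_neq0.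
  by exists sx'; rewrite !gtotE (scE sx cT).
- exact: germ_basisG_basis.
- exact: germ_basisS_basis.
Qed.

End GermTopology.

Lemma tgpd_arrow_ext (R : realType) (a b : tgpd R) (f g : tgpd_arrow a b) :
  (forall x, anchor0 f x = anchor0 g x) ->
  (forall l x, gd l = anchor0 f x -> tact f l (gu x) = tact g l (gu x)) -> f = g.
Proof.
move=> fg0 fg1; have Sb := tgpdS (tgpdP b); have F := tgaP f; have H := tgaP g.
have fg s : tanc f s = tanc g s.
  by rewrite tgpd_anchorE [RHS]tgpd_anchorE; exact: fg0.
apply: tgpd_arrow_eq; first by apply/funext.
move=> l s; have [ls|ls] := pselect (gd l = tanc f s); last first.
  by rewrite (tga_junk F)// (tga_junk H)// -fg.
have ls' : gd l = anchor0 f (gr s) by rewrite ls tgpd_anchorE.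
have ls'' : gd l = anchor0 g (gr s) by rewrite -fg0.
rewrite -{1 2}(gm1g Sb s) (tga_mult F) ?(gd_u Sb)// (tga_mult H) ?(gd_u Sb)//.
by rewrite fg1.
Qed.

(** * Functoriality of germs *)

Section Morphism.
Variables (H G : sg_data) (j : H -> G).
Hypothesis (iH : inverse_semigroup H) (iG : inverse_semigroup G).
Hypothesis jM : forall s t : H, j (s ** t) = j s ** j t.

Lemma morphism_star s : j s^-* = (j s)^-*.
Proof.
by apply: (sg_star_uniq iG); rewrite -!jM ?(sg_starK iH) ?(sg_starV iH).
Qed.

Lemma morphism_idem e : idem e -> idem (j e).
Proof. by rewrite /idem /= -jM => ->. Qed.
End Morphism.

Section DualMap.
Variables (H G : sg_data) (j : H -> G) (rho : dual G -> dual H).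
Hypothesis (bH : boolean_isg H) (bG : boolean_isg G).
Hypothesis (bj : boolean_morphism j) (rhoE : is_dual_map j rho).
Let iH := bisg_isg bH.
Let iG := bisg_isg bG.
Let jS := morphism_star iH iG (bmorM bj).

Lemma dual_map_ideal e : idem e -> rho @^-1` ideal_open e = ideal_open (j e).
Proof. by move=> Ee; apply/seteqP; split=> x /=; rewrite /ideal_open /= rhoE. Qed.

Lemma dual_map_continuous : continuous rho.
Proof.
move=> x W /(dual_nbhs bH) [e [Ee xe eW]]; rewrite nbhs_simpl /=.
apply/(dual_nbhs bG); exists (j e).
split; [exact: boolean_morphism_idem bj Ee|exact/rhoE|].
by rewrite -dual_map_ideal// => y /eW.
Qed.

Lemma dual_map_dom s x : isg_dom (j s) x <-> isg_dom s (rho x).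
Proof.
rewrite /isg_dom -jS -(bmorM bj) /ideal_open /= rhoE//; exact: idem_d.
Qed.

Lemma dual_map_phi s x : isg_dom s (rho x) -> rho (phi (j s) x) = phi s (rho x).
Proof.
move=> sx; have jsx : isg_dom (j s) x by apply/dual_map_dom.
apply: dual_eq => e Ee; rewrite rhoE// phiP//; last exact: boolean_morphism_idem bj Ee.
by rewrite phiP// -jS -!(bmorM bj) rhoE//; exact: idemJV.
Qed.

(** A compact set lies in the basic set of one idempotent [e]; its preimage is closed in the basic
    set of [j e], which is compact. *)
Lemma dual_map_proper K : compact K -> compact (rho @^-1` K).
Proof.
move=> cK; pose Q (U : set (dual H)) := exists2 e, idem e & U = ideal_open e.
have [U [e Ee ->] KU] : exists2 U, Q U & K `<=` U.
  apply: compact_ideal cK.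
  - by exists sg_zero; [exact: idem0|rewrite ideal_open0].
  - move=> _ _ [e Ee ->] [f Ef ->].
    have [g jn] := bool_join (bisg_bool bH) Ee Ef; exists g; first by case: jn.
    by rewrite (ideal_openU Ee Ef jn).
  - move=> x _; have [e xe] := char_neq0 (svalP x).
    by exists (ideal_open e); [exact: char_nbhs|exists e => //; exact: char_idem xe].
apply: (@subclosed_compact _ _ (ideal_open (j e))).
- apply: preimage_closed => [x _|]; first exact: dual_map_continuous.
  exact: compact_closed (dual_hausdorff bH) cK.
- exact/(ideal_open_compact bG)/(morphism_idem (bmorM bj)).
- by rewrite -dual_map_ideal// => x /KU.
Qed.

Lemma dual_map_uniq rho' : is_dual_map j rho' -> rho' = rho.
Proof.
move=> r; apply/funext => x; apply: dual_eq => e Ee.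
by rewrite r// rhoE.
Qed.
End DualMap.

Lemma tsc_germ (R : realType) (D : tbis R) z (g : germS D) : circle z ->
  tsc (D := germ_tgpd D) z g = germ_sc g z.
Proof.
move=> cz; have [lu _ _ l1 _] := germ_gpd_laws D (@scalar_group1 R).
have [dx _] := lu (germ_r g).
rewrite /tsc /= -{2}(sc_1 g) m_sc ?dx// ?mulr1; last exact: circle1.
by have [-> _] := l1 g.
Qed.

Section GermArrow.
Variables (R : realType) (D D' : tbis R) (f : tbis_arrow D D').
Let P := tbisP D.
Let P' := tbisP D'.
Let bG := tbisG P.
Let bG' := tbisG P'.
Let iS := tbisS P.
Let iS' := tbisS P'.
Let F := tbaP f.
Let h1 := @scalar_group1 R.
Let rho := dual_map f.
Implicit Types (s : tbS D) (t : tbS D') (x : dual (tbG D')).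
Local Notation gS := (gtot [set 1]).

Lemma dual_mapP : is_dual_map (tbj f) rho.
Proof. by rewrite /rho /dual_map; case: cid2. Qed.

Lemma dual_map_ker h : is_TX h -> is_TX (h \o rho) /\ tbj1 f (tbi h) = tbi (h \o rho).
Proof. by rewrite /rho /dual_map; case: cid2 => /= r _; apply. Qed.

Let rhoP := dual_mapP.
Let bj := tba_j F.
Let j1M := bmorM (tba_j1 F).

Lemma j1_domain s x : sdomain (tbj1 f s) x <-> sdomain s (rho x).
Proof. by rewrite /sdomain (tba_p F) (dual_map_dom bG bG' bj rhoP). Qed.

Lemma j1_sphi s x : sdomain s (rho x) -> rho (sphi (tbj1 f s) x) = sphi s (rho x).
Proof. by rewrite /sphi (tba_p F); exact: (dual_map_phi bG bG' bj rhoP). Qed.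

Lemma j1_sim s s' x : germ_sim [set 1] s s' (rho x) ->
  germ_sim [set 1] (tbj1 f s) (tbj1 f s') x.
Proof.
move=> [a [b [aT bT ax bx e]]]; exists (a \o rho), (b \o rho).
have [aT' ea] := dual_map_ker aT; have [bT' eb] := dual_map_ker bT.
by split=> //; rewrite -ea -eb -!j1M e.
Qed.

Lemma tact_gtot s t x : sdomain t x -> sdomain s (rho (sphi t x)) ->
  germ_tact f (gS s (rho (sphi t x))) (gS t x) = gS (tbj1 f s ** t) x.
Proof.
move=> tx sx; have stx : sdomain (tbj1 f s ** t) x.
  by apply/sdomain_mul; split=> //; apply/j1_domain.
rewrite -!gtotE /germ_tact; apply: xget_unique.
  by exists s, t, x, tx, sx, stx.
move=> _ [s' [t' [x' [tx' [sx' [stx' [/(germ_eqP h1)[xE e1] /(germ_eqP h1)[xx e2] ->]]]]]]].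
subst x'; apply/(germ_eqP h1); split=> //.
apply: germ_sim_sym; apply: germ_simM => //; exact: j1_sim.
Qed.

Lemma germ_act_rep (l : germS D) (g : germS D') : germ_d l = rho (germ_r g) ->
  exists s t x, [/\ sdomain t x, sdomain s (rho (sphi t x)),
    l = gS s (rho (sphi t x)) & g = gS t x].
Proof.
have [s [y [sy ->]]] := gSP l; have [t [x [tx ->]]] := gSP g.
by rewrite (gtot_d h1) (gtot_r h1)// => xy; subst y; exists s, t, x.
Qed.

(** Equivariance comes from the condition on the kernels: [tbj1 f] sends [c] to c o rho, so the
    scalar c takes at the moment of the germ is recovered after pulling back along [t]. *)
Lemma tact_sc (l : germS D) (g : germS D') z w : circle z -> circle w ->
  germ_d l = rho (germ_r g) ->
  germ_tact f (germ_sc l z) (germ_sc g w) = germ_sc (germ_tact f l g) (z * w).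
Proof.
move=> cz cw /germ_act_rep [s [t [x [tx sx -> ->]]]].
have [c [cT cx sc ->]] := scP sx cz; have [d [dT dx td ->]] := scP tx cw.
rewrite tact_gtot// -(sphi_ti dT td) tact_gtot//; last by rewrite (sphi_ti dT td).
have [cT' ec] := dual_map_ker cT.
rewrite j1M ec.
have -> : tbj1 f s ** tbi (c \o rho) ** (t ** tbi d) =
  tbj1 f s ** (tbi (c \o rho) ** t) ** tbi d by rewrite !(sgA iS').
have pT := TX_pull (tbp t) cT'.
rewrite ti_mul// -!(sgA iS') -(tbis_iM P')// (sgA iS').
apply/esym/scE.
- by apply/sdomain_mul; split=> //; apply/j1_domain.
- exact: TX_mul.
- by rewrite /= pullE //= -/(sphi t x) cx dx.
- exact: circleM.
Qed.

Lemma germ_tact_d l g : germ_d l = rho (germ_r g) -> germ_d (germ_tact f l g) = germ_d g.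
Proof.
by move=> /germ_act_rep [s [t [x [tx sx -> ->]]]]; rewrite tact_gtot// !gtot_d.
Qed.

Lemma germ_tact_r l g : germ_d l = rho (germ_r g) ->
  rho (germ_r (germ_tact f l g)) = germ_r l.
Proof.
move=> /germ_act_rep [s [t [x [tx sx -> ->]]]]; rewrite tact_gtot//.
have h : sdomain (tbj1 f s) (sphi t x) by apply/j1_domain.
rewrite !gtot_r//; last by apply/sdomain_mul.
by rewrite sphi_mul// j1_sphi.
Qed.

Lemma germ_tact_continuous :
  {within [set u : germS D * germS D' | germ_d u.1 = rho (germ_r u.2)],
  continuous (fun u => germ_tact f u.1 u.2 : germS D')}.
Proof.
apply/within_contP => -[l g] /= lg.
have [s [t [y [ty sy lE gE]]]] := germ_act_rep lg.
have c1 := @circle1 R.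
rewrite lE gE tact_gtot// => A.
have sty : sdomain (tbj1 f s ** t) y by apply/sdomain_mul; split=> //; apply/j1_domain.
rewrite -(sc_1 (gS (_ ** _) y)) => /(germS_nbhs _ sty c1) [U [W [nU nW UA]]].
have {}nW : nbhs (1 * 1 : C R) W by rewrite mulr1.
have [W1 [W2 [n1 n2 W12]]] := mul_nbhs nW.
exists ([set germ_sc (gS s x') z' | x' in sdomain s & z' in (W1 `&` @circle R)],
        [set germ_sc (gS t y') w' | y' in (U `&` sdomain t) & w' in (W2 `&` @circle R)]).
  rewrite /= -(sc_1 (gS s _)) -(sc_1 (gS t _)).
  split; apply/germS_nbhs => //.
    exists setT, W1; split=> //; first exact: filterT.
    by move=> x' z' _ sx' W1z cz'; exists x' => //; exists z'.
  exists U, W2; split=> //.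
  by move=> y' w' Uy' ty' W2w cw'; exists y' => //; exists w'.
move=> [_ _] [/= [x' sx' [z' [W1z cz'] <-]] [y' [Uy' ty'] [w' [W2w cw'] <-]]].
rewrite sc_d sc_r (gtot_d h1) (gtot_r h1)// => xy; subst x'.
rewrite tact_sc//; last by rewrite (gtot_d h1) (gtot_r h1).
rewrite tact_gtot//; apply: UA => //.
- by apply/sdomain_mul; split=> //; apply/j1_domain.
- exact: W12.
- exact: circleM.
Qed.

Lemma germ_arrow_anchor x : anchor0 (germ_arrow f) x = rho x.
Proof.
have [lu _ _ _ _] := germ_gpd_laws D' h1.
by rewrite /anchor0 /=; have [_ ->] := lu x.
Qed.

Lemma germ_is_tgpd_arrow : is_tgpd_arrow (germ_arrow f).
Proof.
have [lu lm la l1 li] := germ_gpd_laws D' h1.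
split=> /=.
- move=> g; apply: (@continuous_comp _ _ _ (@germ_r _ D' [set 1] : germS D' -> _) rho).
    exact: germS_r_continuous.
  exact: (dual_map_continuous bG bG' bj rhoP).
- exact: germ_tact_continuous.
- exact: germ_tact_r.
- move=> g; have [t [x [tx ->]]] := gSP g; rewrite (gtot_r h1)//.
  have [e [Ee ex ->]] := gtot_uP h1 (rho (sphi t x)).
  have Ej := morphism_idem j1M Ee.
  have jx : sdomain (tbj1 f e) (sphi t x) by apply/j1_domain.
  rewrite tact_gtot// -(gtot_m h1)// (gtot_u h1 Ej jx) -(gtot_r h1 tx).
  by have [] := l1 (gS t x).
- move=> l m g lm' /germ_act_rep [s [t [x [tx sx mE gE]]]]; subst m g.
  have [u [y [uy lE]]] := gSP l; subst l; move: lm'.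
  rewrite (gtot_d h1) (gtot_r h1)// => yE; subst y.
  rewrite (gtot_m h1)//.
  have sjx : sdomain (tbj1 f s) (sphi t x) by apply/j1_domain.
  have sjtx : sdomain (tbj1 f s ** t) x by apply/sdomain_mul.
  rewrite tact_gtot//; last by apply/sdomain_mul.
  rewrite tact_gtot// j1M -(sgA iS') -(j1_sphi sx) -(sphi_mul tx sjx) tact_gtot//.
  by rewrite (sphi_mul tx sjx) j1_sphi.
- by move=> g h gh; have [_ ->] := lm _ _ gh.
- exact: germ_tact_d.
- move=> l g h /germ_act_rep [s [t [x [tx sx lE gE]]]]; subst l g.
  have [u [y [uy ->]]] := gSP h; rewrite (gtot_d h1) (gtot_r h1)// => xE; subst x.
  have tuy : sdomain (t ** u) y by apply/sdomain_mul.
  have sjx : sdomain (tbj1 f s) (sphi t (sphi u y)) by apply/j1_domain.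
  rewrite (gtot_m h1)// tact_gtot// -(sphi_mul uy tx) tact_gtot//; last by rewrite sphi_mul.
  by rewrite (gtot_m h1) ?(sgA iS')//; apply/sdomain_mul.
- move=> l g z cz lg; rewrite !tsc_germ//.
  have c1 := @circle1 R.
  by rewrite -{1}(sc_1 g) -{2}(sc_1 l) !tact_sc// mulr1 mul1r.
- move=> K cK; rewrite (_ : anchor0 (germ_arrow f) = rho).
    exact: (dual_map_proper bG bG' bj rhoP).
  by apply/funext => x; exact: germ_arrow_anchor.
- move=> l g lg; rewrite /germ_tact; case: xgetP => // h -> [s [t [x [tx [sx [stx [lE gE _]]]]]]].
  by case: lg; rewrite lE gE !gtotE (gtot_d h1) (gtot_r h1).
Qed.

Lemma germ_arrow_formulaP : germ_arrow_formula f.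
Proof.
move=> s t x tx sx; have stx : sdomain (tbj1 f s ** t) x.
  by apply/sdomain_mul; split=> //; apply/j1_domain.
by exists stx; rewrite !gtotE tact_gtot.
Qed.

(** The value of the action at a unit, to which equality of arrows and naturality are reduced. *)
Lemma tact_unit s x : sdomain s (rho x) ->
  germ_tact f (gS s (rho x)) (germ_u [set 1] x) = gS (tbj1 f s) x.
Proof.
move=> sx; have [e [Ee ex ->]] := gtot_uP h1 x.
rewrite -{1}(sphi_idem Ee ex) tact_gtot//; last by rewrite sphi_idem.
by rewrite gtot_mul_idem//; apply/j1_domain.
Qed.
End GermArrow.

Section GermFunctor.
Variable R : realType.
Let h1 := @scalar_group1 R.
Local Notation gS := (gtot [set 1]).
Local Notation F := (germ_functor (@germ_is_tgpd R) (@germ_is_tgpd_arrow R)).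

Lemma germ_functorP : is_functor F.
Proof.
split.
- move=> D; have [lu lm la l1 li] := germ_gpd_laws D h1.
  (* The dual map was obtained by choice; its uniqueness is what makes it functorial. *)
  have rid : dual_map (idm D : tbis_arrow D D) = id.
    by apply: (dual_map_uniq (j := id)) => //; exact: dual_mapP.
  apply: tgpd_arrow_ext => [x|l x].
    rewrite germ_arrow_anchor rid /anchor0 /=.
    by have [_ ->] := lu x.
  rewrite germ_arrow_anchor rid /= => lx.
  have [s [y [sy lE]]] := gSP l; subst l; rewrite /= (gtot_d h1) in lx; subst y.
  have [dx ->] := lu x; rewrite (gtot_d h1); case: asboolP => // _.
  have := @tact_unit _ _ _ (idm D : tbis_arrow D D) s x.
  rewrite rid => ->//=.
  by have [_] := l1 (gS s x); rewrite (gtot_d h1).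
- move=> D1 D2 D3 g f; have [lu lm la l1 li] := germ_gpd_laws D3 h1.
  have rgf : dual_map (cmp g f : tbis_arrow D1 D3) = dual_map f \o dual_map g.
    apply: (dual_map_uniq (j := tbj g \o tbj f)); last exact: dual_mapP.
    move=> x e Ee; rewrite /= !dual_mapP//.
    exact: (boolean_morphism_idem (tba_j (tbaP f)) Ee).
  apply: tgpd_arrow_ext => [x|l x].
    rewrite germ_arrow_anchor rgf /anchor0 /=.
    have [_ ->] := lu x; have [lu2 _ _ _ _] := germ_gpd_laws D2 h1.
    by have [_ ->] := lu2 (dual_map g x).
  rewrite germ_arrow_anchor => lx.
  have [s [y [sy lE]]] := gSP l; subst l; rewrite /= (gtot_d h1) in lx; subst y.
  rewrite /= tact_unit//.
  have [_ ->] := lu x; rewrite rgf /= in sy *.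
  have sjx : sdomain (tbj1 f s) (dual_map g x) by apply/j1_domain.
  by rewrite tact_unit// tact_unit.
Qed.
End GermFunctor.

Lemma within_cont_postcomp (A B E : topologicalType) (S : set A) (f : A -> B) (g : B -> E) :
  continuous g -> {within S, continuous f} -> {within S, continuous (fun x => g (f x))}.
Proof.
move=> cg /within_contP cf; apply/within_contP => x Sx W nW.
exact: (cf x Sx _ (cg _ _ nW)).
Qed.

(** * Compact bisections *)

Section GroupoidAlgebra.
Variables (X : topologicalType) (K : gpd_data X).
Hypothesis hK : topological_groupoid K.
Implicit Types (a b c : K) (x y : X).

Lemma gmKV a b : gd a = gd b -> gm (gm a (gi b)) b = a.
Proof.
move=> ab; rewrite -(gmA hK) ?(gr_i hK)// ?(gd_i hK)// (gmVg hK) -ab.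
exact: (gmg1 hK).
Qed.

Lemma gmKg a b : gd a = gr b -> gm (gi a) (gm a b) = b.
Proof.
by move=> ab; rewrite (gmA hK) ?(gd_i hK)// (gmVg hK) ab (gm1g hK).
Qed.

Lemma gmgK a b : gd a = gr b -> gm (gm a b) (gi b) = a.
Proof.
by move=> ab; rewrite -(gmA hK) ?(gr_i hK)// (gmgV hK) -ab (gmg1 hK).
Qed.

Lemma gi_uniq a b : gd a = gr b -> gm a b = gu (gd b) -> a = gi b.
Proof.
move=> ab e; rewrite -(gmgK ab) e -(gr_i hK b) (gm1g hK)//.
Qed.

Lemma giK a : gi (gi a) = a.
Proof.
by apply/esym/gi_uniq; rewrite ?(gr_i hK)// (gmgV hK) (gd_i hK).
Qed.

Lemma giM a b : gd a = gr b -> gi (gm a b) = gm (gi b) (gi a).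
Proof.
move=> ab; apply/esym/gi_uniq.
  by rewrite (gd_m hK) ?(gd_i hK) ?(gr_i hK)// (gr_m hK).
rewrite -(gmA hK) ?(gd_i hK) ?(gr_i hK) ?(gr_m hK) ?gmKg//.
by rewrite (gmVg hK) (gd_m hK).
Qed.

Lemma gi_u x : gi (gu x : K) = gu x.
Proof.
apply/esym/gi_uniq; rewrite ?(gd_u hK) ?(gr_u hK)//.
by have := gm1g hK (gu x : K); rewrite (gr_u hK).
Qed.

Lemma gu_inj x y : gu x = gu y :> K -> x = y.
Proof. by move=> /(congr1 (@gd _ K)); rewrite !(gd_u hK). Qed.

Lemma set_gmA (A B C : set K) : set_gm A (set_gm B C) = set_gm (set_gm A B) C.
Proof.
apply/seteqP; split=> k.
  move=> [a [_ [Aa [b [c [Bb Cc bc ->]]] abc ->]]].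
  rewrite (gr_m hK)// in abc.
  exists (gm a b), c; split=> //; first by exists a, b.
    by rewrite (gd_m hK).
  exact: (gmA hK).
move=> [_ [c [[a [b [Aa Bb ab ->]]] Cc abc ->]]].
rewrite (gd_m hK)// in abc.
exists a, (gm b c); split=> //; first by exists b, c.
  by rewrite (gr_m hK).
by rewrite (gmA hK).
Qed.

Lemma gi_set_gm (A B : set K) :
  @gi X K @` set_gm A B = set_gm (@gi X K @` B) (@gi X K @` A).
Proof.
apply/seteqP; split=> k.
  move=> [_ [a [b [Aa Bb ab ->]]] <-]; exists (gi b), (gi a).
  split; [by exists b|by exists a|by rewrite (gd_i hK) (gr_i hK)|exact: giM].
move=> [_ [_ [[b Bb <-] [a Aa <-]]]]; rewrite (gd_i hK) (gr_i hK) => ba ->.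
by exists (gm a b); [exists a, b|rewrite giM].
Qed.

Lemma gi_setK (A : set K) : @gi X K @` (@gi X K @` A) = A.
Proof.
apply/seteqP; split=> k; first by move=> [_ [a Aa <-] <-]; rewrite giK.
by move=> Ak; exists (gi k); [exists k|rewrite giK].
Qed.
End GroupoidAlgebra.

Section Bisections.
Variables (X : topologicalType) (K : gpd_data X).
Hypothesis hK : topological_groupoid K.
Hypothesis bX : boolean_space X.
Let HX := bs_hausdorff bX.
Implicit Types (a b : K) (x y : X) (U V : set X).
Local Notation inv A := (@gi X K @` A).
Local Notation units U := ((gu : X -> K) @` U).

(** Sections of d over compact open subsets of X have no separation condition on the groupoid.
    Inversion exchanges r and d, so a bisection is a set which is a section together with its
    inverse. *)
Definition is_section (A : set K) := exists U (sg : X -> K),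
  [/\ copen U, {within U, continuous sg}, forall x, U x -> gd (sg x) = x & A = sg @` U].

Lemma bisectionP (A : set K) : is_bisection A <-> is_section A /\ is_section (inv A).
Proof.
split=> [[cA [[cd [g gK cg]] od] [[cr [g' g'K cg']] or]]|].
  split.
    exists (@gd X K @` A), g; split=> //; first by split=> //; exact: within_compact_image.
      by move=> _ [a Aa <-]; rewrite gK.
    apply/seteqP; split=> k; first by move=> Ak; exists (gd k); [exists k|rewrite gK].
    by move=> [_ [a Aa <-] <-]; rewrite gK.
  exists (@gr X K @` A), (fun x => gi (g' x)); split.
  - by split=> //; exact: within_compact_image.
  - exact: within_cont_postcomp (gi_cont hK) cg'.
  - by move=> _ [a Aa <-]; rewrite (gd_i hK) g'K.
  - apply/seteqP; split=> k.
      by move=> [a Aa <-]; exists (gr a); [exists a|rewrite g'K].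
    by move=> [_ [a Aa <-] <-]; rewrite g'K//; exists a.
move=> [[U [sg [cU csg dsg AE]]] [V [ta [cV cta dta IE]]]].
have dA : @gd X K @` A = U.
  rewrite AE; apply/seteqP; split=> x; first by move=> [_ [y Uy <-] <-]; rewrite dsg.
  by move=> Ux; exists (sg x); [exists x|rewrite dsg].
have rA : @gr X K @` A = V.
  apply/seteqP; split=> x.
    move=> [a Aa <-]; have : (inv A) (gi a) by exists a.
    by rewrite IE => -[y Vy e]; rewrite -(gd_i hK) -e dta.
  move=> Vx; have : (inv A) (ta x) by rewrite IE; exists x.
  by move=> [a Aa e]; exists a => //; rewrite -(gd_i hK) e dta.
split.
- by rewrite AE; apply: within_compact_image csg; case: cU.
- split; last by rewrite dA; case: cU.
  split; first by apply: continuous_subspaceT; exact: (gd_cont hK).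
  exists sg; last by rewrite dA.
  by rewrite AE => _ [x Ux <-]; rewrite dsg.
- split; last by rewrite rA; case: cV.
  split; first by apply: continuous_subspaceT; exact: (gr_cont hK).
  exists (fun x => gi (ta x)).
    move=> a Aa; have : (inv A) (gi a) by exists a.
    rewrite IE => -[y Vy e]; rewrite -(giK hK a) -e; congr gi; congr ta.
    by rewrite (gr_i hK) dta.
  by rewrite rA; exact: within_cont_postcomp (gi_cont hK) cta.
Qed.

Lemma section_inj (A : set K) a b : is_section A -> A a -> A b -> gd a = gd b -> a = b.
Proof.
move=> [U [sg [cU csg dsg ->]]] [x Ux <-] [y Uy <-].
by rewrite !dsg// => ->.
Qed.

Lemma bisection_injd (A : set K) a b : is_bisection A -> A a -> A b -> gd a = gd b -> a = b.
Proof. by move=> /bisectionP [sA _]; exact: section_inj. Qed.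

Lemma bisection_injr (A : set K) a b : is_bisection A -> A a -> A b -> gr a = gr b -> a = b.
Proof.
move=> /bisectionP [_ sA] Aa Ab ab; rewrite -(giK hK a) -(giK hK b); congr gi.
by apply: (section_inj sA); [exists a|exists b|rewrite !(gd_i hK)].
Qed.

Lemma bisection_copend (A : set K) : is_bisection A -> copen (@gd X K @` A).
Proof.
move=> bA; split; last exact: (bis_d bA).2.
apply: within_compact_image (bis_compact bA) _.
by apply: continuous_subspaceT; exact: (gd_cont hK).
Qed.

Lemma section_gm (A B : set K) : is_section A -> is_section B -> is_section (set_gm A B).
Proof.
move=> [U [sg [cU csg dsg ->]]] [V [ta [cV cta dta ->]]].
have crt : {within V, continuous (fun x => gr (ta x))}.
  exact: within_cont_postcomp (gr_cont hK) cta.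
pose W := V `&` (fun x => gr (ta x)) @^-1` U.
exists W, (fun x => gm (sg (gr (ta x))) (ta x)); split.
- exact: copen_preimage.
- have WV : W `<=` V by move=> x [].
  apply: (Defs.within_continuous_comp (f := fun x => (sg (gr (ta x)), ta x))
    (T := [set z : K * K | gd z.1 = gr z.2]) (g := fun z => gm z.1 z.2)).
  + by move=> x [_ Ux] /=; rewrite dsg.
  + apply: within_continuous_pair; last exact: within_cont_sub WV cta.
    apply: (Defs.within_continuous_comp (f := fun x => gr (ta x)) (T := U) (g := sg)) => //.
      by move=> x [].
    exact: within_cont_sub WV crt.
  + exact: (gm_cont hK).
- by move=> x [Vx Ux]; rewrite (gd_m hK) ?dta// dsg.
- apply/seteqP; split=> k.
    move=> [_ [_ [[u Uu <-] [v Vv <-]]]]; rewrite dsg// => uv ->.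
    by subst u; exists v => //; split.
  move=> [x [Vx Ux] <-]; exists (sg (gr (ta x))), (ta x).
  by split; [exists (gr (ta x))|exists x|rewrite dsg|].
Qed.

Lemma bisection_gm (A B : set K) : is_bisection A -> is_bisection B ->
  is_bisection (set_gm A B).
Proof.
move=> /bisectionP [sA sA'] /bisectionP [sB sB']; apply/bisectionP.
by rewrite gi_set_gm//; split; exact: section_gm.
Qed.

Lemma bisection_gi (A : set K) : is_bisection A -> is_bisection (inv A).
Proof. by move=> /bisectionP [sA sA']; apply/bisectionP; rewrite gi_setK. Qed.

Lemma to_bisE (A : set K) : is_bisection A -> sval (to_bis A) = A.
Proof.
move=> bA; rewrite /to_bis; case: xgetP => [B _ //|/(_ (exist _ A bA))].
by case.
Qed.

Lemma bis_eq (A B : bis_sg K) : sval A = sval B -> A = B.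
Proof. by case: A B => [A bA] [B bB] /= e; exact: eq_exist. Qed.

Lemma sval_mul (A B : bis_sg K) : sval (A ** B) = set_gm (sval A) (sval B).
Proof. by apply: to_bisE; apply: bisection_gm; exact: svalP. Qed.

Lemma sval_star (A : bis_sg K) : sval A^-* = inv (sval A).
Proof. by apply: to_bisE; apply: bisection_gi; exact: svalP. Qed.

Lemma bis_formulasP : bis_formulas K.
Proof. by split; [exact: sval_mul|exact: sval_star]. Qed.

Lemma set_gm_star (A : set K) : is_bisection A -> set_gm (set_gm A (inv A)) A = A.
Proof.
move=> bA; apply/seteqP; split=> k.
  move=> [_ [c [[a [_ [Aa [b Ab <-] ab ->]]] Ac ac ->]]].
  rewrite (gr_i hK) in ab; rewrite (gd_m hK) ?(gr_i hK)// (gd_i hK) in ac.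
  have E : a = b by exact: (bisection_injd bA).
  subst b; have <- : a = c by exact: (bisection_injr bA).
  by rewrite gmKV.
move=> Ak; exists (gm k (gi k)), k; split=> //.
- by exists k, (gi k); split; [|exists k|rewrite (gr_i hK)|].
- by rewrite (gd_m hK) ?(gr_i hK)// (gd_i hK).
- by rewrite gmKV.
Qed.

Lemma bis_inverse_semigroup : inverse_semigroup (bis_sg K).
Proof.
split.
- by move=> A B C; apply: bis_eq; rewrite !sval_mul set_gmA.
- move=> A; apply: bis_eq; rewrite sval_mul /=.
  by apply/seteqP; split=> // k [a [b [[]]]].
- move=> A; apply: bis_eq; rewrite sval_mul /=.
  by apply/seteqP; split=> // k [a [b [_ []]]].
- move=> A; apply: bis_eq; rewrite !sval_mul sval_star set_gm_star//; exact: svalP.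
- move=> A; apply: bis_eq; rewrite !sval_mul sval_star.
  rewrite -{2}(gi_setK hK (sval A)) set_gm_star//; apply: bisection_gi; exact: svalP.
(* Write a = a' b c with a', c in [A]. Injectivity of d and r on [A] gives a' = c = a, and
   cancellation makes [b] the inverse of [a]. *)
- have key (A B : bis_sg K) : A ** B ** A = A -> B ** A ** B = B ->
      inv (sval A) `<=` sval B.
    move=> e e' _ [a Aa <-]; move: (Aa); rewrite -{1}e !sval_mul.
    move=> [_ [c [[a' [b [Aa' Bb ab ->]]] Ac abc E]]].
    rewrite (gd_m hK)// in abc.
    have ac : a = c.
      apply: (bisection_injd (svalP A)) => //; rewrite E (gd_m hK)// (gd_m hK)//.
    have aa' : a = a'.
      apply: (bisection_injr (svalP A)) => //; rewrite E (gr_m hK) ?(gd_m hK)// (gr_m hK)//.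
    subst a' c; suff <- : b = gi a by [].
    apply: gi_uniq => //; have rab : gr a = gr (gm a b) by rewrite (gr_m hK).
    have : gm (gi a) (gm (gm a b) a) = gm (gi a) a by rewrite -E.
    by rewrite -(gmA hK)// gmKg ?(gr_m hK)// (gmVg hK).
  move=> A B e e'; apply: bis_eq; rewrite sval_star; apply/seteqP; split.
    move=> b Bb; exists (gi b); last exact: giK.
    by apply: (key _ _ e' e); exists b.
  exact: key.
Qed.

Let iS := bis_inverse_semigroup.

Lemma section_units U : copen U -> is_section (units U).
Proof.
move=> cU; exists U, gu; split=> //; first by apply: continuous_subspaceT; exact: (gu_cont hK).
by move=> x _; exact: (gd_u hK).
Qed.

Lemma inv_units U : inv (units U) = units U.
Proof.
apply/seteqP; split=> k; first by move=> [_ [x Ux <-] <-]; rewrite gi_u//; exists x.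
by move=> [x Ux <-]; exists (gu x); [exists x|rewrite gi_u].
Qed.

Lemma bisection_units U : copen U -> is_bisection (units U).
Proof. by move=> cU; apply/bisectionP; rewrite inv_units; split; exact: section_units. Qed.

Definition ubis U : bis_sg K := to_bis (units U).

Lemma sval_ubis U : copen U -> sval (ubis U) = units U.
Proof. by move=> /bisection_units; exact: to_bisE. Qed.

Lemma set_gm_units_r (A : set K) U : set_gm A (units U) = A `&` @gd X K @^-1` U.
Proof.
apply/seteqP; split=> k.
  move=> [a [_ [Aa [x Ux <-]]]]; rewrite (gr_u hK) => ax ->.
  by rewrite -ax (gmg1 hK); split=> //=; rewrite ax.
move=> [Ak Uk]; exists k, (gu (gd k)); rewrite (gr_u hK) (gmg1 hK).
by split=> //; exists (gd k).
Qed.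

Lemma units_I U V : set_gm (units U) (units V) = units (U `&` V).
Proof.
rewrite set_gm_units_r; apply/seteqP; split=> k.
  by move=> [[x Ux <-]] /=; rewrite (gd_u hK) => Vx; exists x.
by move=> [x [Ux Vx] <-]; split; [exists x|rewrite /= (gd_u hK)].
Qed.

Lemma ubis_idem U : copen U -> idem (ubis U).
Proof. by move=> cU; apply: bis_eq; rewrite sval_mul !sval_ubis// units_I setIid. Qed.

Lemma bis_idemP (A : bis_sg K) : idem A <-> forall a, sval A a -> a = gu (gd a).
Proof.
split=> [EA a Aa|h].
  move: (Aa); rewrite -{1}EA sval_mul => -[b [c [Ab Ac bc E]]].
  have ac : a = c by apply: (bisection_injd (svalP A)) => //; rewrite E (gd_m hK).
  have ab : a = b by apply: (bisection_injr (svalP A)) => //; rewrite E (gr_m hK).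
  subst b c.
  have : gm (gi a) a = gm (gi a) (gm a a) by rewrite -E.
  by rewrite gmKg// (gmVg hK).
have AE : sval A = units (@gd X K @` sval A).
  apply/seteqP; split=> k; first by move=> Ak; exists (gd k); [exists k|rewrite -h].
  by move=> [_ [a Aa <-] <-]; rewrite -h.
by apply: bis_eq; rewrite sval_mul AE units_I setIid.
Qed.

Lemma bis_idemE (A : bis_sg K) : idem A -> exists2 U, copen U & A = ubis U.
Proof.
move=> /bis_idemP h; have cU := bisection_copend (svalP A); exists (@gd X K @` sval A) => //.
apply: bis_eq; rewrite sval_ubis//; apply/seteqP; split=> k.
  by move=> Ak; exists (gd k); [exists k|rewrite -h].
by move=> [_ [a Aa <-] <-]; rewrite -h.
Qed.

Lemma bis_leP (A B : bis_sg K) : sg_le A B <-> sval A `<=` sval B.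
Proof.
split.
  move=> [E EE ->]; have [U cU ->] := bis_idemE EE.
  by rewrite sval_mul sval_ubis// set_gm_units_r => k [].
move=> AB; have cU := bisection_copend (svalP A).
exists (ubis (@gd X K @` sval A)); first exact: ubis_idem.
apply: bis_eq; rewrite sval_mul sval_ubis// set_gm_units_r.
apply/seteqP; split=> k; first by move=> Ak; split; [exact: AB|exists k].
move=> [Bk [a Aa ak]]; suff <- : a = k by [].
by apply: (bisection_injd (svalP B)) => //; exact: AB.
Qed.

Lemma units_sub U V : units U `<=` units V <-> U `<=` V.
Proof.
split=> [UV x Ux|UV _ [x Ux <-]]; last by exists x => //; exact: UV.
by have [|y Vy /(gu_inj hK) <-] := UV (gu x); first by exists x.
Qed.

Lemma units_inj U V : units U = units V -> U = V.
Proof. by move=> e; apply/seteqP; split; apply/units_sub; rewrite e. Qed.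

Lemma ubis_le U V : copen U -> copen V -> sg_le (ubis U) (ubis V) <-> U `<=` V.
Proof. by move=> cU cV; rewrite bis_leP !sval_ubis//; exact: units_sub. Qed.

Lemma ubis_join U V : copen U -> copen V ->
  is_join idem (ubis U) (ubis V) (ubis (U `|` V)).
Proof.
move=> cU cV; have cUV := copenU cU cV; split; first exact: ubis_idem.
- by apply/ubis_le => //; left.
- by apply/ubis_le => //; right.
- move=> E /bis_idemE [W cW ->] /(ubis_le cU cW) UW /(ubis_le cV cW) VW.
  by apply/ubis_le => // x [/UW|/VW].
Qed.

Lemma ubis_joinE U V W : copen U -> copen V -> copen W ->
  is_join idem (ubis U) (ubis V) (ubis W) <-> W = U `|` V.
Proof.
move=> cU cV cW; split; last by move=> ->; exact: ubis_join.
move=> j; have := join_uniq iS j (ubis_join cU cV) => /(congr1 sval).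
by rewrite !sval_ubis//; [exact: units_inj|exact: copenU].
Qed.

Lemma ubisI U V : copen U -> copen V -> ubis U ** ubis V = ubis (U `&` V).
Proof.
move=> cU cV; apply: bis_eq; rewrite sval_mul !sval_ubis ?units_I//.
exact: copenI.
Qed.

Lemma ubis0 : ubis set0 = sg_zero.
Proof. by apply: bis_eq; rewrite sval_ubis ?image_set0//; exact: copen0. Qed.

Lemma bis_boolean_idem : boolean_idem (bis_sg K).
Proof.
split.
- move=> _ _ /bis_idemE [U cU ->] /bis_idemE [V cV ->].
  by exists (ubis (U `|` V)); exact: ubis_join.
- move=> _ _ _ k /bis_idemE [U cU ->] /bis_idemE [V cV ->] /bis_idemE [W cW ->] j.
  have [/bis_idemE [T cT kE] _ _ _] := j; subst k; move: j => /(ubis_joinE cV cW cT) ->.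
  rewrite !ubisI//; last exact: copenU.
  by rewrite setIUr; apply: ubis_join; exact: copenI.
- move=> _ _ /bis_idemE [U cU ->] /bis_idemE [V cV ->].
  have cD := copenD HX cV cU; have cI := copenI HX cU cV.
  exists (ubis (V `\` U)); split; first exact: ubis_idem.
    rewrite ubisI// -ubis0; congr ubis.
    by apply/seteqP; split=> // x [[]].
  rewrite ubisI//; apply/ubis_joinE => //.
  apply/seteqP; split=> x; last by case=> -[].
  by move=> Vx; have [Ux|Ux] := pselect (U x); [left|right].
Qed.

Lemma sectionU (A B : set K) : is_section A -> is_section B ->
  (forall a b, A a -> B b -> gd a <> gd b) -> is_section (A `|` B).
Proof.
move=> [U [sg [cU csg dsg ->]]] [V [ta [cV cta dta ->]]] dj.
have UV x : U x -> V x -> False.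
  by move=> Ux Vx; apply: (dj (sg x) (ta x)); [exists x|exists x|rewrite dsg// dta].
pose f x := if `[< U x >] then sg x else ta x.
have fU x : U x -> f x = sg x by rewrite /f; case: asboolP.
have fV x : V x -> f x = ta x by rewrite /f; case: asboolP => // Ux Vx; case: (UV x).
exists (U `|` V), f; split; first exact: copenU.
(* The two sections are pasted along closed sets: compact open subsets of the Hausdorff space X are
   closed. *)
- apply: withinU_continuous; [exact: copen_closed|exact: copen_closed| |].
    by apply: within_cont_eq csg => x Ux; rewrite fU.
  by apply: within_cont_eq cta => x Vx; rewrite fV.
- by move=> x [Ux|Vx]; [rewrite fU// dsg|rewrite fV// dta].
- apply/seteqP; split=> k.
    case=> -[x hx <-].
      by exists x; [left|exact: fU].
    by exists x; [right|exact: fV].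
  by move=> [x [hx|hx] <-]; [left; exists x => //; rewrite fU|right; exists x => //; rewrite fV].
Qed.

Lemma bisectionU (A B : set K) : is_bisection A -> is_bisection B ->
  (forall a b, A a -> B b -> gd a <> gd b /\ gr a <> gr b) -> is_bisection (A `|` B).
Proof.
move=> /bisectionP [sA sA'] /bisectionP [sB sB'] dj; apply/bisectionP; split.
  by apply: sectionU => // a b Aa Bb; have [] := dj _ _ Aa Bb.
rewrite image_setU; apply: sectionU => // _ _ [a Aa <-] [b Bb <-].
by rewrite !(gd_i hK); have [] := dj _ _ Aa Bb.
Qed.

Lemma orthogonal_disjoint (A B : bis_sg K) : Defs.orthogonal A B ->
  forall a b, sval A a -> sval B b -> gd a <> gd b /\ gr a <> gr b.
Proof.
move=> [e1 e2] a b Aa Bb; split=> ab.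
  move/(congr1 sval): e2; rewrite sval_mul sval_star /= => e.
  rewrite -[False]/(set0 (gm a (gi b))) -e; exists a, (gi b).
  by split; [by []|exists b|rewrite (gr_i hK)|by []].
move/(congr1 sval): e1; rewrite sval_mul sval_star /= => e.
rewrite -[False]/(set0 (gm (gi a) b)) -e; exists (gi a), b.
by split; [exists a|by []|rewrite (gd_i hK)|by []].
Qed.

Lemma disjoint_orthogonal (A B : bis_sg K) :
  (forall a b, sval A a -> sval B b -> gd a <> gd b /\ gr a <> gr b) -> Defs.orthogonal A B.
Proof.
move=> dj; split; apply: bis_eq; rewrite sval_mul sval_star /=; apply/seteqP; split=> // k.
  move=> [_ [b [[a Aa <-] Bb]]]; rewrite (gd_i hK) => ab _.
  by have [] := dj _ _ Aa Bb.
move=> [a [_ [Aa [b Bb <-]]]]; rewrite (gr_i hK) => ab _.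
by have [] := dj _ _ Aa Bb.
Qed.

Lemma bis_boolean : boolean_isg (bis_sg K).
Proof.
split; [exact: bis_inverse_semigroup|exact: bis_boolean_idem|].
move=> A B o; have bAB := bisectionU (svalP A) (svalP B) (orthogonal_disjoint o).
exists (exist _ _ bAB); split=> //; [by apply/bis_leP => a; left|by apply/bis_leP => a; right|].
by move=> C _ /bis_leP AC /bis_leP BC; apply/bis_leP => a /= [/AC|/BC].
Qed.

Local Notation dualK := (dual (bis_sg K)).

Lemma is_pointE (c : dualK) x U : is_point c x -> copen U -> sval c (ubis U) <-> U x.
Proof.
move=> cx cU; rewrite cx sval_ubis//; split.
  by move=> [_ [y Uy /(gu_inj hK) <-]].
by move=> Ux; split; [exact: ubis_idem|exists x].
Qed.

Lemma point_exists x : exists c : dualK, is_point c x.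
Proof.
pose c : set (bis_sg K) := [set A : bis_sg K | idem A /\ sval A (gu x)].
have cE U : copen U -> c (ubis U) <-> U x.
  move=> cU; rewrite /c /= sval_ubis//; split; first by move=> [_ [y Uy /(gu_inj hK) <-]].
  by move=> Ux; split; [exact: ubis_idem|exists x].
have bc : boolean_character c.
  split.
  - by move=> A [].
  - have [U [cU Ux _]] := boolean_space_copen bX (@filterT _ (nbhs x) _).
    by exists (ubis U); apply/cE.
  - by rewrite -ubis0 => /(cE _ (@copen0 X)).
  - move=> _ _ /bis_idemE [U cU ->] /bis_idemE [V cV ->].
    by rewrite ubisI// !cE//; exact: copenI.
  - move=> _ _ g /bis_idemE [U cU ->] /bis_idemE [V cV ->] j.
    have [/bis_idemE [W cW gE] _ _ _] := j; subst g.
    by move: j => /(ubis_joinE cU cV cW) ->; rewrite !cE//; exact: copenU.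
by exists (exist _ c bc).
Qed.

Lemma point_uniq (c : dualK) x y : is_point c x -> is_point c y -> x = y.
Proof.
move=> cx cy; apply: HX => A B nA nB.
have [U [cU Ux UA]] := boolean_space_copen bX nA.
have [V [cV Vy VB]] := boolean_space_copen bX nB.
exists x; split; first exact: UA.
by apply: VB; apply/(is_pointE cx cV)/(is_pointE cy cV).
Qed.

Lemma point_eq (c c' : dualK) x : is_point c x -> is_point c' x -> c = c'.
Proof. by move=> cx cx'; apply: dual_eq => E EE; rewrite cx cx'. Qed.

(** The compact open sets selected by [c] generate a filter containing the compact set [U0]; being
    closed, they all contain its cluster point. *)
Lemma dual_point (c : dualK) : exists x, is_point c x.
Proof.
have [E0 cE0] := char_neq0 (svalP c).
have [U0 cU0 EU0] := bis_idemE (char_idem cE0); subst E0.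
pose F : set_system X := [set A | exists2 U, copen U /\ sval c (ubis U) & U `<=` A].
have cI U V : copen U -> copen V -> sval c (ubis (U `&` V)) <-> sval c (ubis U) /\ sval c (ubis V).
  by move=> cU cV; rewrite -ubisI// charM//; exact: ubis_idem.
have FF : ProperFilter F.
  apply: Build_ProperFilter_ex.
    move=> A [U [cU cxU] UA]; apply: contrapT => nA.
    have U0' : U = set0 by apply/seteqP; split=> // x /UA Ax; apply: nA; exists x.
    by move: cxU; rewrite U0' ubis0 => /(char_0 (svalP c)).
  split.
  - by exists U0.
  - move=> A B [U [cU xU] UA] [V [cV xV] VB]; exists (U `&` V).
      by split; [exact: copenI|apply/cI].
    by move=> x [/UA ? /VB].
  - by move=> A B AB [U hU UA]; exists U => // x /UA /AB.
have [x [U0x clx]] : U0 `&` cluster F !=set0.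
  by apply: (cU0.1 F FF); exists U0.
have key U : copen U -> sval c (ubis U) -> U x.
  move=> cU xU; apply: (copen_closed HX cU) => B nB.
  by apply: clx => //; exists U.
exists x => A; split.
  move=> cA; have EA := char_idem cA; split=> //.
  have [U cU AU] := bis_idemE EA; subst A.
  by rewrite sval_ubis//; exists x => //; exact: key.
move=> [/bis_idemE [U cU ->]]; rewrite sval_ubis// => -[y Uy /(gu_inj hK) yx]; subst y.
(* If [c] did not select [U], it would select the rest of [U0], which would then contain [x]. *)
have cD := copenD HX cU0 cU; have cII := copenI HX cU0 cU.
have j : is_join idem (ubis (U0 `&` U)) (ubis (U0 `\` U)) (ubis U0).
  apply/ubis_joinE => //; apply/seteqP; split=> z; last by case=> -[].
  by move=> Uz; have [h|h] := pselect (U z); [left|right].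
have [/(cI _ _ cU0 cU) []//|/(key _ cD) []//] :=
  (char_join (svalP c) (ubis_idem cII) (ubis_idem cD) j).1 cE0.
Qed.

Definition pt (c : dualK) : X := sval (cid (dual_point c)).
Definition chr x : dualK := sval (cid (point_exists x)).

Lemma ptP c : is_point c (pt c).
Proof. by rewrite /pt; case: cid. Qed.

Lemma chrP x : is_point (chr x) x.
Proof. by rewrite /chr; case: cid. Qed.

Lemma ptK : cancel pt chr.
Proof. by move=> c; apply: (point_eq (x := pt c)); [exact: chrP|exact: ptP]. Qed.

Lemma chrK : cancel chr pt.
Proof. by move=> x; apply: (point_uniq (c := chr x)); [exact: ptP|exact: chrP]. Qed.

Lemma pt_ideal U : copen U -> pt @^-1` U = ideal_open (ubis U).
Proof.
by move=> cU; apply/seteqP; split=> c; rewrite /ideal_open /= (is_pointE (ptP c) cU).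
Qed.

Lemma chr_ideal U : copen U -> chr @^-1` ideal_open (ubis U) = U.
Proof.
by move=> cU; apply/seteqP; split=> x; rewrite /ideal_open /= (is_pointE (chrP x) cU).
Qed.

Lemma pt_continuous : continuous pt.
Proof.
move=> c W /(boolean_space_copen bX) [U [cU Uc UW]]; rewrite nbhs_simpl /=.
apply/(dual_nbhs bis_boolean); exists (ubis U); split; first exact: ubis_idem.
  exact/(is_pointE (ptP c) cU).
by rewrite -pt_ideal// => d /UW.
Qed.

Lemma chr_continuous : continuous chr.
Proof.
move=> x W /(dual_nbhs bis_boolean) [E [/bis_idemE [U cU ->] xE EW]]; rewrite nbhs_simpl /=.
have Ux : U x by apply/(is_pointE (chrP x) cU).
apply: filterS (open_nbhs_nbhs (conj cU.2 Ux)) => y; rewrite -{1}(chr_ideal cU).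
exact: EW.
Qed.

Lemma bis_dom (A : bis_sg K) x : isg_dom A (chr x) <-> (@gd X K @` sval A) x.
Proof.
rewrite /isg_dom /ideal_open /mkset (chrP x); split.
  rewrite sval_mul sval_star => -[_ [_ [b [[a Aa <-] Ab]]]]; rewrite (gd_i hK) => ab e.
  exists b => //; rewrite -(gd_u hK x) e (gd_m hK)// (gd_i hK)//.
move=> [a Aa <-]; split; first exact: (idem_d iS A).
rewrite sval_mul sval_star.
by exists (gi a), a; split; [exists a| |rewrite (gd_i hK)|rewrite (gmVg hK)].
Qed.

(** Under the identification of X with the dual space, conjugation of idempotents by [A] is dual to
    the homeomorphism that follows the elements of [A] from domain to range. *)
Lemma bis_phi (A : bis_sg K) a : sval A a -> phi A (chr (gd a)) = chr (gr a).
Proof.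
move=> Aa; have Ad : isg_dom A (chr (gd a)) by apply/bis_dom; exists a.
apply: dual_eq => E /bis_idemE [U cU ->].
rewrite (phiP bis_boolean) //; last exact: ubis_idem.
rewrite (is_pointE (chrP _) cU) (chrP (gd a)) !sval_mul sval_star sval_ubis//.
rewrite set_gm_units_r; split.
  move=> [_ [_ [b [[[c Ac <-] Uc] Ab cb e]]]]; rewrite /= !(gd_i hK) in Uc cb.
  have bc : b = c by apply: (bisection_injr (svalP A)).
  suff <- : b = a by rewrite -cb.
  apply: (bisection_injd (svalP A)) => //.
  by rewrite -[RHS](gd_u hK) e (gd_m hK) ?(gd_i hK).
move=> Ua; split; first by apply: idemJV => //; exact: ubis_idem.
exists (gi a), a; split; [split; [by exists a|by rewrite /= (gd_i hK)]|by []|by rewrite (gd_i hK)|by rewrite (gmVg hK)].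
Qed.

End Bisections.

Lemma circle_compact (R : realType) : compact (@circle R : set (C R)).
Proof.
pose f (p : R * R) : C R := Complex p.1 p.2.
apply: (@subclosed_compact _ _ (f @` (`[-1, 1] `*` `[-1, 1]))).
- exact: circle_closed.
- apply: within_compact_image; first by apply: compact_setX; exact: segment_compact.
  by apply: continuous_subspaceT; exact: complex_pair_continuous.
- move=> [a b] cz; exists (a, b) => //=; move: cz; rewrite /circle /= => cz.
  have h1 := normc_ge_Re (Complex a b); rewrite cz /= lecR in h1.
  (* The imaginary part is bounded through the real part of the product with i. *)
  have h2 := normc_ge_Re (Complex a b * 'i); rewrite normrM cz mul1r in h2.
  have ni : `|'i| = 1 :> R[i] by rewrite normCi.
  rewrite ni -complexiE /= ?(mulr0,mulr1,sub0r,add0r) normrN lecR in h2.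
  by split; rewrite /= in_itv /= -ler_norml.
Qed.

Lemma nbhs1_ball (R : realType) (z : C R) (W : set (C R)) : nbhs z W ->
  exists n : nat, [set w : C R | `|w - z| < n.+1%:R^-1] `<=` W.
Proof.
move=> /nbhs_normP [e /= e0 eW].
have eE : e = (complex.Re e)%:C%C by rewrite RRe_real// gtr0_real.
have r0 : 0 < complex.Re e by rewrite -ltcR -eE.
have [n nE] : exists n : nat, (n.+1%:R^-1 : R) < complex.Re e.
  have [n] := near_infty_natSinv_lt (PosNum r0); move=> _ h.
  by exists n; apply: (h n) => /=.
exists n => w /= h; apply: eW; rewrite /= distrC; apply: lt_trans h _.
rewrite eE -ltcR in nE *; apply: le_lt_trans nE.
by rewrite rmorphV/= ?unitfE ?pnatr_eq0// rmorph_nat.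
Qed.

Lemma ball_nbhs1 (R : realType) (z : C R) (n : nat) : nbhs z [set w : C R | `|w - z| < n.+1%:R^-1].
Proof.
apply/nbhs_normP; exists n.+1%:R^-1 => /=; first by rewrite invr_gt0 ltr0n.
by move=> w /=; rewrite distrC.
Qed.

(** * Lifting bisections through a twist *)

Section TwistedGroupoid.
Variables (R : realType) (D : tgpd R).
Local Notation X := (tgX D).
Local Notation G := (tgG D).
Local Notation S := (tgS D).
Local Notation C := (C R).
Let P := tgpdP D.
Let bG := tgpdG P.
Let hG : topological_groupoid G := bgpd_gpd bG.
Let hS : topological_groupoid S := tgpdS P.
Let bX : boolean_space X := bgpd_X bG.
Let HX := bs_hausdorff bX.
Implicit Types (s t : S) (x y : X) (z w : C).

Lemma tgp_u x : tgp (gu x : S) = gu x.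
Proof.
have := tgpd_ker P (gu x); rewrite (gr_u hS) => -[_ ]; apply.
by exists 1; [exact: circle1|rewrite (tgpd_i1 P)].
Qed.

Lemma tgp_i s : tgp (gi s) = gi (tgp s).
Proof.
apply: (gi_uniq hG); rewrite ?(tgpd_d P) ?(tgpd_r P) ?(gd_i hS)//.
by rewrite -(tgpd_pM P) ?(gd_i hS)// (gmVg hS) tgp_u.
Qed.

Lemma tsc_d z s : circle z -> gd (tsc z s) = gd s.
Proof. by move=> cz; rewrite /tsc (gd_m hS)// (tgpd_di P). Qed.

Lemma tsc_r z s : circle z -> gr (tsc z s) = gr s.
Proof. by move=> cz; rewrite /tsc (gr_m hS) ?(tgpd_ri P)// (tgpd_di P). Qed.

Lemma tsc_1 s : tsc 1 s = s.
Proof. by rewrite /tsc (tgpd_i1 P) (gm1g hS). Qed.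

Lemma tsc_tsc z w s : circle z -> circle w -> tsc z (tsc w s) = tsc (z * w) s.
Proof.
move=> cz cw; rewrite /tsc (gr_m hS) ?(tgpd_di P)// (tgpd_ri P)//.
by rewrite (gmA hS) ?(tgpd_di P) ?(tgpd_ri P)// -(tgpd_iM P).
Qed.

Lemma tgp_tgi x z : circle z -> tgp (tgi x z : S) = gu x.
Proof.
move=> cz; rewrite -{2}(tgpd_ri P x cz); apply/(tgpd_ker P).
by exists z => //; rewrite (tgpd_ri P).
Qed.

Lemma tgp_tsc z s : circle z -> tgp (tsc z s) = tgp s.
Proof.
move=> cz; rewrite /tsc (tgpd_pM P) ?(tgpd_di P)// tgp_tgi//.
by rewrite -(tgpd_r P) (gm1g hG).
Qed.

Lemma tsc_gml z s t : circle z -> gd s = gr t -> gm (tsc z s) t = tsc z (gm s t).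
Proof. by move=> cz st; rewrite /tsc (gr_m hS)// (gmA hS)// (tgpd_di P). Qed.

Lemma tsc_gmr z s t : circle z -> gd s = gr t -> gm s (tsc z t) = tsc z (gm s t).
Proof.
move=> cz st; rewrite -tsc_gml// /tsc !(tgpd_central P)//.
rewrite -(gmA hS) ?(tgpd_ri P)// ?(tgpd_di P)//.
by rewrite st !(tgpd_central P).
Qed.

Lemma tgi_tsc x z : circle z -> tgi x z = tsc z (gu x) :> S.
Proof.
by move=> cz; rewrite /tsc (gr_u hS) -{3}(tgpd_di P x cz) (gmg1 hS).
Qed.

Lemma tgi_inj x y z w : circle z -> circle w -> tgi x z = tgi y w :> S ->
  x = y /\ z = w.
Proof.
move=> cz cw e; have [_ [g gK _]] := tgpd_ihomeo P.
by have := gK (x, z) cz; rewrite /= e (gK (y, w) cw) => -[].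
Qed.

Lemma tsc_inj z w s : circle z -> circle w -> tsc z s = tsc w s -> z = w.
Proof.
move=> cz cw /(congr1 (fun k : S => gm k (gi s))); rewrite !tsc_gml ?(gr_i hS)// (gmgV hS).
by rewrite -!tgi_tsc// => /(tgi_inj cz cw) [].
Qed.

(** The two elements are parallel and t s^-1 lies over a unit, hence in the image of X x T. *)
Lemma tgp_eq s t : tgp s = tgp t -> exists2 z, circle z & t = tsc z s.
Proof.
move=> st; have ds : gd s = gd t by rewrite -!(tgpd_d P) st.
have rs : gr s = gr t by rewrite -!(tgpd_r P) st.
have ts : gd t = gr (gi s) by rewrite (gr_i hS).
have : tgp (gm t (gi s)) = gu (gr (gm t (gi s))).
  by rewrite (tgpd_pM P)// tgp_i st (gmgV hG) (tgpd_r P) (gr_m hS).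
move/(tgpd_ker P) => [z cz]; rewrite (gr_m hS)// -rs => e.
exists z => //; rewrite /tsc -e.
by rewrite gmKV.
Qed.

Lemma tgi_nbhs x z (A : set S) : circle z -> nbhs (tgi x z : S) A ->
  exists U W, [/\ nbhs x U, nbhs z W & forall y w, U y -> W w -> circle w -> A (tgi y w)].
Proof.
move=> cz nA; have [/within_contP ci _] := tgpd_ihomeo P.
have [[U W] /= [nU nW] UW] := ci (x, z) cz _ nA.
by exists U, W; split=> // y w Uy Ww cw; apply: (UW (y, w)).
Qed.

Lemma tsc_nbhs z s (A : set S) : circle z -> nbhs (tsc z s) A ->
  exists W B, [/\ nbhs z W, nbhs s B & forall w t, W w -> circle w -> B t -> A (tsc w t)].
Proof.
move=> cz nA; have /within_contP cm := gm_cont hS.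
have [|[A1 A2] /= [n1 n2] A12] := cm (tgi (gr s) z, s) _ _ nA; first by rewrite /= (tgpd_di P).
have [U [W [nU nW UW]]] := tgi_nbhs cz n1.
exists W, (A2 `&` @gr X S @^-1` U); split=> //.
  by apply: filterI => //; exact: (continuous_near (gr_cont hS (x := s)) nU).
move=> w t Ww cw [A2t Ut]; apply: (A12 (tgi (gr t) w, t)).
  by split=> //=; exact: UW.
by rewrite /= (tgpd_di P).
Qed.

(* Continuity of the division map of the T-torsor p. *)
Lemma div_nbhs z s (W : set C) : circle z -> nbhs z W ->
  exists B B', [/\ nbhs s B, nbhs (tsc z s) B' &
    forall t w, B t -> B' (tsc w t) -> circle w -> W w].
Proof.
move=> cz nW; have [_ [g gK /within_contP cg]] := tgpd_ihomeo P.
have gE y w : circle w -> g (tgi y w) = (y, w) by move=> cw; exact: (gK (y, w) cw).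
have im : ((fun u => tgi u.1 u.2 : S) @` @XT R X) (tgi (gr s) z) by exists (gr s, z).
have nA : nbhs (g (tgi (gr s) z)) [set u : X * C | W u.2].
  rewrite gE//; exists (setT, W) => [|[a b] [_ Wb]] //; split=> //; exact: filterT.
have {}cg := cg _ im _ nA.
have /within_contP cm := gm_cont hS.
have e : gm (tsc z s) (gi s) = tgi (gr s) z.
  by rewrite tsc_gml ?(gr_i hS)// (gmgV hS) tgi_tsc.
have nB : nbhs (gm (tsc z s) (gi s))
    [set k | ((fun u => tgi u.1 u.2 : S) @` @XT R X) k -> W (g k).2] by rewrite e.
have dr : gd (tsc z s) = gr (gi s) by rewrite tsc_d// (gr_i hS).
have [[A1 A2] /= [n1 n2] A12] := cm (tsc z s, gi s) dr _ nB.
exists (@gi X S @^-1` A2), A1; split=> //.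
  exact: (continuous_near (gi_cont hS (x := s)) n2).
move=> t w A2t A1t cw.
have := A12 (tsc w t, gi t) (conj A1t A2t) => /=.
rewrite tsc_d// (gr_i hS) => /(_ erefl).
rewrite tsc_gml ?(gr_i hS)// (gmgV hS) -tgi_tsc// gE//; apply.
by exists (gr t, w).
Qed.

Section Lift.
Variables (U : set X) (al : X -> G).
Hypothesis (cU : copen U) (cal : {within U, continuous al}).
Hypothesis dal : forall x, U x -> gd (al x) = x.

Let covers (V : set X) (M : set S) := forall x, V x -> exists2 s, M s & tgp s = al x.
Let small (W : set C) (M : set S) := forall s z, M s -> M (tsc z s) -> circle z -> W z.

Lemma al_near x (N : set S) : U x -> open N -> (exists2 s, N s & tgp s = al x) ->
  \forall y \near x, exists2 s, N s & tgp s = al y.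
Proof.
move=> Ux oN [s Ns sx].
have nN : nbhs (al x) (@tgp _ D @` N).
  by apply: open_nbhs_nbhs; split; [exact: (tgpd_open P)|exists s].
have := continuous_near (within_cont_at cU.2 cal Ux) nN.
by apply: filterS => y [t Nt ty]; exists t.
Qed.

Lemma lift_refine (M : set S) (W : set C) : open M -> covers U M -> nbhs (1 : C) W ->
  exists M', [/\ open M', M' `<=` M, covers U M' & small W M'].
Proof.
move=> oM cM nW.
pose Q (V : set X) := V `<=` U -> exists M', [/\ open M', M' `<=` M, covers V M' & small W M'].
suff : Q U by apply.
apply: (copen_ind HX (P := Q)) cU => [|V1 V2 cV1 cV2 dj|x Ux|x Ux A nA].
- move=> _; exists set0; split=> //; exact: open0.
- move=> Q1 Q2 VU.
  have V1U : V1 `<=` U by move=> x Vx; apply: VU; left.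
  have V2U : V2 `<=` U by move=> x Vx; apply: VU; right.
  have [M1 [ o1 s1 c1 sm1]] := Q1 V1U; have [M2 [ o2 s2 c2 sm2]] := Q2 V2U.
  have od (V : set X) : copen V -> open (@gd X S @^-1` V).
    by move=> [_ oV]; move/continuousP: (gd_cont hS); exact.
  (* Each piece is cut over its own part of X, so that two points in the same fibre come from the
     same piece and smallness is kept. *)
  exists ((M1 `&` @gd X S @^-1` V1) `|` (M2 `&` @gd X S @^-1` V2)); split.
  + by apply: openU; apply: openI => //; exact: od.
  + by move=> s [[/s1 //]|[/s2 //]].
  + have h s x : U x -> tgp s = al x -> gd s = x by move=> Ux sx; rewrite -(tgpd_d P) sx dal.
    move=> x [Vx|Vx]; [have [s Ms sx] := c1 _ Vx|have [s Ms sx] := c2 _ Vx]; exists s => //.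
      by left; split=> //=; rewrite (h s x)//; exact: V1U.
    by right; split=> //=; rewrite (h s x)//; exact: V2U.
  + move=> s z [[Ms Vs]|[Ms Vs]] [[Mt Vt]|[Mt Vt]] cz; rewrite /= tsc_d// in Vt.
    * exact: (sm1 s).
    * by exfalso; rewrite -[False]/(set0 (gd s)) -dj.
    * by exfalso; rewrite -[False]/(set0 (gd s)) -dj.
    * exact: (sm2 s).
- have [s Ms sx] := cM _ Ux.
  have [B [B' [nB nB' BW]]] := div_nbhs s (circle1 R) nW.
  rewrite tsc_1 in nB'.
  pose N := M `&` (B `&` B')°.
  have oN : open N by apply: openI => //; exact: open_interior.
  have Ns : N s by split=> //; apply: nbhs_singleton; apply: nbhs_interior; exact: filterI.
  have := al_near Ux oN (ex_intro2 _ _ s Ns sx) => nN.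
  eexists; first exact: nN.
  move=> V cV Vn _ _; exists N; split=> //; first by move=> t [].
  by move=> t z [_ /interior_subset[Bt _]] [_ /interior_subset[_ Bt']]; exact: (BW t).
- exact: boolean_space_copen.
Qed.

Let state := {M : set S | open M /\ covers U M}.

Let refine_ex (n : nat) (M : state) : exists M' : state,
  sval M' `<=` sval M /\ small [set w : C | `|w - 1| < n.+1%:R^-1] (sval M').
Proof.
have [oM cM] := svalP M.
have [M' [oM' sM' cM' sm]] := lift_refine oM cM (ball_nbhs1 (1 : C) n).
by exists (exist _ M' (conj oM' cM')).
Qed.

Let start_ex : open (setT : set S) /\ covers U setT.
Proof.
split; first exact: openT.
by move=> x _; have [s sx] := tgpd_surj P (al x); exists s.
Qed.

Let Mseq : nat -> state :=
  fix F n := if n is n'.+1 then sval (cid (refine_ex n' (F n')))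
             else exist _ setT start_ex.

Let MseqS n : sval (Mseq n.+1) `<=` sval (Mseq n) /\
  small [set w : C | `|w - 1| < n.+1%:R^-1] (sval (Mseq n.+1)).
Proof. by rewrite /=; case: cid. Qed.

Let Mseq_le m n : (m <= n)%N -> sval (Mseq n) `<=` sval (Mseq m).
Proof.
move=> /subnK <-; elim: (n - m)%N => // k IH.
by rewrite addSn => s /(MseqS _).1 /IH.
Qed.

(** The limit of the refinements in the fibre over [al x]. The fibre is a circle, whose compactness
    gives an adherent point; the choice does no harm to continuity, since the sets in the fibre
    shrink. *)
Let adherent x s := tgp s = al x /\
  forall n (A : set S), nbhs s A -> exists t, [/\ A t, sval (Mseq n) t & tgp t = al x].

Let adherent_ex x : U x -> exists s, adherent x s.
Proof.
move=> Ux; have [e sx] := tgpd_surj P (al x).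
pose F : set_system C := [set A | exists n, [set z : C | circle z /\ sval (Mseq n) (tsc z e)] `<=` A].
have ne n : exists2 z, circle z & sval (Mseq n) (tsc z e).
  have [_ cM] := svalP (Mseq n); have [t Mt tx] := cM _ Ux.
  by have [z cz tE] := tgp_eq (etrans sx (esym tx)); exists z; rewrite -?tE.
have FF : ProperFilter F.
  apply: Build_ProperFilter_ex.
    by move=> A [n nA]; have [z cz Mz] := ne n; exists z; apply: nA.
  split.
  - by exists 0%N.
  - move=> A B [m mA] [n nB]; exists (maxn m n) => z [cz Mz]; split.
      by apply: mA; split=> //; apply: (Mseq_le (leq_maxl m n)).
    by apply: nB; split=> //; apply: (Mseq_le (leq_maxr m n)).
  - by move=> A B AB [n nA]; exists n => z /nA /AB.
have Fc : F (@circle R) by exists 0%N => z [].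
have [z [cz clz]] := @circle_compact R F FF Fc.
exists (tsc z e); split; first by rewrite tgp_tsc.
move=> n A /(tsc_nbhs cz) [W [B [nW nB WB]]].
have Fn : F [set z : C | circle z /\ sval (Mseq n) (tsc z e)] by exists n.
have [w [[cw Mw] Ww]] := clz _ W Fn nW.
exists (tsc w e); split=> //; last by rewrite tgp_tsc.
by apply: WB => //; exact: nbhs_singleton.
Qed.

Lemma lift_section : exists sg : X -> S,
  {within U, continuous sg} /\ forall x, U x -> tgp (sg x) = al x.
Proof.
pose sg x := if pselect (U x) is left Ux then sval (cid (adherent_ex Ux)) else gu x.
have sgP x : U x -> adherent x (sg x).
  by move=> Ux; rewrite /sg; case: pselect => // Ux'; case: cid.
exists sg; split; last by move=> x /sgP [].
apply/within_contP => x Ux A; have [sx adx] := sgP x Ux.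
rewrite -{1}(tsc_1 (sg x)) => /(tsc_nbhs (circle1 R)) [W [B [nW nB WB]]].
have [n0 nW'] := nbhs1_ball nW.
(* Two errors of 1/(n+1) will be added, and their sum must stay below 1/(n0+1). *)
pose n := (n0.+1.*2)%N.
have [m [Bm Mm mx]] := adx n.+1 _ (nbhs_interior nB).
have [oM _] := svalP (Mseq n.+1).
have oN : open (sval (Mseq n.+1) `&` B°) by apply: openI => //; exact: open_interior.
have := al_near Ux oN (ex_intro2 _ _ m (conj Mm Bm) mx).
apply: filterS => y [v [Mv Bv] vy] Uy.
have [sy ady] := sgP y Uy.
have [z cz zE] := tgp_eq (etrans vy (esym sy)).
rewrite zE; apply: WB => //; last exact: interior_subset.
apply: nW' => /=.
(* Here [v] lies over [al y] in the small open set and near [sg x], while [t] is in the same small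
   set and close to [sg y]. The ratio [z] of [sg y] to [v] is close to the ratio [w] of [t] to [v],
   which smallness keeps close to 1. *)
have [B1 [B2 [n1 n2 B12]]] := div_nbhs v cz (ball_nbhs1 z n).
rewrite -zE in n2; have [t [Bt Mt ty]] := ady n.+1 _ n2.
have [w cw wE] := tgp_eq (etrans vy (esym ty)).
have wz : `|w - z| < n.+1%:R^-1.
  by apply: (B12 v) => //; [exact: nbhs_singleton|rewrite -wE].
have w1 : `|w - 1| < n.+1%:R^-1.
  by have [_ sm] := MseqS n; apply: (sm v) => //; rewrite -wE.
rewrite (_ : z - 1 = (w - 1) - (w - z)); last by ring.
apply: le_lt_trans (ler_normB _ _) _.
apply: (lt_le_trans (ltrD w1 wz)).
have k0 : (0 : C) < n0.+1%:R by rewrite ltr0n.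
have : (n.+1%:R^-1 : C) <= (n0.+1%:R *+ 2)^-1.
  by rewrite lef_pV2 ?posrE ?ltr0n// -?mulrnA ?ltr0n// ler_nat muln2.
move=> h; apply: (le_trans (lerD h h)).
rewrite -[_ *+ 2]mulr_natr invfM -mulrDr (_ : 2^-1 + 2^-1 = 1) ?mulr1//.
by field.
Qed.
End Lift.

End TwistedGroupoid.

(** * The twisted ample semigroup *)

Section BisTbis.
Variables (R : realType) (D : tgpd R).
Local Notation X := (tgX D).
Local Notation G := (tgG D).
Local Notation S := (tgS D).
Local Notation C := (C R).
Let P := tgpdP D.
Let bG := tgpdG P.
Let hG : topological_groupoid G := bgpd_gpd bG.
Let hS : topological_groupoid S := tgpdS P.
Let bX : boolean_space X := bgpd_X bG.
Let HX := bs_hausdorff bX.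
Let iS := bis_inverse_semigroup hS bX.
Let bbG := bis_boolean hG bX.
Implicit Types (s t : S) (x y : X) (z w : C).
Local Notation p := (@tgp _ D).
Local Notation dualG := (dual (bis_sg G)).
Local Notation chr := (chr hG bX).
Local Notation pt := (pt hG bX).

Lemma dual_copen (V : set dualG) : copen V <-> exists2 U, copen U & V = ideal_open (ubis G U).
Proof.
split.
  move=> /(copen_ideal_open bbG) [E /(bis_idemE hG bX) [U cU ->] ->].
  by exists U.
by move=> [U cU ->]; apply: ideal_open_copen => //; exact: ubis_idem.
Qed.

Lemma TX_chr h : is_TX h -> is_TX (h \o chr : X -> C).
Proof.
apply: TX_comp; first exact: chr_continuous.
by move=> _ /dual_copen [U cU ->]; rewrite chr_ideal//; case: cU.
Qed.

Lemma TX_pt (f : X -> C) : is_TX f -> is_TX (f \o pt).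
Proof.
apply: TX_comp; first exact: pt_continuous.
move=> U cU; rewrite pt_ideal//.
by apply: ideal_open_compact => //; exact: ubis_idem.
Qed.

Lemma section_p (A : set S) : is_section A -> is_section (p @` A).
Proof.
move=> [U [sg [cU csg dsg ->]]]; exists U, (fun x => p (sg x)); split=> //.
- exact: within_cont_postcomp (tgpd_cont P) csg.
- by move=> x Ux; rewrite (tgpd_d P) dsg.
- by rewrite image_comp.
Qed.

Lemma inv_p (A : set S) : @gi X G @` (p @` A) = p @` (@gi X S @` A).
Proof.
rewrite !image_comp; apply: eq_imagel => s _ /=.
by rewrite tgp_i.
Qed.

Lemma bisection_p (A : set S) : is_bisection A -> is_bisection (p @` A).
Proof.
move=> /(bisectionP hS) [sA sA']; apply/(bisectionP hG).
by rewrite inv_p; split; exact: section_p.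
Qed.

(** The range of an element of [A] is that of its image, so the section for the inverse of [A] is
    obtained from the one in G by lifting back through [sg]. *)
Lemma section_bisection (A : set S) :
  is_section A -> is_bisection (p @` A) -> is_bisection A.
Proof.
move=> sA bA; apply/(bisectionP hS); split=> //.
have [U [sg [cU csg dsg AE]]] := sA.
have /(bisectionP hG) [_ [V [be [cV cbe dbe IE]]]] := bA.
have key y : V y -> U (gr (be y)) /\ p (sg (gr (be y))) = gi (be y).
  move=> Vy; have : (@gi X G @` (p @` A)) (be y) by rewrite IE; exists y.
  rewrite AE => -[_ [_ [x Ux <-] <-] <-].
  by rewrite (gr_i hG) (tgpd_d P) dsg// (giK hG).
exists V, (fun y => gi (sg (gr (be y)))); split=> //.
- apply: (within_cont_postcomp (gi_cont hS)).
  apply: (Defs.within_continuous_comp (T := U) (f := fun y => gr (be y)) (g := sg)) => //.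
    by move=> y /key [].
  exact: within_cont_postcomp (gr_cont hG) cbe.
- move=> y Vy; have [Uy py] := key y Vy.
  by rewrite (gd_i hS) -(tgpd_r P) py (gr_i hG) dbe.
- rewrite AE; apply/seteqP; split=> k.
    move=> [_ [x Ux <-] <-].
    have : (@gi X G @` (p @` A)) (gi (p (sg x))).
      by exists (p (sg x)) => //; exists (sg x) => //; rewrite AE; exists x.
    rewrite IE => -[y Vy yE]; exists y => //.
    by rewrite yE (gr_i hG) (tgpd_d P) dsg.
  by move=> [y Vy <-]; have [Uy _] := key y Vy; exists (sg (gr (be y))) => //; exists (gr (be y)).
Qed.

Lemma bisection_lift (B : set G) : is_bisection B ->
  exists2 A : set S, is_bisection A & p @` A = B.
Proof.
move=> bB; have /(bisectionP hG) [[U [al [cU cal dal BE]]] _] := bB.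
have [sg [csg psg]] := lift_section cU cal dal.
have pE : p @` (sg @` U) = B.
  by rewrite BE image_comp; apply: eq_imagel => x /psg.
exists (sg @` U) => //; apply: section_bisection; last by rewrite pE.
by exists U, sg; split=> // x Ux; rewrite -(tgpd_d P) psg// dal.
Qed.

Definition graph (f : X -> C) : set S := [set tgi x (f x) | x in [set x | f x != 0]].

Lemma bis_i_setE h : bis_i_set h = graph (h \o chr).
Proof.
apply/seteqP; split=> s.
  move=> [x [c [cx h0 ->]]]; have <- : chr x = c by apply: point_eq cx; exact: chrP.
  by exists x => //=; have -> : chr x = c by apply: point_eq cx; exact: chrP.
by move=> [x h0 <-]; exists x, (chr x); split=> //; exact: chrP.
Qed.

Lemma p_graph f : is_TX f -> p @` graph f = gu @` [set x | f x != 0].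
Proof.
move=> fT; apply/seteqP; split=> k.
  by move=> [_ [x f0 <-] <-]; exists x => //; rewrite tgp_tgi//; exact: (TX_circle fT).
move=> [x f0 <-]; exists (tgi x (f x)); first by exists x.
by rewrite tgp_tgi//; exact: (TX_circle fT).
Qed.

Lemma bisection_graph f : is_TX f -> is_bisection (graph f).
Proof.
move=> fT; apply: section_bisection; last first.
  by rewrite p_graph//; apply: bisection_units => //; exact: TX_copen.
exists [set x | f x != 0], (fun x => tgi x (f x)); split=> //; first exact: TX_copen.
- apply: (Defs.within_continuous_comp (T := @XT R X) (f := fun x => (x, f x))
     (g := fun u => tgi u.1 u.2 : S)).
  + by move=> x f0; exact: (TX_circle fT).
  + apply: Defs.within_continuous_pair; last by case: fT.
    by apply: continuous_subspaceT => x; exact: cvg_id.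
  + by have [] := tgpd_ihomeo P.
- by move=> x f0; rewrite (tgpd_di P)//; exact: (TX_circle fT).
Qed.

Lemma sval_tbp (A : bis_sg S) : sval (tbp (A : tbS (bis_tbis D))) = p @` sval A.
Proof. by apply: to_bisE; apply: bisection_p; exact: svalP. Qed.

Lemma sval_tbi h : is_TX h -> sval (tbi h : tbS (bis_tbis D)) = graph (h \o chr).
Proof.
move=> hT; rewrite /= bis_i_setE; apply: to_bisE.
exact/bisection_graph/TX_chr.
Qed.

Lemma p_set_gm (A B : set S) : p @` set_gm A B = set_gm (p @` A) (p @` B).
Proof.
apply/seteqP; split=> k.
  move=> [_ [a [b [Aa Bb ab ->]]] <-]; exists (p a), (p b).
  by split; [exists a|exists b|rewrite (tgpd_d P) (tgpd_r P)|rewrite (tgpd_pM P)].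
move=> [_ [_ [[a Aa <-] [b Bb <-]]]]; rewrite (tgpd_d P) (tgpd_r P) => ab ->.
by exists (gm a b); [exists a, b|rewrite (tgpd_pM P)].
Qed.

Lemma p_units (U : set X) : p @` (gu @` U) = gu @` U.
Proof.
rewrite image_comp; apply: eq_imagel => x _ /=; exact: tgp_u.
Qed.

Lemma tbp_ubis U : copen U -> tbp (ubis S U : tbS (bis_tbis D)) = ubis G U.
Proof.
by move=> cU; apply: bis_eq; rewrite sval_tbp !sval_ubis// p_units.
Qed.

Lemma graphM f k : is_TX f -> is_TX k ->
  graph (fun x => f x * k x) = set_gm (graph f) (graph k).
Proof.
move=> fT kT; apply/seteqP; split=> s.
  move=> [x]; rewrite /= mulf_eq0 negb_or => /andP[f0 k0] <-.
  have cf := TX_circle fT f0; have ck := TX_circle kT k0.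
  exists (tgi x (f x)), (tgi x (k x)).
  split; [by exists x|by exists x|by rewrite (tgpd_di P)// (tgpd_ri P)|exact: (tgpd_iM P)].
move=> [_ [_ [[x f0 <-] [y k0 <-]]]]; have cf := TX_circle fT f0; have ck := TX_circle kT k0.
rewrite (tgpd_di P)// (tgpd_ri P)// => xy ->; subst y.
by exists x; [exact: mulf_neq0|rewrite (tgpd_iM P)].
Qed.

Lemma graph_inj f k : is_TX f -> is_TX k -> graph f = graph k -> f = k.
Proof.
move=> fT kT e; have key f' k' x : is_TX f' -> is_TX k' -> graph f' = graph k' ->
    f' x != 0 -> f' x = k' x.
  move=> {}fT {}kT {}e f0; have : graph f' (tgi x (f' x)) by exists x.
  rewrite e => -[y k0 /(tgi_inj (TX_circle kT k0) (TX_circle fT f0)) [xy <-]].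
  by rewrite xy.
apply/funext => x; have [f0|f0] := eqVneq (f x) 0; last exact: key.
by have [k0|k0] := eqVneq (k x) 0; [rewrite f0 k0|rewrite -(key _ _ _ kT fT)].
Qed.

(** An element over a unit is a scalar at that unit, and the continuous inverse of X x T -> Sigma on
    its image reads this scalar off the section. *)
Lemma bis_unitsE (A : set S) : is_bisection A -> (forall s, A s -> p s = gu (gr s)) ->
  exists2 f : X -> C, is_TX f & A = graph f.
Proof.
move=> bA pA; have /(bisectionP hS) [[U [sg [cU csg dsg AE]]] _] := bA.
have [_ [g gK cg]] := tgpd_ihomeo P.
have key x : U x -> exists2 z, circle z & sg x = tgi x z.
  move=> Ux; have As : A (sg x) by rewrite AE; exists x.
  have := pA _ As; move=> /(tgpd_ker P) [z cz e]; exists z => //.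
  have := dsg x Ux; rewrite e (tgpd_di P)// => rx; by move: e; rewrite rx.
have gE x z : circle z -> g (tgi x z) = (x, z) by move=> cz; exact: (gK (x, z) cz).
pose f := restrict0 U (fun x => (g (sg x)).2).
have fE x z : U x -> circle z -> sg x = tgi x z -> f x = z.
  by move=> Ux cz e; rewrite /f /restrict0; case: asboolP => // _; rewrite e gE.
have fT : is_TX f.
  apply: TX_restrict0 => //.
    by move=> x Ux; have [z cz ->] := key x Ux; rewrite gE.
  apply: (Defs.within_continuous_comp (T := [set: X * C]) (f := fun x => g (sg x)) (g := snd)) => //.
    apply: (Defs.within_continuous_comp (T := (fun u => tgi u.1 u.2 : S) @` @XT R X) (f := sg) (g := g)) => //.
    by move=> x /key [z cz ->]; exists (x, z).
  by apply: continuous_subspaceT => u; exact: cvg_snd.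
exists f => //; rewrite AE; apply/seteqP; split=> s.
  move=> [x Ux <-]; have [z cz e] := key x Ux; exists x => /=.
    by rewrite (fE x z)//; exact: circle_neq0.
  by rewrite (fE x z).
move=> [x]; rewrite /=; have [Ux|Ux] := pselect (U x).
  by have [z cz e] := key x Ux; rewrite (fE x z)// => _ <-; exists x.
by rewrite /f /restrict0; case: asboolP => // _; rewrite eqxx.
Qed.

Lemma bis_is_tbis : is_tbis (bis_tbis D).
Proof.
split.
- exact: bbG.
- exact: iS.
- by move=> A B; apply: bis_eq; rewrite sval_mul// !sval_tbp sval_mul// p_set_gm.
- move=> B; have [A bA pA] := bisection_lift (svalP B).
  by exists (exist _ A bA); apply: bis_eq; rewrite sval_tbp.
- move=> e f /(bis_idemE hS bX) [U cU ->] /(bis_idemE hS bX) [V cV ->].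
  rewrite !tbp_ubis// => /(congr1 sval); rewrite !sval_ubis// => /(units_inj hG) UV.
  by rewrite UV.
- move=> h k hT kT; apply: bis_eq; rewrite sval_mul// !sval_tbi//.
    by rewrite -graphM//; exact: TX_chr.
  by apply: TX_M => //; exact: dual_hausdorff.
- move=> h k hT kT /(congr1 sval); rewrite !sval_tbi// => /(graph_inj (TX_chr hT) (TX_chr kT)) e.
  by apply/funext => c; rewrite -(ptK hG bX c); exact: (congr1 (@^~ (pt c)) e).
- move=> A; split.
    move=> /(bis_idemP hG bX) h.
    have [|f fT AE] := bis_unitsE (svalP A).
      move=> s As; have pAs : sval (tbp A : bis_sg G) (p s) by rewrite sval_tbp; exists s.
      have e := h _ pAs; rewrite -(tgpd_r P) [in RHS]e (gr_u hG); exact: e.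
    exists (f \o pt); first exact: TX_pt.
    apply: bis_eq; rewrite sval_tbi; last exact: TX_pt.
    rewrite AE; congr graph; apply/funext => x /=.
    by rewrite chrK.
  move=> [h hT <-]; apply/(bis_idemP hG bX) => a; rewrite sval_tbp sval_tbi// p_graph; last exact: TX_chr.
  by move=> [x _ <-]; rewrite (gd_u hG).
- move=> E /(bis_idemE hG bX) [U cU ->].
  have hT : is_TX (indicator R (ideal_open (ubis G U))).
    by apply: TX_indicator; apply/dual_copen; exists U.
  apply: bis_eq; rewrite sval_tbp sval_tbi// p_graph; last exact: TX_chr.
  rewrite sval_ubis//; congr image; apply/seteqP; split=> x /=.
    rewrite indicatorE /restrict0; case: asboolP; last by rewrite eqxx.
    by rewrite /ideal_open /= (is_pointE hG bX (chrP _ _ _) cU).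
  move=> Ux; rewrite /indicator mem_set ?oner_neq0//.
  by rewrite /ideal_open /= (is_pointE hG bX (chrP _ _ _) cU).
- move=> A h hT.
  have pT : is_TX (push (tbp (A : tbS (bis_tbis D))) h) by exact: (push_TX bbG).
  have hcT := TX_chr hT.
  have pushE a : sval A a -> push (tbp (A : tbS (bis_tbis D))) h (chr (gr a)) = h (chr (gd a)).
    move=> Aa; rewrite /push.
    have Ap : sval (tbp (A : tbS (bis_tbis D))) (p a) by rewrite sval_tbp; exists a.
    have Ap' : sval (tbp (A : tbS (bis_tbis D)))^-* (gi (p a)) by rewrite sval_star//; exists (p a).
    have := bis_phi hG bX Ap'; rewrite (gd_i hG) (gr_i hG) (tgpd_d P) (tgpd_r P) => ->.
    case: asboolP => // -[]; rewrite -(isg_dom_star bbG); apply/bis_dom.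
    by exists (gi (p a)) => //; rewrite (gd_i hG) (tgpd_r P).
  apply: bis_eq; rewrite !sval_mul// sval_star// !sval_tbi//.
  (* Covariance is centrality of the circle: conjugating a scalar by [a] gives the same scalar,
     placed at the range of [a]. *)
  have step a : sval A a -> h (chr (gd a)) != 0 ->
      gm (gm a (tgi (gd a) (h (chr (gd a))))) (gi a) = tgi (gr a) (h (chr (gd a))) :> S.
    move=> Aa h0; have cz := TX_circle hT h0.
    by rewrite -(tgpd_central P)// tsc_gml ?(gr_i hS)// (gmgV hS) tgi_tsc.
  apply/seteqP; split=> k.
    move=> [_ [_ [[a [_ [Aa [x h0 <-] ax ->]]] [b Ab <-] axb ->]]].
    have cz := TX_circle hT h0.
    rewrite (tgpd_ri P)// in ax; subst x.
    rewrite (gr_i hS) (gd_m hS) ?(tgpd_di P) ?(tgpd_ri P)// in axb.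
    have ab : a = b by apply: (bisection_injd hS (svalP A)).
    subst b; rewrite step//; exists (gr a); rewrite /= pushE//.
  move=> [x h0 <-].
  have : isg_ran (tbp (A : tbS (bis_tbis D))) (chr x).
    by move: h0; rewrite /= /push; case: asboolP => //; rewrite eqxx.
  rewrite -(isg_dom_star bbG) => /(bis_dom hG bX) [g]; rewrite sval_star// sval_tbp.
  move=> [_ [a Aa <-] <-]; rewrite (gd_i hG) (tgpd_r P) => ax; subst x.
  rewrite /= pushE// in h0 *.
  rewrite -step//; exists (gm a (tgi (gd a) (h (chr (gd a))))), (gi a).
  have cz := TX_circle hT h0.
  split; [|by exists a|by rewrite (gr_i hS) (gd_m hS) ?(tgpd_di P) ?(tgpd_ri P)|by []].
  by exists a, (tgi (gd a) (h (chr (gd a)))); split; [by []|by exists (gd a)|by rewrite (tgpd_ri P)|by []].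
Qed.

Lemma bis_tbis_formulasP : bis_tbis_formulas D.
Proof.
split.
- by split; exact: bis_formulasP.
- exact: point_exists.
- move=> c; exists (pt c); split; first exact: ptP.
  by move=> x; apply: point_uniq => //; exact: ptP.
- exact: sval_tbp.
- by move=> h hT; rewrite sval_tbi// bis_i_setE.
Qed.

End BisTbis.

(** * Functoriality of bisections *)

Section BisArrow.
Variables (R : realType) (D D' : tgpd R) (f : tgpd_arrow D D').
Local Notation X := (tgX D).
Local Notation X' := (tgX D').
Local Notation C := (C R).
Let P := tgpdP D.
Let P' := tgpdP D'.
Let hG : topological_groupoid (tgG D) := bgpd_gpd (tgpdG P).
Let hS : topological_groupoid (tgS D) := tgpdS P.
Let bX : boolean_space X := bgpd_X (tgpdG P).
Let HX := bs_hausdorff bX.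
Let hG' : topological_groupoid (tgG D') := bgpd_gpd (tgpdG P').
Let hS' : topological_groupoid (tgS D') := tgpdS P'.
Let bX' : boolean_space X' := bgpd_X (tgpdG P').
Let F := tgaP f.
Implicit Types (l m : tgS D) (s t : tgS D') (x y : X').
Local Notation rho := (anchor0 f).
Local Notation dS := (bis_tbis D).

Lemma anchor_r s : tanc f s = rho (gr s).
Proof. exact: tgpd_anchorE. Qed.

Lemma anchor_tsc z s : circle z -> tanc f (tsc z s) = tanc f s.
Proof. by move=> cz; rewrite !anchor_r tsc_r. Qed.

Lemma anchor0_continuous : continuous rho.
Proof.
move=> x; apply: (@continuous_comp _ _ _ (gu : X' -> tgS D') (tanc f)).
  exact: (gu_cont hS').
exact: (tga_anc_cont F).
Qed.

Lemma tact_tsc_r z l s : circle z -> gd l = tanc f s ->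
  tact f l (tsc z s) = tsc z (tact f l s).
Proof.
move=> cz ls; rewrite /tsc (tgpd_central P')// (tga_mult F)//; last by rewrite (tgpd_ri P').
by rewrite (tgpd_central P')// (tga_d F).
Qed.

(** Other lifts differ by scalars; equivariance moves these outside the action, and [tgp] forgets
    them. *)
Lemma quotient_actE l s : gd l = tanc f s ->
  quotient_act f (tgp l) (tgp s) = tgp (tact f l s).
Proof.
move=> ls; rewrite /quotient_act; apply: xget_unique; first by exists l, s.
move=> _ [l' [s' [/esym/tgp_eq [z cz lE] /esym/tgp_eq [w cw sE] ls' ->]]]; subst l' s'.
rewrite (tga_equi F)//; last by rewrite anchor_tsc.
rewrite tsc_tsc// tact_tsc_r//; last exact: circleM.
by rewrite tgp_tsc//; exact: circleM.
Qed.

Lemma tact_u_d l x : gd l = rho x -> gd (tact f l (gu x)) = x.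
Proof. by move=> lx; rewrite (tga_d F)// (gd_u hS'). Qed.

Lemma tact_u_r l x : gd l = rho x -> rho (gr (tact f l (gu x))) = gr l.
Proof. by move=> lx; rewrite -anchor_r (tga_anc F). Qed.

Lemma tact_uu x : tact f (gu (rho x)) (gu x) = gu x.
Proof. exact: (tga_1 F (gu x)). Qed.

(* The action is by left multipliers, so it is determined by the l x. *)
Lemma tact_gm l s : gd l = tanc f s -> tact f l s = gm (tact f l (gu (gr s))) s.
Proof.
move=> ls; rewrite -(tga_mult F) ?(gd_u hS')// ?(gm1g hS')//.
by rewrite -/(rho _) -anchor_r.
Qed.

(** The cocycle identity of the elements l x; it makes the map on bisections multiplicative. *)
Lemma tact_u_gm l m x : gd l = gr m -> gd m = rho x ->
  gm (tact f l (gu (gr (tact f m (gu x))))) (tact f m (gu x)) = tact f (gm l m) (gu x).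
Proof.
move=> lm mx; rewrite (tga_M F)// -tact_gm//.
by rewrite anchor_r tact_u_r.
Qed.

Lemma tact_u_gi l x : gd l = rho x ->
  tact f (gi l) (gu (gr (tact f l (gu x)))) = gi (tact f l (gu x)).
Proof.
move=> lx; apply: (gi_uniq hS').
  by rewrite tact_u_d// (gd_i hS) tact_u_r.
by rewrite tact_u_gm ?(gd_i hS)// (gmVg hS) lx tact_uu tact_u_d.
Qed.

Lemma rho_copen (U : set X) : copen U -> copen (rho @^-1` U).
Proof.
move=> [cU oU]; split; first exact: (tga_proper F).
by move/continuousP: anchor0_continuous; exact.
Qed.

Lemma section_j1 (A : set (tgS D)) : is_section A -> is_section (bis_j1_set f A).
Proof.
move=> [U [sg [cU csg dsg ->]]].
exists (rho @^-1` U), (fun x => tact f (sg (rho x)) (gu x)); split.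
- exact: rho_copen.
- apply: (Defs.within_continuous_comp (T := [set z : tgS D * tgS D' | gd z.1 = tanc f z.2])
    (f := fun x => (sg (rho x), gu x : tgS D')) (g := fun z => tact f z.1 z.2)).
  + by move=> x Ux /=; rewrite dsg.
  + apply: Defs.within_continuous_pair.
      apply: (Defs.within_continuous_comp (T := U) (f := rho) (g := sg)) => //.
      by apply: continuous_subspaceT; exact: anchor0_continuous.
    by apply: continuous_subspaceT; exact: (gu_cont hS').
  + exact: (tga_act_cont F).
- by move=> x Ux; rewrite tact_u_d// dsg.
- apply/seteqP; split=> k.
    move=> [_ [x [[y Uy <-]]]]; rewrite dsg// => xy ->.
    by exists x; rewrite /= xy.
  by move=> [x Ux <-]; exists (sg (rho x)), x; split; [exists (rho x)|rewrite dsg|].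
Qed.

Lemma inv_j1 (A : set (tgS D)) :
  @gi X' (tgS D') @` bis_j1_set f A = bis_j1_set f (@gi X (tgS D) @` A).
Proof.
apply/seteqP; split=> k.
  move=> [_ [l [x [Al xl ->]]] <-]; exists (gi l), (gr (tact f l (gu x))).
  by split; [exists l|rewrite tact_u_r// (gd_i hS)|rewrite tact_u_gi].
move=> [_ [x [[l Al <-] xl ->]]]; rewrite (gd_i hS) in xl.
have lx : gd (gi l) = rho x by rewrite (gd_i hS).
exists (tact f l (gu (gr (tact f (gi l) (gu x))))).
  by exists l, (gr (tact f (gi l) (gu x))); split=> //; rewrite tact_u_r// (gr_i hS).
by have := tact_u_gi lx; rewrite (giK hS) => ->; rewrite (giK hS').
Qed.

Lemma bisection_j1 (A : set (tgS D)) : is_bisection A -> is_bisection (bis_j1_set f A).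
Proof.
move=> /(bisectionP hS) [sA sA']; apply/(bisectionP hS').
by rewrite inv_j1; split; exact: section_j1.
Qed.

Lemma j_set_p (A : set (tgS D)) :
  bis_j_set f (@tgp _ D @` A) = @tgp _ D' @` bis_j1_set f A.
Proof.
have qE l x : rho x = gd l -> quotient_act f (tgp l) (gu x) = tgp (tact f l (gu x)).
  by move=> xl; rewrite -(tgp_u x) quotient_actE.
apply/seteqP; split=> k.
  move=> [_ [x [[l Al <-]]]]; rewrite (tgpd_d P) => xl ->.
  by exists (tact f l (gu x)); [exists l, x|rewrite qE].
move=> [_ [l [x [Al xl ->]]] <-]; exists (tgp l), x.
by split; [exists l|rewrite (tgpd_d P)|rewrite qE].
Qed.

Lemma sval_j1 (A : tbS dS) : sval (tbj1 (bis_arrow f) A) = bis_j1_set f (sval A).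
Proof. by apply: to_bisE; apply: bisection_j1; exact: svalP. Qed.

(** A bisection of G is lifted to Sigma, transported there, and projected again. *)
Lemma sval_j (B : tbG dS) : sval (tbj (bis_arrow f) B) = bis_j_set f (sval B).
Proof.
apply: to_bisE; have [A bA <-] := bisection_lift (svalP B).
by rewrite j_set_p; apply: bisection_p; exact: bisection_j1.
Qed.

Lemma j_tbp (A : tbS dS) : tbj (bis_arrow f) (tbp A) = tbp (tbj1 (bis_arrow f) A).
Proof. by apply: bis_eq; rewrite sval_j !sval_tbp j_set_p sval_j1. Qed.

Lemma j1_set_gm (A B : set (tgS D)) :
  bis_j1_set f (set_gm A B) = set_gm (bis_j1_set f A) (bis_j1_set f B).
Proof.
apply/seteqP; split=> k.
  move=> [_ [x [[l [m [Al Bm lm ->]]] xlm ->]]]; rewrite (gd_m hS)// in xlm.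
  have mx := esym xlm.
  exists (tact f l (gu (gr (tact f m (gu x))))), (tact f m (gu x)); split.
  - by exists l, (gr (tact f m (gu x))); split=> //; rewrite tact_u_r.
  - by exists m, x.
  - by rewrite tact_u_d// tact_u_r.
  - by rewrite tact_u_gm.
move=> [_ [_ [[l [y [Al ly ->]]] [m [x [Bm mx ->]]]]]].
rewrite tact_u_d// => yE ->; subst y; rewrite tact_u_r// in ly.
by exists (gm l m), x; split; [exists l, m|rewrite (gd_m hS)|rewrite tact_u_gm].
Qed.

Lemma j1_units (U : set X) : bis_j1_set f (gu @` U) = gu @` (rho @^-1` U).
Proof.
apply/seteqP; split=> k.
  move=> [_ [x [[y Uy <-]]]]; rewrite (gd_u hS) => xy ->; exists x; first by rewrite /= xy.
  by rewrite -xy tact_uu.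
move=> [x Ux <-]; exists (gu (rho x)), x.
by split; [exists (rho x)|rewrite (gd_u hS)|rewrite tact_uu].
Qed.

Lemma j1_ubis U : copen U -> tbj1 (bis_arrow f) (ubis _ U) = ubis _ (rho @^-1` U).
Proof.
move=> cU; apply: bis_eq; rewrite sval_j1 !sval_ubis//; last exact: rho_copen.
exact: j1_units.
Qed.

Lemma j_ubis U : copen U -> tbj (bis_arrow f) (ubis _ U) = ubis _ (rho @^-1` U).
Proof.
move=> cU; rewrite -tbp_ubis// j_tbp j1_ubis// tbp_ubis//.
exact: rho_copen.
Qed.

Let tbp_surj (B : tbG dS) : exists A : tbS dS, tbp A = B.
Proof. exact: (tbis_surj (bis_is_tbis D)). Qed.

Lemma copen_cover (K : set X) : compact K -> exists2 U, copen U & K `<=` U.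
Proof.
apply: compact_ideal.
- exact: copen0.
- by move=> U V; exact: copenU.
- move=> x _; have [U [cU Ux _]] := boolean_space_copen bX (@filterT _ (nbhs x) _).
  by exists U => //; apply: open_nbhs_nbhs; split=> //; case: cU.
Qed.

(** Shared by G and Sigma, whose idempotent bisections are both the compact open subsets of the unit
    space. *)
Let boolean_of (K : gpd_data X) (K' : gpd_data X') (hK : topological_groupoid K)
  (hK' : topological_groupoid K') (j : bis_sg K -> bis_sg K') :
  (forall A B, j (A ** B) = j A ** j B) ->
  (forall U, copen U -> j (ubis K U) = ubis K' (rho @^-1` U)) -> boolean_morphism j.
Proof.
move=> jM jU; split=> //.
- by rewrite -(ubis0 hK) jU ?preimage_set0 ?(ubis0 hK')//; exact: copen0.
- move=> _ _ g /(bis_idemE hK bX) [U cU ->] /(bis_idemE hK bX) [V cV ->] jn.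
  have [/(bis_idemE hK bX) [W cW gE] _ _ _] := jn; subst g.
  move: jn => /(ubis_joinE hK bX cU cV cW) ->.
  have cUV := copenU cU cV.
  rewrite !jU// preimage_setU; apply: ubis_join => //; exact: rho_copen.
- move=> _ /(bis_idemE hK' bX') [V cV ->].
  (* Non-degeneracy: the image of [V] under the anchor is compact, so a compact open set contains
     it. *)
  have cK : compact (rho @` V).
    by apply: within_compact_image cV.1 _; apply: continuous_subspaceT; exact: anchor0_continuous.
  have [U cU VU] := copen_cover cK.
  exists (ubis K U); first exact: ubis_idem.
  rewrite jU//; apply/ubis_le => //; first exact: rho_copen.
  by move=> x Vx; apply: VU; exists x.
Qed.

Lemma j1M (A B : tbS dS) :
  tbj1 (bis_arrow f) (A ** B) = tbj1 (bis_arrow f) A ** tbj1 (bis_arrow f) B.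
Proof.
by apply: bis_eq; rewrite sval_mul// !sval_j1 sval_mul// j1_set_gm.
Qed.

Lemma bis_dual_map : is_dual_map (tbj (bis_arrow f)) (chr hG bX \o rho \o pt hG' bX').
Proof.
move=> c E /(bis_idemE hG bX) [U cU ->].
rewrite j_ubis//= (is_pointE hG bX (chrP _ _ _) cU).
by symmetry; exact: (is_pointE hG' bX' (ptP _ _ _) (rho_copen cU)).
Qed.

Lemma bis_is_tbis_arrow : is_tbis_arrow (bis_arrow f).
Proof.
split.
- apply: (boolean_of hG hG') => [A B|]; last exact: j_ubis.
  have [A' <-] := tbp_surj A; have [B' <-] := tbp_surj B.
  have pM := tbisM (bis_is_tbis D); have pM' := tbisM (bis_is_tbis D').
  by rewrite -pM !j_tbp j1M pM'.
- by apply: (boolean_of hS hS'); [exact: j1M|exact: j1_ubis].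
- by move=> A; rewrite j_tbp.
- exists (chr hG bX \o rho \o pt hG' bX') => [|h hT]; first exact: bis_dual_map.
  have fT : is_TX ((h \o chr hG bX) \o rho).
    apply: TX_comp (TX_chr hT); first exact: anchor0_continuous.
    by move=> U cU; case: (rho_copen cU).
  have kT := TX_pt fT; split=> //.
  apply: bis_eq; rewrite sval_j1 !sval_tbi//.
  rewrite (_ : _ \o chr hG' bX' = (h \o chr hG bX) \o rho); last first.
    by apply/funext => x /=; rewrite chrK.
  have hcT := TX_chr hT.
  have key x : h (chr hG bX (rho x)) != 0 ->
      tact f (tgi (rho x) (h (chr hG bX (rho x)))) (gu x) = tgi x (h (chr hG bX (rho x))).
    move=> h0; have cz := TX_circle hT h0.
    rewrite tgi_tsc// (tga_equi F) ?(gd_u hS)// tact_tsc_r ?(gd_u hS)// tact_uu.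
    by rewrite tgi_tsc.
  apply/seteqP; split=> k.
    move=> [_ [x [[y h0 <-]]]]; rewrite (tgpd_di P); last exact: (TX_circle hT).
    move=> xy ->; subst y.
    by rewrite key//; exists x.
  move=> [x h0 <-]; exists (tgi (rho x) (h (chr hG bX (rho x)))), x.
  split; [by exists (rho x)|by rewrite (tgpd_di P)//; exact: (TX_circle hT)|].
  by rewrite key.
Qed.

Lemma bis_arrow_formulasP : bis_arrow_formulas f.
Proof. by split; [exact: quotient_actE|exact: sval_j|exact: sval_j1]. Qed.
End BisArrow.

Lemma tbis_arrow_ext (R : realType) (D D' : tbis R) (f g : tbis_arrow D D') :
  (forall s, tbj1 f s = tbj1 g s) -> f = g.
Proof.
move=> fg; have fg1 : tbj1 f = tbj1 g by apply/funext.
apply: tbis_arrow_eq => //; apply/funext => b.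
have [s <-] := tbis_surj (tbisP D) b.
by rewrite -(tba_p (tbaP f)) -(tba_p (tbaP g)) fg1.
Qed.

Section BisFunctor.
Variable R : realType.
Local Notation F := (bis_functor (@bis_is_tbis R) (@bis_is_tbis_arrow R)).

Lemma bis_functorP : is_functor F.
Proof.
split.
- move=> D; have hS := tgpdS (tgpdP D).
  apply: tbis_arrow_ext => A; apply: bis_eq.
  rewrite [LHS](sval_j1 (idm D : tgpd_arrow D D)) /=; apply/seteqP; split=> k.
    move=> [l [x [Al]]]; rewrite /anchor0 /= (gr_u hS) => xl ->.
    by rewrite xl; case: asboolP => // _; rewrite (gmg1 hS).
  move=> Ak; exists k, (gd k); rewrite /anchor0 /= (gr_u hS); split=> //.
  by case: asboolP => // _; rewrite (gmg1 hS).
- move=> D1 D2 D3 g f; apply: tbis_arrow_ext => A; apply: bis_eq.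
  rewrite [LHS](sval_j1 (cmp g f : tgpd_arrow D1 D3)) [RHS](sval_j1 g) (sval_j1 f) /=.
  apply/seteqP; split=> k.
    move=> [l [x [Al xl ->]]]; exists (tact f l (gu (tanc g (gu x)))), x.
    split=> //; first by exists l, (tanc g (gu x)).
    by rewrite tact_u_d.
  move=> [_ [x [[l [y [Al yl ->]]]]]]; rewrite tact_u_d// => xy ->; subst y.
  by exists l, x.
Qed.
End BisFunctor.

(** The map s |-> {[s, x]} goes out of the given semigroup, opposite to the direction in the
    definition of an equivalence. *)
Lemma naturally_isomorphic_sym (A B : category) (F G : functor_data A B) :
  naturally_isomorphic G F -> naturally_isomorphic F G.
Proof.
move=> [th [iso nat]].
have inv a : {k : Defs.hom (F a) (G a) | cmp k (th a) = idm (G a) /\ cmp (th a) k = idm (F a)}.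
  by apply: cid; have [k ? ?] := iso a; exists k.
exists (fun a => sval (inv a)); split=> [a|a b f].
  by case: (inv a) => k /= [k1 k2]; exists (th a).
case: (inv a) => k /= [_ k2]; case: (inv b) => m /= [m1 _].
have := nat a b f => e.
rewrite -(cmpf1 (cmp m _)) -k2 -!cmpA (cmpA (fhom F f)) -e.
by rewrite !cmpA m1 cmp1f.
Qed.

(** * The semigroup as bisections of its germs *)

Section BooleanMorphism.
Variables (H G : sg_data) (j : H -> G).
Hypothesis (bj : boolean_morphism j).

(** Non-degeneracy is what makes the pull-back of a character non-zero. *)
Lemma boolean_morphism_dual : boolean_isg H -> exists rho : dual G -> dual H, is_dual_map j rho.
Proof.
move=> bH; have iH := bisg_isg bH.
have key (x : dual G) : exists y : dual H, forall e, idem e -> sval y e <-> sval x (j e).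
  pose y : set H := [set e | idem e /\ sval x (j e)].
  have by' : boolean_character y.
    split.
    - by move=> e [].
    - have [f xf] := char_neq0 (svalP x); have Ef := char_idem xf.
      have [e Ee [g Eg fE]] := bmor_nondeg bj Ef.
      exists e; split=> //; have Eje := boolean_morphism_idem bj Ee.
      by move: xf; rewrite fE charM// => -[].
    - by move=> [_]; rewrite (bmor0 bj) => /(char_0 (svalP x)).
    - move=> e f Ee Ef; rewrite /y /= (bmorM bj) charM; try exact: boolean_morphism_idem.
      by split=> [[_ [? ?]]|[[_ ?] [_ ?]]]; split=> //; exact: idemM.
    - move=> e f g Ee Ef jn; have [Eg _ _ _] := jn.
      have Eje := boolean_morphism_idem bj Ee; have Ejf := boolean_morphism_idem bj Ef.
      rewrite /y /= (char_join (svalP x) Eje Ejf (bmor_join bj Ee Ef jn)).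
      by split=> [[_ [?|?]]|[[_ ?]|[_ ?]]]; [left|right| |]; split=> //; [left|right].
  exists (exist _ y by') => e Ee; rewrite /= /y /=.
  by split=> [[]|].
by exists (fun x => sval (cid (key x))) => x e Ee; case: cid => y /= ->.
Qed.

Lemma boolean_morphism_inverse k : cancel j k -> cancel k j -> boolean_morphism k.
Proof.
move=> jk kj; have jI := can_inj jk; have kI := can_inj kj.
have kM s t : k (s ** t) = k s ** k t by apply: jI; rewrite (bmorM bj) !kj.
have idk e : idem e -> idem (k e) by rewrite /idem /= -kM => ->.
have lek s t : sg_le s t -> sg_le (k s) (k t).
  by move=> [e Ee ->]; exists (k e); [exact: idk|rewrite kM].
have lej s t : sg_le s t -> sg_le (j s) (j t).
  move=> [e Ee ->]; exists (j e); first exact: boolean_morphism_idem.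
  by rewrite (bmorM bj).
split=> //.
- by apply: jI; rewrite kj (bmor0 bj).
- move=> e f g Ee Ef [Eg eg fg gm]; split; [exact: idk|exact: lek|exact: lek|].
  move=> h Eh eh fh; rewrite -(jk h); apply: lek; apply: gm.
  + exact: boolean_morphism_idem.
  + by have := lej _ _ eh; rewrite kj.
  + by have := lej _ _ fh; rewrite kj.
- move=> e Ee; exists (j e); first exact: boolean_morphism_idem.
  by rewrite jk; exists e => //; rewrite Ee.
Qed.
End BooleanMorphism.

(** The inverse maps satisfy the condition on kernels because the dual map of the inverse of [tbj f]
    inverts the one of [tbj f]. *)
Lemma tbis_iso (R : realType) (D D' : TBIS R) (f : Defs.hom D D') :
  bijective (tbj (f : tbis_arrow D D')) -> bijective (tbj1 (f : tbis_arrow D D')) -> is_iso f.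
Proof.
move: f => /= f [k jk kj] [k1 jk1 kj1].
have F := tbaP f; have bG := tbisG (tbisP D); have bG' := tbisG (tbisP D').
have bk := boolean_morphism_inverse (tba_j F) jk kj.
have bk1 := boolean_morphism_inverse (tba_j1 F) jk1 kj1.
have kP : is_tbis_arrow (@TbisArrowData R D' D k k1).
  split=> //=; first by move=> s; apply: (can_inj jk); rewrite -(tba_p F) kj kj1.
  have [rho rhoE ker] := tba_ker F.
  have [rho' rhoE'] := boolean_morphism_dual bk bG'.
  have r1 : rho' \o rho = id.
    apply/funext => x; apply: dual_eq => e Ee /=.
    by rewrite rhoE'// rhoE ?kj//; exact: boolean_morphism_idem bk Ee.
  exists rho' => // h hT.
  have hT' : is_TX (h \o rho').
    apply: TX_comp hT; first exact: (dual_map_continuous bG' bG bk rhoE').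
    by move=> U [cU _]; exact: (dual_map_proper bG' bG bk rhoE').
  split=> //; apply: (can_inj jk1); rewrite kj1; have [_ ->] := ker _ hT'.
  by rewrite -compA r1.
exists (TbisArrow kP : tbis_arrow D' D).
  by apply: tbis_arrow_eq; apply/funext => s /=; rewrite ?jk ?jk1.
by apply: tbis_arrow_eq; apply/funext => s /=; rewrite ?kj ?kj1.
Qed.

Section BooleanJoin.
Variable G : sg_data.
Hypothesis bG : boolean_isg G.
Let iG := bisg_isg bG.
Let A := sgA iG.
Implicit Types s t u e : G.

Lemma orthogonal_mul s e1 e2 : idem e1 -> idem e2 -> e1 ** e2 = sg_zero ->
  Defs.orthogonal (s ** e1) (s ** e2).
Proof.
move=> E1 E2 e12; split; rewrite starM//.
  rewrite (idem_star iG E1) !A -(A e1) (idemC iG E1 (idem_d iG s)) -!A e12.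
  by rewrite !(sgs0 iG).
rewrite (idem_star iG E2) !A -(A s) e12 (sgs0 iG) (sg0s iG)//.
Qed.

(** If [e] lies above both domains, then [u ** e] is still an upper bound of [s] and [t], so [u]
    lies below it. *)
Lemma join_d s t u : is_join setT s t u ->
  is_join idem (s^-* ** s) (t^-* ** t) (u^-* ** u).
Proof.
move=> [_ su tu um]; split; [exact: idem_d|exact: sle_d|exact: sle_d|].
move=> e Ee se te.
have key v : sg_le v u -> sg_le (v^-* ** v) e -> sg_le v (u ** e).
  move=> /(sleP iG) vu /(sle_idem iG _ (idem_d iG v)) ve.
  exists (v^-* ** v); first exact: idem_d.
  by rewrite -A -ve.
have /(sle_d iG) := um (u ** e) I (key _ su se) (key _ tu te).
rewrite d_mulr// => h; apply: (sle_trans iG h).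
exact: (sle_mul_idem iG (idem_d iG u) Ee).2.
Qed.

(** [u] lies below [s ** e], and by distributivity both have the same domain. *)
Lemma join_restrict s e1 e2 e u : idem e1 -> idem e2 -> is_join idem e1 e2 e ->
  is_join setT (s ** e1) (s ** e2) u -> u = s ** e.
Proof.
move=> E1 E2 j ju; have [Ee e1e e2e _] := j.
have jd := join_d ju; rewrite !d_mulr// in jd.
have jd' := bool_distr (bisg_bool bG) (idem_d iG s) E1 E2 j.
have [_ _ _ um] := ju.
have /(sleP iG) -> : sg_le u (s ** e).
  by apply: um => //; apply: sle_mul => //; exact: sle_refl.
rewrite (join_uniq iG jd jd') (idemC iG (idem_d iG s) Ee) !A -(A s) Ee.
by rewrite -(A (s ** e)) -(A s) (idemC iG Ee (idem_d iG s)) !A (sg_starK iG).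
Qed.
End BooleanJoin.

Lemma inj_surj_bijective T T' (f : T -> T') :
  injective f -> (forall y, exists x, f x = y) -> bijective f.
Proof.
move=> fI fS; pose g y := sval (cid (fS y)).
have gK : cancel g f by move=> y; rewrite /g; case: cid.
by exists g => // x; apply: fI; rewrite gK.
Qed.

Section GermBis.
Variables (R : realType) (D : tbis R).
Local Notation G := (tbG D).
Local Notation S := (tbS D).
Local Notation X := (dual (tbG D)).
Local Notation C := (C R).
Let P := tbisP D.
Let bG : boolean_isg G := tbisG P.
Let iG : inverse_semigroup G := bisg_isg bG.
Let iS : inverse_semigroup S := tbisS P.
Let h1 := @scalar_group1 R.
Let hc := @scalar_group_circle R.
Implicit Types (s t : S) (x y : X) (g h : G).
Local Notation gS := (gtot [set 1]).
Local Notation gG := (gtot (@circle R)).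
Let Gam : tgpd R := Tgpd (germ_is_tgpd D).
Let hKG : topological_groupoid (tgG Gam) := bgpd_gpd (tgpdG (tgpdP Gam)).
Let hKS : topological_groupoid (tgS Gam) := tgpdS (tgpdP Gam).
Let bX : boolean_space X := bgpd_X (tgpdG (tgpdP Gam)).
Let HX := bs_hausdorff bX.
Let Bis : tbis R := Tbis (bis_is_tbis Gam).

Definition germ_setS s : set (tgS Gam) := gS s @` sdomain s.
Definition germ_setG s : set (tgG Gam) := gG s @` sdomain s.

Lemma germ_setG_p s : germ_setG s = @tgp _ Gam @` germ_setS s.
Proof.
rewrite /germ_setG /germ_setS image_comp; apply: eq_imagel => x sx /=.
by rewrite germ_pE.
Qed.

Lemma inv_germ_setS s : @gi X (tgS Gam) @` germ_setS s = germ_setS s^-*.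
Proof.
rewrite /germ_setS; apply/seteqP; split=> k.
  move=> [_ [x sx <-] <-]; exists (sphi s x); first exact: sdomain_star.
  by rewrite /= gtot_i.
move=> [x sx <-]; have := sdomain_star sx; rewrite starK// => sx'.
exists (gS s (sphi s^-* x)); first by exists (sphi s^-* x).
by rewrite /= gtot_i//; congr gtot; have := sphi_star sx; rewrite starK.
Qed.

Lemma section_germ_setS s : is_section (germ_setS s).
Proof.
exists (sdomain s), (gS s : X -> germS D); split=> //.
- exact: sdomain_copen.
- apply: within_cont_open => x sx A; rewrite nbhs_simpl /= => nA.
  move: nA; rewrite -(sc_1 (gS s x)) => /(germS_nbhs A sx (circle1 R)) [U [W [nU nW UA]]].
  apply: filterS2 nU (isg_dom_nbhs bG sx) => y Uy sy.
  by rewrite /= -(sc_1 (gS s y)); apply: UA => //; [exact: nbhs_singleton|exact: circle1].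
- by move=> x sx; exact: gtot_d.
Qed.

Lemma bisection_germ_setS s : is_bisection (germ_setS s).
Proof. by apply/(bisectionP hKS); rewrite inv_germ_setS; split; exact: section_germ_setS. Qed.

Lemma bisection_germ_setG s : is_bisection (germ_setG s).
Proof. by rewrite germ_setG_p; apply: bisection_p; exact: bisection_germ_setS. Qed.

Definition lift g : S := sval (cid (tbis_surj P g)).

Lemma liftP g : tbp (lift g) = g.
Proof. by rewrite /lift; case: cid. Qed.

Definition germ_bis1 s : tbS Bis := exist _ _ (bisection_germ_setS s).
(** Germs are written with elements of the twisted semigroup, so [g] is lifted to it; the resulting
    set does not depend on the lift. *)
Definition germ_bis g : tbG Bis := exist _ _ (bisection_germ_setG (lift g)).

Lemma gG_eq s t x : tbp s = tbp t -> sdomain s x -> gG s x = gG t x.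
Proof.
move=> st sx; have [c [cT tE cE]] := p_eq st.
have c0 : c x != 0 by apply/cE.
subst t; rewrite -!germ_pE//; last by apply/sdomain_ti.
by rewrite -sc_ti// p_sc.
Qed.

Lemma germ_setG_eq s t : tbp s = tbp t -> germ_setG s = germ_setG t.
Proof.
move=> st; rewrite /germ_setG; apply/seteqP; split=> k [x sx <-]; exists x.
- by move: sx; rewrite /sdomain st.
- exact/esym/gG_eq.
- by move: sx; rewrite /sdomain st.
- by apply: gG_eq => //; move: sx; rewrite /sdomain st.
Qed.

Lemma germ_bis_p s : tbp (germ_bis1 s) = germ_bis (tbp s).
Proof.
apply: bis_eq; rewrite [LHS]sval_tbp /= -germ_setG_p.
by apply: germ_setG_eq; rewrite liftP.
Qed.

Lemma germ_setS_mul s t : germ_setS (s ** t) = set_gm (germ_setS s) (germ_setS t).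
Proof.
apply/seteqP; split=> k.
  move=> [x /sdomain_mul [tx sx] <-]; exists (gS s (sphi t x)), (gS t x).
  split; [by exists (sphi t x)|by exists x|by rewrite /= gtot_d// gtot_r|by rewrite /= gtot_m].
move=> [_ [_ [[y sy <-] [x tx <-]]]] /=; rewrite gtot_d// gtot_r// => yx ->; subst y.
by exists x; [apply/sdomain_mul|rewrite gtot_m].
Qed.

Lemma germ_bis1M s t : germ_bis1 (s ** t) = germ_bis1 s ** germ_bis1 t.
Proof. by apply: bis_eq; rewrite [RHS]sval_mul//= germ_setS_mul. Qed.

Lemma germ_bisM g h : germ_bis (g ** h) = germ_bis g ** germ_bis h.
Proof.
by rewrite -{1}(liftP g) -{1}(liftP h) -(tbisM P) -germ_bis_p germ_bis1M (tbisM (tbisP Bis)) !germ_bis_p !liftP.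
Qed.

Lemma germ_bis1_idem (e : S) : idem e -> germ_bis1 e = ubis (tgS Gam) (sdomain e).
Proof.
move=> Ee; apply: bis_eq; rewrite [RHS]sval_ubis//=; last exact: sdomain_copen.
by apply: eq_imagel => x ex; exact: gtot_u.
Qed.

Lemma sdomain_ideal (e : S) : idem e -> sdomain e = ideal_open (tbp e).
Proof. by move=> Ee; apply/seteqP; split=> x; rewrite (sdomain_idem _ Ee). Qed.

Lemma germ_bis_idem (e : G) : idem e -> germ_bis e = ubis (tgG Gam) (ideal_open e).
Proof.
move=> Ee; rewrite -{1}(p_tunit Ee) -germ_bis_p germ_bis1_idem; last exact: tunit_idem.
rewrite tbp_ubis; last exact: sdomain_copen.
by rewrite sdomain_ideal ?p_tunit//; exact: tunit_idem.
Qed.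

Lemma tunit_le (e f : S) : idem e -> idem f -> sg_le e f <-> sg_le (tbp e) (tbp f).
Proof.
move=> Ee Ef; rewrite (sle_idem iS _ Ee) (sle_idem iG _ (p_idem Ee)) -(tbisM P).
split=> [<- //|h]; apply: (tbis_idem P) => //; exact: idemM.
Qed.

Lemma join_p (e f g : S) : idem e -> idem f -> is_join idem e f g ->
  is_join idem (tbp e) (tbp f) (tbp g).
Proof.
move=> Ee Ef [Eg eg fg gm]; split; [exact: p_idem|exact/tunit_le|exact/tunit_le|].
move=> k Ek; rewrite -(p_tunit Ek) => /(tunit_le Ee (tunit_idem Ek)) ek.
move=> /(tunit_le Ef (tunit_idem Ek)) fk.
by apply/tunit_le => //; [exact: tunit_idem|apply: gm => //; exact: tunit_idem].
Qed.

Lemma germ_bis1_ti (h : X -> C) : is_TX h -> germ_bis1 (tbi h) = @tbi _ Bis (h \o pt hKG bX).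
Proof.
move=> hT; have hT' : is_TX (h \o pt hKG bX) by exact: (@TX_pt _ Gam).
apply: bis_eq; rewrite [RHS](sval_tbi hT') /=.
rewrite (_ : _ \o _ = h); last by apply/funext => x /=; rewrite chrK.
have dE x : sdomain (tbi h : S) x <-> h x != 0.
  rewrite /sdomain isg_dom_idem//; last exact: p_ti_idem.
  by rewrite -[X in X <-> _]/(ideal_open _ x) p_ti.
have key x : h x != 0 -> gS (tbi h) x = germ_sc (germ_u [set 1] x) (h x).
  move=> h0; have ch := TX_circle hT h0; have [e [Ee ex ->]] := gtot_uP h1 x.
  have tx : sdomain (tbi h : S) x by apply/dE.
  rewrite (scE ex hT erefl ch) -(idem_tunit Ee) /tunit tiC//; last exact/TX_ideal/p_idem.
  by rewrite -/(tunit _) idem_tunit// gtot_mul_idem.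
apply/seteqP; split=> k [x hx <-]; exists x.
+ exact/dE.
+ by rewrite key//; apply/dE.
+ exact/dE.
+ exact: key.
Qed.

Lemma germ_bis_arrow : is_tbis_arrow (@TbisArrowData R D Bis germ_bis germ_bis1).
Proof.
split=> /=.
- split.
  + exact: germ_bisM.
  + rewrite germ_bis_idem; last exact: idem0.
    by rewrite ideal_open0; exact: ubis0.
  + move=> e f g Ee Ef j; have [Eg _ _ _] := j; rewrite !germ_bis_idem//.
    by rewrite (ideal_openU Ee Ef j); apply: ubis_join => //; exact: ideal_open_copen.
  + move=> _ /(bis_idemE hKG bX) [U cU ->].
    have [e Ee ->] := copen_ideal_open bG cU; exists e => //.
    by rewrite germ_bis_idem//; apply: sle_refl; exact: bis_inverse_semigroup.
- have E0 : idem (sg_zero : S) by exact: idem0.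
  have p0 : tbp (sg_zero : S) = sg_zero.
    have [z zE] := tbis_surj P sg_zero.
    by rewrite -(sg0s iS z) (tbisM P) zE (sgs0 iG).
  split.
  + exact: germ_bis1M.
  + rewrite germ_bis1_idem// sdomain_ideal// p0 ideal_open0; exact: ubis0.
  + move=> e f g Ee Ef j; have [Eg _ _ _] := j; rewrite !germ_bis1_idem// !sdomain_ideal//.
    rewrite (ideal_openU (p_idem Ee) (p_idem Ef) (join_p Ee Ef j)).
    by apply: ubis_join => //; apply: ideal_open_copen => //; exact: p_idem.
  + move=> _ /(bis_idemE hKS bX) [U cU ->].
    have [e Ee ->] := copen_ideal_open bG cU; exists (tunit e); first exact: tunit_idem.
    rewrite germ_bis1_idem ?sdomain_ideal ?p_tunit//; try exact: tunit_idem.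
    by apply: sle_refl; exact: bis_inverse_semigroup.
- exact: germ_bis_p.
- exists (pt hKG bX) => [c e Ee|h hT].
    by rewrite germ_bis_idem//; symmetry; apply: (is_pointE hKG bX (ptP _ _ _)); exact: ideal_open_copen.
  by split; [exact: (@TX_pt _ Gam)|exact: germ_bis1_ti].
Qed.

Lemma germ_set_dom s t : germ_setG s = germ_setG t -> sdomain s `<=` sdomain t.
Proof.
move=> st x sx; have : germ_setG s (gG s x) by exists x.
rewrite st => -[y ty e]; have := congr1 (@germ_d _ D _) e.
by rewrite !(gtot_d hc)// => <-.
Qed.

Lemma germ_setG_inj s t : germ_setG s = germ_setG t -> tbp s = tbp t.
Proof.
move=> st; have domE : isg_dom (tbp s) = isg_dom (tbp t).
  by apply/seteqP; split; exact: germ_set_dom.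
have ddE : (tbp s)^-* ** tbp s = (tbp t)^-* ** tbp t.
  by apply: (ideal_open_inj bG) => //; exact: idem_d.
pose Q (V : set X) := forall e, idem e -> V = ideal_open e -> tbp s ** e = tbp t ** e.
suff q : Q (isg_dom (tbp s)).
  by rewrite -(mul_d iG (tbp s)) (q _ (idem_d iG (tbp s)) erefl) ddE mul_d.
apply: (copen_ind HX (P := Q)).
- move=> e Ee e0; suff -> : e = sg_zero by rewrite !(sgs0 iG).
  by apply: (ideal_open_inj bG) => //; [exact: idem0|rewrite -e0 ideal_open0].
- move=> U V cU cV UV QU QV e Ee eE.
  have [e1 E1 U1] := copen_ideal_open bG cU; have [e2 E2 V2] := copen_ideal_open bG cV.
  have j : is_join idem e1 e2 e.
    have [k jk] := bool_join (bisg_bool bG) E1 E2; have [Ek _ _ _] := jk.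
    suff -> : e = k by [].
    by apply: (ideal_open_inj bG) => //; rewrite (ideal_openU E1 E2 jk) -eE U1 V2.
  have e12 : e1 ** e2 = sg_zero.
    apply: (ideal_open_inj bG); [exact: idemM|exact: idem0|].
    by rewrite ideal_openI// ideal_open0 -U1 -V2.
  (* The join of the two restrictions of [tbp s] is its restriction to [e]; the restrictions of
     [tbp t] are the same two elements, so they have the same join. *)
  have [u ju] := bisg_join bG (orthogonal_mul bG (tbp s) E1 E2 e12).
  rewrite -(join_restrict bG E1 E2 j ju).
  by rewrite (QU _ E1 U1) (QV _ E2 V2) in ju; exact: (join_restrict bG E1 E2 j ju).
- move=> x sx; have tx : sdomain t x by rewrite /sdomain -domE.
  have : germ_setG s (gG s x) by exists x.
  rewrite st => -[y ty e]; have := congr1 (@germ_d _ D _) e; rewrite !gtot_d// => xy; subst y.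
  have [k [a [Ek kx aT ca E]]] := germ_sim_local hc sx ((gtot_eq hc sx tx).1 (esym e)).
  have a0 : a x != 0 by exact: circle_neq0.
  have Ea := p_ti_idem aT; have Epk := p_idem Ek.
  (* The local equality has different idempotents on its two sides after [tbp]; below their product
     both restrict alike. *)
  exists (ideal_open (tbp k ** tbp (tbi a : S))).
    apply: char_nbhs => //; apply/charM => //; split; first by apply/sdomain_idem.
    by rewrite -[sval x _]/(ideal_open _ x) p_ti.
  move=> V cV VU _ e' Ee' VE; subst V.
  have /(sle_idem iG _ Ee') -> := ideal_open_le bG Ee' (idemM iG Epk Ea) VU.
  have := congr1 (@tbp _ D) E; rewrite !(tbisM P) => pE.
  have -> : tbp s ** (tbp k ** tbp (tbi a) ** e') = tbp s ** tbp k ** tbp (tbi a) ** e'.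
    by rewrite !(sgA iG).
  rewrite pE -(sgA iG (tbp t)) Ea (idemC iG Epk Ea) !(sgA iG).
  by rewrite -pE -(sgA iG (tbp s) (tbp k) (tbp k)) Epk.
- by move=> x _ U; exact: boolean_space_copen.
- exact: (sdomain_copen s).
Qed.

Lemma germ_bis_inj : injective germ_bis.
Proof. by move=> g h /(congr1 sval) /germ_setG_inj; rewrite !liftP. Qed.

Lemma sval_germ_bis s : sval (germ_bis (tbp s)) = germ_setG s.
Proof. by apply: germ_setG_eq; rewrite liftP. Qed.

Lemma germ_bis_surj (A : tbG Bis) : exists g, germ_bis g = A.
Proof.
have [[U [sg [cU csg dsg AE]]] _] := (bisectionP hKG _).1 (svalP A).
pose Q (V : set X) := V `<=` U -> exists s, sdomain s = V /\ forall x, V x -> gG s x = sg x.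
suff [s [sU sE]] : exists s, sdomain s = U /\ forall x, U x -> gG s x = sg x.
  exists (tbp s); apply: bis_eq.
  by rewrite sval_germ_bis AE /germ_setG sU; apply: eq_imagel => x; exact: sE.
suff : Q U by apply.
have oU := cU.2; apply: (copen_ind HX (P := Q)) cU => [|V1 V2 c1 c2 V12 Q1 Q2 VU|x Ux|].
- move=> _; exists (tunit sg_zero); rewrite sdomain_ideal ?p_tunit ?ideal_open0//; try exact: idem0.
  exact/tunit_idem/idem0.
- have [|s1 [d1 s1E]] := Q1; first by move=> x Vx; apply: VU; left.
  have [|s2 [d2 s2E]] := Q2; first by move=> x Vx; apply: VU; right.
  have dj a b : sval (germ_bis (tbp s1)) a -> sval (germ_bis (tbp s2)) b -> gd a <> gd b /\ gr a <> gr b.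
    rewrite !sval_germ_bis => -[x1 x1s <-] [x2 x2s <-].
    have n12 : x1 <> x2 by move=> x12; rewrite -[False]/(set0 x1) -V12; split; [rewrite -d1|rewrite x12 -d2].
    rewrite d1 in x1s; rewrite d2 in x2s; rewrite s1E// s2E//.
    have U1 : U x1 by apply: VU; left.
    have U2 : U x2 by apply: VU; right.
    split; first by rewrite !dsg.
    move=> r12; have e12 : sg x1 = sg x2.
      by apply: (bisection_injr hKG (svalP A)) => //; rewrite AE; [exists x1|exists x2].
    by apply: n12; rewrite -(dsg _ U1) e12 dsg.
  (* Orthogonality is visible on bisections, the ranges being disjoint because r is injective on
     [A]; injectivity of [germ_bis] brings it back to the semigroup. *)
  have o : Defs.orthogonal (tbp s1) (tbp s2).
    have [ o1 o2] := disjoint_orthogonal hKG bX dj.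
    have inj0 g : germ_bis g = sg_zero -> g = sg_zero.
      move=> g0; apply: germ_bis_inj; rewrite g0 germ_bis_idem; last exact: idem0.
      by rewrite ideal_open0 ubis0.
    have st g : germ_bis g^-* = (germ_bis g)^-*.
      by apply: morphism_star => //; [exact: bis_inverse_semigroup|exact: germ_bisM].
    by split; apply: inj0; rewrite germ_bisM st.
  have [u ju] := bisg_join bG o; have [s sE] := tbis_surj P u.
  have [_ u1 u2 _] := ju.
  have dE : sdomain s = V1 `|` V2.
    have := ideal_openU (idem_d iG _) (idem_d iG _) (join_d bG ju).
    by rewrite -d1 -d2 -sE => e; exact: e.
  exists s; split=> // x.
  have key s' : sg_le (tbp s') u -> sdomain s' x -> gG s' x = gG s x.
    move=> [e Ee]; rewrite -sE -(p_tunit Ee) -(tbisM P) => e1 sx.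
    have Et := tunit_idem Ee.
    rewrite (gG_eq e1 sx); have : sdomain (s ** tunit e) x by move: sx; rewrite /sdomain e1.
    move=> /sdomain_mul [ex]; rewrite sphi_idem// => sx'.
    exact: gtot_mul_idem.
  move=> [Vx|Vx].
    by rewrite -(key s1)// ?d1// s1E.
  by rewrite -(key s2)// ?d2// s2E.
- have [s [y [sy sE]]] := gGP (sg x).
  have xy : x = y by rewrite -(dsg x Ux) sE /= gtot_d.
  (* The germs of [s] form an open set, so [sg] stays in it near [x]; as both are sections of d,
     they agree there. *)
  subst y; have nP : nbhs (sg x) [set k : germG D | exists2 y, sdomain s y & k = gG s y].
    by rewrite sE; apply/germG_nbhs => //; exists setT; [exact: filterT|move=> y _ sy'; exists y].
  have nx := continuous_near (within_cont_at oU csg Ux) nP.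
  eexists; first exact: (filterI nx (open_nbhs_nbhs (conj oU Ux))).
  move=> V cV VN _ _; have [e Ee VE] := copen_ideal_open bG cV.
  have Et := tunit_idem Ee; have dt : sdomain (tunit e) = V by rewrite sdomain_ideal// p_tunit.
  have key y : V y -> sdomain s y /\ sg y = gG s y.
    move=> /VN [[y' sy' e'] Uy].
    have yy : y = y' by rewrite -(dsg y Uy) e' /= gtot_d.
    by subst y'.
  exists (s ** tunit e); split.
    apply/seteqP; split=> y; first by move=> /sdomain_mul []; rewrite dt.
    move=> Vy; apply/sdomain_mul; rewrite dt; split=> //.
    by rewrite sphi_idem ?dt//; have [] := key y Vy.
  by move=> y Vy; have [sy' ->] := key y Vy; apply: gtot_mul_idem => //; rewrite dt.
- by move=> x _ V; exact: boolean_space_copen.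
Qed.

(** Elements with the same germs have the same image, hence differ by a function [c]; the circle
    acts freely on germs, so [c] is 1 on the domain. *)
Lemma germ_bis1_inj : injective germ_bis1.
Proof.
move=> s t /(congr1 sval) /= st.
have pst : tbp s = tbp t by apply: germ_setG_inj; rewrite !germ_setG_p st.
have [c [cT tE cE]] := p_eq pst.
rewrite tE -[LHS](mul_d iS) tunit_d; congr (_ ** _); congr tbi.
apply/funext => x; have [c0|c0] := eqVneq (c x) 0.
  rewrite c0 /indicator memNset// => /cE.
  by rewrite c0 eqxx.
have sx : sdomain s x by apply/cE.
rewrite /indicator mem_set//.
have : germ_setS t (gS t x) by exists x => //; rewrite /sdomain -pst.
rewrite -st => -[y sy e]; have := congr1 (@germ_d _ D _) e; rewrite !gtot_d// => xy; subst y.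
move: e; rewrite tE -sc_ti// -{1}(sc_1 (gS s x)).
exact: (sc_inj (circle1 R) (TX_circle cT c0)).
Qed.

(** The image of [A] is reached first, and the remaining factor in T(X) comes from the kernel. *)
Lemma germ_bis1_surj (A : tbS Bis) : exists s, germ_bis1 s = A.
Proof.
have [g gE] := germ_bis_surj (tbp A); have [s sE] := tbis_surj P g.
have pE : tbp (germ_bis1 s) = tbp A by rewrite germ_bis_p sE.
have [c [cT AE _]] := @p_eq _ Bis _ _ pE.
have cT' : is_TX (c \o chr hKG bX) by exact: (@TX_chr _ Gam).
exists (s ** tbi (c \o chr hKG bX)); rewrite germ_bis1M AE; congr (_ ** _).
by rewrite germ_bis1_ti//; congr tbi; apply/funext => d /=; rewrite ptK.
Qed.

Definition germ_bis_hom : tbis_arrow D Bis := TbisArrow germ_bis_arrow.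

Lemma germ_bis_iso : is_iso (germ_bis_hom : Defs.hom (D : TBIS R) Bis).
Proof.
apply: tbis_iso.
  exact: inj_surj_bijective germ_bis_inj germ_bis_surj.
exact: inj_surj_bijective germ_bis1_inj germ_bis1_surj.
Qed.
End GermBis.

Section GermBisNatural.
Variables (R : realType).
Let F := germ_functor (@germ_is_tgpd R) (@germ_is_tgpd_arrow R).
Let K := bis_functor (@bis_is_tbis R) (@bis_is_tbis_arrow R).

Lemma germ_bis_natural : naturally_isomorphic (functor_comp K F) (functor_idm (TBIS R)).
Proof.
apply: naturally_isomorphic_sym; exists (@germ_bis_hom R); split=> [D|D D' f].
  exact: germ_bis_iso.
apply: tbis_arrow_ext => s; apply: bis_eq.
set fa := fhom F f; rewrite [RHS](sval_j1 (fa : tgpd_arrow _ _)).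
have h1 := @scalar_group1 R.
apply/seteqP; split=> k.
  move=> [x sx <-]; have sx' : sdomain s (dual_map f x) by apply/j1_domain.
  exists (gtot [set 1] s (dual_map f x)), x; split.
  - by exists (dual_map f x).
  - by rewrite germ_arrow_anchor /= gtot_d.
  - by rewrite /= tact_unit.
move=> [_ [x [[y sy <-] ]]]; rewrite germ_arrow_anchor /= gtot_d// => xy ->.
subst y; rewrite tact_unit//; exists x => //; exact/j1_domain.
Qed.
End GermBisNatural.

(** * The groupoid as germs of its bisections *)

Section EtaleSections.
Variables (X : topologicalType) (K : gpd_data X).
Hypothesis bK : boolean_groupoid K.
Let hK := bgpd_gpd bK.

(** Where d is injective, an element [h] near [sg x] has to be the value of [sg] at its own
    domain. *)
Lemma section_open (U : set X) (sg : X -> K) : open U -> {within U, continuous sg} ->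
  (forall x, U x -> gd (sg x) = x) -> open (sg @` U).
Proof.
move=> oU csg dsg; apply: open_near => _ [x Ux <-].
have [V [oV Vs [[_ [g gK _]] _]]] := bgpd_d bK (sg x).
have nV : nbhs (sg x) V by exact: open_nbhs_nbhs.
have nx : \forall y \near x, V (sg y) := continuous_near (within_cont_at oU csg Ux) nV.
have nU : nbhs x U by exact: open_nbhs_nbhs.
have nd : \forall h \near sg x, (U `&` [set y | V (sg y)]) (gd h).
  by apply: (gd_cont hK); rewrite dsg//; exact: filterI.
apply: filterS2 nV nd => h Vh [Uh Vsh]; exists (gd h) => //.
by rewrite -(gK _ Vsh) -[RHS](gK _ Vh) dsg.
Qed.

Lemma bisection_through (g : K) : exists2 B : set K, is_bisection B & B g.
Proof.
have [V [oV Vg [[_ [a aK ca]] odV]]] := bgpd_d bK g.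
have [V' [oV' V'g [[_ [t tK ct]] orV]]] := bgpd_r bK g.
have dg : (@gd X K @` V) (gd g) by exists g.
have nx : \forall y \near gd g, (@gd X K @` V) y by exact: open_nbhs_nbhs.
have ny : \forall y \near gd g, V' (a y).
  apply: continuous_near (within_cont_at odV ca dg) _; rewrite aK//.
  exact: open_nbhs_nbhs.
(* [U] is chosen so small that the local inverse [a] of d takes its values in [V'], where r is a
   homeomorphism onto an open set. *)
have [U [cU Ux UV]] := boolean_space_copen (bgpd_X bK) (filterI nx ny).
have Ud : U `<=` @gd X K @` V by move=> y /UV [].
have cUa : {within U, continuous a} := within_cont_sub Ud ca.
have da y : U y -> gd (a y) = y by move=> /Ud [h Vh <-]; rewrite aK.
have oB := section_open cU.2 cUa da.
exists (a @` U); last by exists (gd g) => //; exact: aK.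
have BV' : a @` U `<=` V' by move=> _ [y /UV [_ V'y] <-].
have rV' : @gr X K @` (a @` U) `<=` @gr X K @` V' by exact: image_subset.
apply/(bisectionP hK); split; first by exists U, a.
exists (@gr X K @` (a @` U)), (fun y => gi (t y)); split.
- split.
    apply: within_compact_image; first exact: within_compact_image cU.1 cUa.
    by apply: continuous_subspaceT; exact: (gr_cont hK).
  apply: open_near => _ [b Bb <-].
  have rb : (@gr X K @` V') (gr b) by exists b => //; exact: BV'.
  have nr : \forall y \near gr b, (@gr X K @` V') y by exact: open_nbhs_nbhs.
  have nt : \forall y \near gr b, (a @` U) (t y).
    apply: continuous_near (within_cont_at orV ct rb) _; rewrite tK; last exact: BV'.
    exact: open_nbhs_nbhs.
  by apply: filterS2 nr nt => _ [h V'h <-]; rewrite tK// => Bh; exists h.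
- apply: within_cont_postcomp (within_cont_sub rV' ct); exact: (gi_cont hK).
- by move=> _ [b Bb <-]; rewrite (gd_i hK) tK//; exact: BV'.
- apply/seteqP; split=> k.
    by move=> [b Bb <-]; exists (gr b); [exists b|rewrite tK//; exact: BV'].
  by move=> [_ [b Bb <-] <-]; exists b => //; rewrite tK//; exact: BV'.
Qed.
End EtaleSections.

(** * Arrows given by isomorphisms of twisted groupoids *)

Section TgpdIso.
Variable R : realType.

Record tgpd_iso (D D' : tgpd R) (u : tgX D -> tgX D') (v : tgX D' -> tgX D)
    (psi : tgS D -> tgS D') (chi : tgS D' -> tgS D) : Prop := TgpdIso {
  iso_uK : cancel u v;
  iso_vK : cancel v u;
  iso_psiK : cancel psi chi;
  iso_chiK : cancel chi psi;
  iso_u : continuous u;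
  iso_v : continuous v;
  iso_psi : continuous psi;
  iso_chi : continuous chi;
  iso_d : forall l, gd (psi l) = u (gd l);
  iso_r : forall l, gr (psi l) = u (gr l);
  iso_m : forall l m, gd l = gr m -> psi (gm l m) = gm (psi l) (psi m);
  iso_sc : forall z l, circle z -> psi (tsc z l) = tsc z (psi l) }.

Lemma tgpd_iso_sym D D' u v psi chi :
  @tgpd_iso D D' u v psi chi -> @tgpd_iso D' D v u chi psi.
Proof.
move=> I; have pI := can_inj (iso_psiK I); have uI := can_inj (iso_uK I).
have d l : gd (chi l) = v (gd l).
  by apply: uI; rewrite -(iso_d I) (iso_chiK I) (iso_vK I).
have r l : gr (chi l) = v (gr l).
  by apply: uI; rewrite -(iso_r I) (iso_chiK I) (iso_vK I).
split=> //; try by case: I.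
- by move=> l m lm; apply: pI; rewrite (iso_m I) ?d ?r ?lm// !(iso_chiK I).
- by move=> z l cz; apply: pI; rewrite (iso_sc I)// !(iso_chiK I).
Qed.

Section Arrow.
Variables (D D' : tgpd R) (u : tgX D -> tgX D') (v : tgX D' -> tgX D).
Variables (psi : tgS D -> tgS D') (chi : tgS D' -> tgS D).
Hypothesis I : tgpd_iso u v psi chi.
Let hS : topological_groupoid (tgS D) := tgpdS (tgpdP D).
Let hS' : topological_groupoid (tgS D') := tgpdS (tgpdP D').

(** The image of a unit is an idempotent of the groupoid, hence a unit by cancellation. *)
Lemma iso_unit x : psi (gu x) = gu (u x).
Proof.
have ed : gd (psi (gu x)) = u x by rewrite (iso_d I) (gd_u hS).
have er : gr (psi (gu x)) = u x by rewrite (iso_r I) (gr_u hS).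
have e : gm (psi (gu x)) (psi (gu x)) = psi (gu x).
  rewrite -(iso_m I) ?(gd_u hS) ?(gr_u hS)//.
  by rewrite -{1}(gr_u hS x : gr (gu x : tgS D) = x) (gm1g hS).
have := gmKg hS' (a := psi (gu x)) (b := psi (gu x)).
by rewrite ed er e (gmVg hS') ed => /(_ erefl).
Qed.

(** The action by left multiplication through [psi]; its moment map uses the inverse [v], since
    anchors run against arrows. *)
Definition iso_data : tgpd_arrow_data D D' :=
  @TgpdArrowData R D D' (fun s => v (gr s))
    (fun l s => if `[< gd l = v (gr s) >] then gm (psi l) s else s).

Lemma iso_tact l s : gd l = v (gr s) -> tact iso_data l s = gm (psi l) s.
Proof. by move=> ls /=; case: asboolP. Qed.

Lemma iso_is_arrow : is_tgpd_arrow iso_data.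
Proof.
have aE := iso_tact.
have dr l (s : tgS D') : gd l = v (gr s) -> gd (psi l) = gr s.
  by move=> ls; rewrite (iso_d I) ls (iso_vK I).
split.
- by move=> s; apply: continuous_comp; [exact: (gr_cont hS')|exact: (iso_v I)].
- apply: (within_cont_eq (f := fun z => gm (psi z.1) z.2)).
    by move=> z /= zz; case: asboolP.
  apply: (Defs.within_continuous_comp
    (f := fun z : tgS D * tgS D' => (psi z.1, z.2)) _ _ (gm_cont hS')).
    by move=> z /= /dr.
  apply: continuous_subspaceT => z; apply: cvg_pair; last exact: cvg_snd.
  by apply: (@continuous_comp _ _ _ fst psi); [exact: cvg_fst|exact: (iso_psi I)].
- by move=> l s ls; rewrite aE// [LHS]/= (gr_m hS' (dr _ _ ls)) (iso_r I) (iso_uK I).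
- by move=> s; rewrite aE ?(gd_u hS)//= iso_unit (iso_vK I) (gm1g hS').
- move=> l m s lm ms; have ms' := dr _ _ ms.
  have lr : gd (psi l) = gr (psi m) by rewrite (iso_d I) (iso_r I) lm.
  rewrite (aE m)// !aE ?(gd_m hS)//= ?(gr_m hS')// ?(iso_m I)//.
    by rewrite (gmA hS').
  by rewrite (iso_r I) (iso_uK I).
- by move=> s t st /=; rewrite (gr_m hS').
- by move=> l s ls; rewrite aE// (gd_m hS' (dr _ _ ls)).
- by move=> l s t ls st; rewrite !aE ?(gr_m hS')// (gmA hS') ?(dr _ _ ls).
- move=> l s z cz ls; rewrite !aE ?tsc_d ?tsc_r// (iso_sc I)//.
  by rewrite tsc_gml ?tsc_gmr// (dr _ _ ls).
- move=> K cK; rewrite (_ : _ @^-1` K = u @` K).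
    by apply: continuous_compact cK; apply: continuous_subspaceT; exact: (iso_u I).
  apply/seteqP; split=> x; rewrite /anchor0 /= ?(gr_u hS').
    by move=> Kx; exists (v x) => //; exact: (iso_vK I).
  by move=> [y Ky <-]; rewrite (iso_uK I).
- by move=> l s ls /=; case: asboolP.
Qed.

Definition iso_arrow : tgpd_arrow D D' := TgpdArrow iso_is_arrow.

Lemma iso_anchor x : anchor0 iso_arrow x = v x.
Proof. by rewrite /anchor0 /= (gr_u hS'). Qed.

Lemma iso_tact_u l x : gd l = v x -> tact iso_arrow l (gu x) = psi l.
Proof.
move=> lx; rewrite [LHS]iso_tact ?(gr_u hS')//.
have <- : gd (psi l) = x by rewrite (iso_d I) lx (iso_vK I).
exact: (gmg1 hS').
Qed.
End Arrow.

Lemma iso_arrow_cmp D D' u v psi chi (I : @tgpd_iso D D' u v psi chi)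
    (J : @tgpd_iso D' D v u chi psi) :
  tgpd_comp (iso_arrow J) (iso_arrow I) = tgpd_id D.
Proof.
have hS := tgpdS (tgpdP D); have hS' := tgpdS (tgpdP D').
have cE x : anchor0 (tgpd_comp (iso_arrow J) (iso_arrow I)) x = x.
  by rewrite /anchor0 /= (gr_u hS) (gr_u hS') (iso_uK I).
apply: tgpd_arrow_ext => [x|l x]; rewrite cE.
  by rewrite /anchor0 /= (gr_u hS).
have aE y : tanc (iso_arrow J) (gu y) = u y by rewrite -[LHS]/(anchor0 (iso_arrow J) y) iso_anchor.
move=> lx.
have e1 : tact (iso_arrow I) l (gu (u x)) = psi l.
  by apply: iso_tact_u; rewrite (iso_uK I).
have e2 : tact (iso_arrow J) (psi l) (gu x) = l.
  by rewrite iso_tact_u ?(iso_psiK I)// (iso_d I) lx.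
transitivity (tact (iso_arrow J) (tact (iso_arrow I) l (gu (u x))) (gu x)).
  by rewrite -aE.
rewrite e1 e2 /= (gr_u hS).
by case: asboolP => // _; rewrite -lx (gmg1 hS).
Qed.

Lemma iso_arrow_iso D D' u v psi chi (I : @tgpd_iso D D' u v psi chi) :
  is_iso (iso_arrow I : Defs.hom (D : TBG R) D').
Proof.
exists (iso_arrow (tgpd_iso_sym I)); first exact: iso_arrow_cmp.
exact: iso_arrow_cmp.
Qed.
End TgpdIso.

Section BisGerm.
Variables (R : realType) (D : tgpd R).
Local Notation X := (tgX D).
Local Notation G := (tgG D).
Local Notation S := (tgS D).
Let P := tgpdP D.
Let hG : topological_groupoid G := bgpd_gpd (tgpdG P).
Let hS : topological_groupoid S := tgpdS P.
Let bX : boolean_space X := bgpd_X (tgpdG P).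
Let Bis : tbis R := Tbis (bis_is_tbis D).
Let Gam : tgpd R := Tgpd (germ_is_tgpd Bis).
Let h1 := @scalar_group1 R.
Let hc := @scalar_group_circle R.
Local Notation chr := (chr hG bX).
Local Notation pt := (pt hG bX).
Local Notation gS := (@gtot R Bis [set 1]).
Local Notation gG := (@gtot R Bis (@circle R)).
Implicit Types (s t : S) (x y : X) (A B : tbS Bis) (k l : germS Bis).

(** A lifted bisection meets the fibre of [s], and a constant scalar rotates it so that it contains
    [s]. *)
Lemma bisection_throughS s : exists A, sval A s.
Proof.
have [B bB Bs] := bisection_through (tgpdG P) (tgp s).
have [A bA AB] := bisection_lift bB.
have [t At /tgp_eq [z cz sE]] : (@tgp _ D @` A) (tgp s) by rewrite AB.
have bA' : is_bisection (@tsc _ D z @` A).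
  apply: section_bisection; last first.
    rewrite (_ : _ @` _ = B)// -AB image_comp; apply: eq_imagel => u _ /=.
    exact: tgp_tsc.
  have /(bisectionP hS) [[U [sg [cU csg dsg AE]]] _] := bA.
  exists U, (fun x => tsc z (sg x)); split=> //.
  - apply: within_cont_open => x Ux W nW.
    have [W1 [N [nz nN WN]]] := tsc_nbhs cz nW.
    apply: filterS (continuous_near (within_cont_at cU.2 csg Ux) nN) => y Ny.
    by apply: WN => //; exact: nbhs_singleton.
  - by move=> x Ux; rewrite tsc_d// dsg.
  - by rewrite AE image_comp.
by exists (exist _ _ bA'); exists t.
Qed.

Lemma bis_sdomain A s : sval A s -> sdomain A (chr (gd s)).
Proof.
move=> As; apply/(bis_dom hG bX); rewrite sval_tbp; exists (tgp s); first by exists s.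
exact: (tgpd_d P).
Qed.

Lemma bis_sphi A s : sval A s -> sphi A (chr (gd s)) = chr (gr s).
Proof.
move=> As; rewrite /sphi -(tgpd_d P) -(tgpd_r P); apply: bis_phi.
by rewrite sval_tbp; exists s.
Qed.

Lemma bis_sdomainP A x : sdomain A (chr x) -> exists2 s, sval A s & gd s = x.
Proof.
move=> /(bis_dom hG bX); rewrite sval_tbp => -[_ [s As <-]] /esym.
by rewrite (tgpd_d P) => xE; exists s.
Qed.

Lemma bis_germP k : exists A s, sval A s /\ k = gS A (chr (gd s)).
Proof.
have [A [c [Ac ->]]] := gSP k; rewrite -(ptK hG bX c) in Ac *.
by have [s As <-] := bis_sdomainP Ac; exists A, s.
Qed.

Lemma mem_ti A s (h : dual (tbG Bis) -> C R) : is_TX h -> h (chr (gd s)) != 0 -> sval A s ->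
  sval (A ** tbi h) (tsc (h (chr (gd s))) s).
Proof.
move=> hT h0 As.
have -> : sval (A ** tbi h) = set_gm (sval A) (graph (h \o chr)).
  by rewrite [LHS](sval_mul hS bX); congr set_gm; exact: sval_tbi.
have ch := TX_circle hT h0; exists s, (tgi (gd s) (h (chr (gd s)))); split=> //.
- by exists (gd s).
- by rewrite (tgpd_ri P).
- by rewrite /tsc (tgpd_central P).
Qed.

(** An equality of germs makes one bisection, [A ** tbi a], contain both [s] and [t], the two
    functions having value 1 at the common domain. *)
Lemma bis_germ_value A B s t : sval A s -> sval B t ->
  gS A (chr (gd s)) = gS B (chr (gd t)) -> s = t.
Proof.
move=> As Bt e.
have dst : gd s = gd t.
  by have := congr1 (@germ_d _ Bis _) e; rewrite !(gtot_d h1) => /(can_inj (chrK hG bX)).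
have := e; rewrite -dst => /(gtot_eq h1 (bis_sdomain As)).
rewrite {1}dst => /(_ (bis_sdomain Bt)) [a [b [aT bT a1 b1 ab]]].
have n1 : (1 : C R) != 0 by exact: oner_neq0.
have As' : sval (A ** tbi a) s.
  by rewrite -(tsc_1 s) -{1}a1; apply: mem_ti => //; rewrite a1.
have Bt' : sval (A ** tbi a) t.
  by rewrite ab -(tsc_1 t) -{1}b1 dst; apply: mem_ti => //; rewrite -dst b1.
exact: (bisection_injd hS (svalP (A ** tbi a))).
Qed.

Let value_ex k : exists s, exists2 A, sval A s & k = gS A (chr (gd s)).
Proof. by have [A [s [As kE]]] := bis_germP k; exists s, A. Qed.

Definition germ_value k : S := sval (cid (value_ex k)).
Definition bis_at s : tbS Bis := sval (cid (bisection_throughS s)).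
Definition value_germ s : germS Bis := gS (bis_at s) (chr (gd s)).

Lemma germ_valueE A s : sval A s -> germ_value (gS A (chr (gd s))) = s.
Proof.
by move=> As; rewrite /germ_value; case: cid => t [B Bt e]; exact/esym/(bis_germ_value As Bt e).
Qed.

Lemma value_germK : cancel value_germ germ_value.
Proof. by move=> s; apply: germ_valueE; rewrite /bis_at; case: cid. Qed.

Lemma germ_value_sc k z : circle z -> germ_value (germ_sc k z) = tsc z (germ_value k).
Proof.
move=> cz; have [A [s [As ->]]] := bis_germP k.
have [c [cT cx _ ->]] := scP (bis_sdomain As) cz.
have c0 : c (chr (gd s)) != 0 by rewrite cx; exact: circle_neq0.
have := germ_valueE (mem_ti cT c0 As); rewrite cx tsc_d// => ->.
by rewrite germ_valueE.
Qed.

(** The images of [A] and [B] in G are open, so they agree over a neighbourhood of the domain of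
    [s]. Above it [A] and [B] may still differ by scalars, hence the coarser germs. *)
Lemma bis_p_local A B s : sval A s -> sval B s ->
  gG A (chr (gd s)) = gG B (chr (gd s)).
Proof.
move=> As Bs; set x := gd s.
have bA := svalP (tbp A : tbG Bis); have bB := svalP (tbp B : tbG Bis).
have pA : sval (tbp A : tbG Bis) (tgp s) by rewrite sval_tbp; exists s.
have pB : sval (tbp B : tbG Bis) (tgp s) by rewrite sval_tbp; exists s.
have [[UA [a [cUA ca da AE]]] _] := (bisectionP hG _).1 bA.
have [[UB [b [cUB cb db BE]]] _] := (bisectionP hG _).1 bB.
have [UAx ax] : UA x /\ a x = tgp s.
  by move: pA; rewrite AE => -[y Uy e]; rewrite /x -(tgpd_d P) -e da.
have nB : nbhs (a x) (sval (tbp B : tbG Bis)).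
  apply: open_nbhs_nbhs; split; last by rewrite ax.
  by rewrite BE; exact: (section_open (tgpdG P) cUB.2 cb db).
have nU : nbhs x UA by apply: open_nbhs_nbhs; split=> //; exact: cUA.2.
have [U [cU Ux UV]] := boolean_space_copen bX
  (filterI nU (continuous_near (within_cont_at cUA.2 ca UAx) nB)).
pose e : tbS Bis := ubis S U.
have Ee : idem e by exact: ubis_idem.
have ex : sdomain e (chr x).
  have ue : sval e (gu x) by rewrite sval_ubis//; exists x.
  by have := bis_sdomain ue; rewrite (gd_u hS).
rewrite -(gtot_mul_idem hc Ee (bis_sdomain As) ex) -(gtot_mul_idem hc Ee (bis_sdomain Bs) ex).
apply: gG_eq; last by apply/sdomain_mul; rewrite sphi_idem//; split=> //; exact: bis_sdomain.
rewrite !(tbisM (tbisP Bis)) [tbp e](tbp_ubis cU); apply: bis_eq.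
rewrite !(sval_mul hG bX) !(sval_ubis hG)// !(set_gm_units_r hG); apply/seteqP; split=> g [].
  rewrite {1}AE => -[y UAy <-]; rewrite /= da// => Uy; split=> //.
  by have [] := UV _ Uy.
move=> Bg Ug; split=> //; have [UAg ag] := UV _ Ug.
rewrite (bisection_injd hG bB Bg ag) ?da// AE.
by exists (gd g).
Qed.

(** Germs with the same value agree in G, hence differ by a scalar; comparing values, freeness makes
    it 1. *)
Lemma germ_value_inj : injective germ_value.
Proof.
move=> k l; have [A [s [As ->]]] := bis_germP k; have [B [t [Bt ->]]] := bis_germP l.
rewrite !germ_valueE// => st; subst t.
have [z cz e] : exists2 z, circle z & gS B (chr (gd s)) = germ_sc (gS A (chr (gd s))) z.
  by apply: gS_p_eq; rewrite !germ_pE; [exact: bis_p_local|exact: bis_sdomain|exact: bis_sdomain].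
have := congr1 germ_value e; rewrite germ_value_sc// !germ_valueE// => sE.
have z1 : 1 = z by apply: (@tsc_inj _ D _ _ s) => //; [exact: circle1|rewrite tsc_1].
by rewrite e -z1 sc_1.
Qed.

Lemma germ_valueK : cancel germ_value value_germ.
Proof. by move=> k; apply: germ_value_inj; rewrite value_germK. Qed.

Lemma germ_value_continuous : continuous (germ_value : germS Bis -> S).
Proof.
move=> k; have [A [s [As ->]]] := bis_germP k => W nW; rewrite nbhs_simpl /= -(sc_1 (gS A _)).
move: nW; rewrite germ_valueE// -{1}(tsc_1 s) => nW.
have [W1 [N [n1 nN WN]]] := tsc_nbhs (circle1 R) nW.
have [[U [sg [cU csg dsg AE]]] _] := (bisectionP hS _).1 (svalP A).
have [Us sgs] : U (gd s) /\ sg (gd s) = s.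
  by move: As; rewrite AE => -[y Uy <-]; rewrite dsg.
have nx : \forall y \near gd s, N (sg y).
  by apply: continuous_near (within_cont_at cU.2 csg Us) _; rewrite sgs.
apply/(germS_nbhs _ (bis_sdomain As) (circle1 R)).
exists (pt @^-1` [set y | N (sg y)]), W1; split=> //.
  by apply: (pt_continuous (hK := hG) (bX := bX)); rewrite chrK.
move=> c w /= Nc Ac W1w cw; rewrite germ_value_sc//; apply: WN => //.
rewrite -(ptK hG bX c) in Ac *; have [t At te] := bis_sdomainP Ac.
rewrite -te germ_valueE// in Nc *; move: At; rewrite AE => -[y Uy ty].
by move: Nc; rewrite -ty dsg.
Qed.

(** The bisection chosen at a nearby [t] varies without control, so it is replaced by the one at
    [s]. Its image in G is open, so [t] is a scalar multiple of one of its elements, and continuity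
    of division keeps the scalar near 1. *)
Lemma value_germ_continuous : continuous (value_germ : S -> germS Bis).
Proof.
move=> s W; set A := bis_at s.
have As : sval A s by rewrite /A /bis_at; case: cid.
rewrite nbhs_simpl /= /value_germ -/A -{1}(sc_1 (gS A _)).
move=> /(germS_nbhs _ (bis_sdomain As) (circle1 R)) [U [V [nU nV UV]]].
have [B [B' [nB nB' BV]]] := div_nbhs s (circle1 R) nV.
rewrite tsc_1 in nB'.
have [[ O [sg [cO csg dsg AE]]] _] := (bisectionP hS _).1 (svalP A).
have [Os sgs] : O (gd s) /\ sg (gd s) = s.
  by move: As; rewrite AE => -[y Uy <-]; rewrite dsg.
have nO : \forall t \near s, O (gd t).
  by apply: (gd_cont hS); exact: open_nbhs_nbhs (conj cO.2 Os).
have nsx : \forall y \near gd s, B (sg y).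
  by apply: continuous_near (within_cont_at cO.2 csg Os) _; rewrite sgs.
have nsB := continuous_near (gd_cont hS (x := s)) nsx.
have nx : \forall y \near gd s, U (chr y).
  by apply: continuous_near nU; exact: chr_continuous.
have nUt := continuous_near (gd_cont hS (x := s)) nx.
have npA : \forall t \near s, sval (tbp A : tbG Bis) (tgp t).
  apply: (tgpd_cont P); apply: open_nbhs_nbhs; split; last by rewrite sval_tbp; exists s.
  have [[UA [a [cUA ca da ->]]] _] := (bisectionP hG _).1 (svalP (tbp A : tbG Bis)).
  exact: (section_open (tgpdG P) cUA.2 ca da).
apply: filterS (filterI (filterI nO nsB) (filterI nUt (filterI npA nB'))) => t [[Ot Bt] [Ut [pAt B't]]].
move: pAt; rewrite sval_tbp => -[a Aa /tgp_eq [z cz tE]].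
have at_ : a = sg (gd t).
  by move: Aa; rewrite AE tE tsc_d// => -[y Oy <-]; rewrite dsg.
rewrite /= -[gS (bis_at t) _]/(value_germ t).
have -> : value_germ t = germ_sc (gS A (chr (gd t))) z.
  apply: germ_value_inj; rewrite value_germK germ_value_sc//.
  by rewrite [in gd t]tE tsc_d// germ_valueE.
apply: UV => //; first by rewrite tE tsc_d//; exact: bis_sdomain.
by apply: (BV a) => //; [rewrite at_|rewrite -tE].
Qed.

Lemma germ_value_iso : @tgpd_iso R Gam D pt chr germ_value value_germ.
Proof.
split.
- exact: ptK.
- exact: chrK.
- exact: germ_valueK.
- exact: value_germK.
- exact: pt_continuous.
- exact: chr_continuous.
- exact: germ_value_continuous.
- exact: value_germ_continuous.
- move=> k; have [A [s [As ->]]] := bis_germP k.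
  by rewrite germ_valueE//= gtot_d// chrK.
- move=> k; have [A [s [As ->]]] := bis_germP k.
  by rewrite germ_valueE//= gtot_r ?bis_sphi ?chrK//; exact: bis_sdomain.
- move=> k l; have [A [s [As ->]]] := bis_germP k; have [B [t [Bt ->]]] := bis_germP l.
  have As' := bis_sdomain As; have Bt' := bis_sdomain Bt.
  rewrite !germ_valueE//= gtot_d// gtot_r// bis_sphi// => /(can_inj (chrK hG bX)) st.
  have ABst : sval (A ** B) (gm s t) by rewrite (sval_mul hS bX); exists s, t.
  rewrite st -(bis_sphi Bt) gtot_m//; last by rewrite bis_sphi// -st.
  by rewrite -(gd_m hS st) germ_valueE.
- by move=> z k cz; rewrite tsc_germ// germ_value_sc.
Qed.

Definition germ_value_hom : tgpd_arrow Gam D := iso_arrow germ_value_iso.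
End BisGerm.

Section BisGermNatural.
Variable R : realType.
Let F := germ_functor (@germ_is_tgpd R) (@germ_is_tgpd_arrow R).
Let K := bis_functor (@bis_is_tbis R) (@bis_is_tbis_arrow R).

Lemma germ_value_natural : naturally_isomorphic (functor_comp F K) (functor_idm (TBG R)).
Proof.
exists (@germ_value_hom R); split=> [D|D D' f]; first exact: iso_arrow_iso.
pose hG := bgpd_gpd (tgpdG (tgpdP D)); pose hG' := bgpd_gpd (tgpdG (tgpdP D')).
pose bX := bgpd_X (tgpdG (tgpdP D)); pose bX' := bgpd_X (tgpdG (tgpdP D')).
have hS := tgpdS (tgpdP D); have hS' := tgpdS (tgpdP D').
pose fb : tbis_arrow (K D) (K D') := fhom K f.
pose fa : tgpd_arrow (F (K D)) (F (K D')) := fhom F fb.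
(* Read on points, the dual map of the arrow between bisections is the original anchor. *)
have dE : dual_map fb = chr hG bX \o anchor0 f \o pt hG' bX'.
  apply/esym/(dual_map_uniq (j := tbj fb)); first exact: dual_mapP.
  exact: bis_dual_map.
have aE x : anchor0 (germ_value_hom D') x = chr hG' bX' x by exact: iso_anchor.
have faE x : anchor0 fa (chr hG' bX' x) = chr hG bX (anchor0 f x).
  by rewrite [LHS]germ_arrow_anchor dE /= chrK.
apply: (@tgpd_arrow_ext R (F (K D)) D') => [x|k x].
  transitivity (anchor0 fa (anchor0 (germ_value_hom D') x)) => //.
  by rewrite aE faE; apply/esym/iso_anchor.
have [A [s [As ->]]] := bis_germP k.
move=> e; have {e} : chr hG bX (gd s) = chr hG bX (anchor0 f x).
  by rewrite -faE -aE -[LHS](gtot_d (@scalar_group1 R) A).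
move=> /(can_inj (chrK hG bX)) sx.
have ts : tact f s (gu x) = gm (tact f s (gu x)) (gu x).
  by rewrite -{3}(tact_u_d sx) (gmg1 hS').
have dx : sdomain A (dual_map fb (chr hG' bX' x)).
  by rewrite dE /= chrK -sx; exact: bis_sdomain.
have js : sval (tbj1 fb A) (tact f s (gu x)).
  by rewrite [sval _]sval_j1; exists s, x; rewrite sx.
(* Both ways around the square act on the unit at [x] by giving s x, the element of the transported
   bisection with domain [x]. *)
transitivity (tact f s (gu x)).
  transitivity (tact (germ_value_hom D') (tact fa (gtot [set 1] A (chr hG bX (gd s))) (gu (anchor0 (germ_value_hom D') x))) (gu x)) => //.
  rewrite aE.
  have -> : tact fa (gtot [set 1] A (chr hG bX (gd s))) (gu (chr hG' bX' x)) = gtot [set 1] (tbj1 fb A) (chr hG' bX' x).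
    by rewrite -[RHS]tact_unit// dE /= chrK sx.
  rewrite [LHS]iso_tact_u; last exact: (gtot_d (@scalar_group1 R)).
  by rewrite -{1}(tact_u_d sx) germ_valueE.
transitivity (tact f (tact (germ_value_hom D) (gtot [set 1] A (chr hG bX (gd s))) (gu (anchor0 f x))) (gu x)) => //.
rewrite iso_tact_u; last by rewrite [LHS](gtot_d (@scalar_group1 R)) sx.
by rewrite germ_valueE.
Qed.
End BisGermNatural.

Theorem theoremA22 (R : realType) :
  exists (germ_ob : forall D : tbis R, is_tgpd (germ_tgpd D))
         (germ_hom : forall (D D' : tbis R) (f : tbis_arrow D D'),
            is_tgpd_arrow (germ_arrow f))
         (bis_ob : forall D : tgpd R, is_tbis (bis_tbis D))
         (bis_hom : forall (D D' : tgpd R) (f : tgpd_arrow D D'),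
            is_tbis_arrow (bis_arrow f)),
  [/\ forall D : tbis R, germ_formulas D,
      forall (D D' : tbis R) (f : tbis_arrow D D'), germ_arrow_formula f,
      forall D : tgpd R, bis_tbis_formulas D,
      forall (D D' : tgpd R) (f : tgpd_arrow D D'), bis_arrow_formulas f &
      is_equivalence (germ_functor germ_ob germ_hom)
                     (bis_functor bis_ob bis_hom)].
Proof.
exists (@germ_is_tgpd R), (@germ_is_tgpd_arrow R), (@bis_is_tbis R), (@bis_is_tbis_arrow R).
split; [exact: germ_formulasP|exact: germ_arrow_formulaP|exact: bis_tbis_formulasP|
  exact: bis_arrow_formulasP|].
split; [exact: germ_functorP|exact: bis_functorP|exact: germ_bis_natural|
  exact: germ_value_natural].
Qed.
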